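(* Let $U$ be the random velocity field on $\mathbb{R}\times\mathbb{T}^3$ and, for $\kappa\ge 0$, let $B^\kappa:[0,\infty)\times\mathbb{T}^3\to\mathbb{R}^3$ be the random solution of the induction equation with velocity $U$, resistivity $\kappa$ and initial data $-2\sqrt{2}\,\mathrm{e}_y\cos(2\pi x)$, both as defined in the context. Then for all $\kappa \in \big[0,\frac{1}{4\pi^2}\log\frac{\pi}{e}\big]$ there exists an almost surely finite random constant $L^\kappa\ge 1$ such that (almost surely) for all $t\ge 0$, $$\|B^\kappa_t\|_{L^2_x}\ \ge\ \frac{1}{L^\kappa}\,e^{t/2}.$$ Further, there exist constants $p, C>0$, which can be taken uniformly for $\kappa\in\big[0,\frac{1}{4\pi^2}\log\frac{\pi}{e}\big]$ (i.e. independent of $\kappa$), such that $$\mathbb{E}\,(L^\kappa)^p\le C.$$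
   Context: $\mathbb{T}^3=\mathbb{R}^3/\mathbb{Z}^3$ with coordinates $(x,y,z)$, and $\mathrm{e}_x,\mathrm{e}_y,\mathrm{e}_z$ are the standard basis vectors of $\mathbb{R}^3$. Define the vector fields on $\mathbb{T}^3$ $$u_0(x,y,z)=\mathrm{e}_z\sin\big(2\pi(x-y)\big),\quad u_1(x,y,z)=\mathrm{e}_x\sin\big(2\pi(y-z)\big),\quad u_2(x,y,z)=\mathrm{e}_y\sin\big(2\pi(z-x)\big).$$ For $j\in\mathbb{Z}$ let $\theta_j=(\theta_{j,x},\theta_{j,y},\theta_{j,z})$ be i.i.d. uniformly distributed $\mathbb{T}^3$-valued random variables. Let $\eta:\mathbb{R}\to[0,\infty)$ be a fixed smooth function with $\operatorname{supp}\eta\subseteq[0,1]$ and $\int\eta(s)\,ds=1$. Define the random velocity field $$U(t,x,y,z):=\sum_{j\in\mathbb{Z}}\eta(t-j)\,u_{j \bmod 3}(x+\theta_{j,x},\,y+\theta_{j,y},\,z+\theta_{j,z}).$$ (It is divergence-free and smooth, with deterministic bounds on all of its derivatives.) For $\kappa\ge0$, $B^\kappa:[0,\infty)\times\mathbb{T}^3\to\mathbb{R}^3$ denotes the (random) unique solution to $$\partial_t B^\kappa-\kappa\Delta B^\kappa+U\cdot\nabla B^\kappa-B^\kappa\cdot\nabla U=0,\qquad B^\kappa(0,x,y,z)=-2\sqrt{2}\,\mathrm{e}_y\cos(2\pi x).$$ Here $B^\kappa_t:=B^\kappa(t,\cdot)$, $\|\cdot\|_{L^2_x}$ is the $L^2(\mathbb{T}^3;\mathbb{R}^3)$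 norm, and $\mathbb{E}$ is expectation with respect to the law of $(\theta_j)_{j\in\mathbb{Z}}$. *)

(* Defs.v *)
From HB Require Import structures.
From mathcomp Require Import all_boot all_order all_algebra.
From mathcomp Require Import all_classical all_reals all_analysis.

Set Implicit Arguments.
Unset Strict Implicit.
Unset Printing Implicit Defensive.

Import Order.TTheory GRing.Theory Num.Theory.
Import numFieldNormedType.Exports.

Local Open Scope classical_set_scope.
Local Open Scope ring_scope.

(* The triple product carries both the topology (for derivatives) and the
   Borel sigma-algebra (for laws and integrals). Its library norm is the sup
   norm, so the Euclidean norm used in L^2 is introduced separately. *)
Notation R3 R := (R * R * R)%type.

Section VectorCalculus.
Context {R : realType}.
Implicit Types (p v : R3 R) (i j : 'I_3).

Definition comp3 v i : R := [:: v.1.1; v.1.2; v.2]`_i.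

Definition basis3 i : R3 R :=
  ((i == 0 :> nat)%:R, (i == 1 :> nat)%:R, (i == 2 :> nat)%:R).

Definition e_x : R3 R := (1, 0, 0).
Definition e_y : R3 R := (0, 1, 0).
Definition e_z : R3 R := (0, 0, 1).

Definition sqnorm3 v : R := \sum_(i < 3) comp3 v i ^+ 2.

(* u . nabla F *)
Definition advect (u F : R3 R -> R3 R) p : R3 R :=
  \sum_(i < 3) comp3 (u p) i *: 'D_(basis3 i) F p.

Definition laplacian (F : R3 R -> R3 R) p : R3 R :=
  \sum_(i < 3) 'D_(basis3 i) ('D_(basis3 i) F) p.

(* Functions on T^3 = R^3 / Z^3 are Z^3-periodic functions on R^3. *)
Definition Z3_periodic (F : R3 R -> R3 R) : Prop :=
  forall p (a b c : int), F (p + (a%:~R, b%:~R, c%:~R)) = F p.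

(* [cube] is the fundamental domain [0,1)^3 of T^3; [lebesgue3] restricted to
   it represents the normalised Haar measure of T^3. The library's Lebesgue
   measure lives on [measurableTypeR R], which has the same carrier and the
   same (Borel) measurable sets as R. *)
Definition cube : set (R3 R) := [set p | forall i, 0 <= comp3 p i < 1].

Definition lebesgue3 : {measure set (R3 (measurableTypeR R)) -> \bar R} :=
  ((@lebesgue_measure R \x @lebesgue_measure R) \x @lebesgue_measure R)%E.

Definition L2norm (F : R3 R -> R3 R) : R :=
  Num.sqrt (\int[lebesgue3]_(p in cube) sqnorm3 (F p)).

End VectorCalculus.

Section RandomPhases.
Context {R : realType} {d : measure_display} {T : measurableType d}.
Variable P : probability T R.

Definition mutually_independent {I : choiceType} {d' : measure_display}
    {T' : measurableType d'} (X : I -> {RV P >-> T'}) : Prop :=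
  forall (s : seq I) (A : I -> set T'), uniq s ->
    (forall i, measurable (A i)) ->
    P (\bigcap_(i in [set` s]) (X i @^-1` A i)) =
    (\prod_(i <- s) P (X i @^-1` A i))%E.

(* A T^3-valued random variable is given by its representative in [0,1)^3. *)
Definition uniform_on_torus (X : {RV P >-> R3 R}) : Prop :=
  forall A : set (R3 R), measurable A ->
    distribution P X A = lebesgue3 (A `&` cube).

Definition iid_uniform_on_torus (theta : int -> {RV P >-> R3 R}) : Prop :=
  mutually_independent theta /\ forall j, uniform_on_torus (theta j).

End RandomPhases.

Section Induction.
Context {R : realType}.

Definition smooth (f : R -> R) : Prop :=
  forall n s, derivable (derive1n n f) s 1.

Definition is_time_profile (eta : R -> R) : Prop :=
  [/\ smooth eta,
      forall s, 0 <= eta s,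
      closure [set s | eta s != 0] `<=` `[0, 1] &
      (\int[lebesgue_measure]_(s in setT) (eta s)%:E)%E = 1%:E].

Definition shear (m : nat) (p : R3 R) : R3 R :=
  let: (x, y, z) := p in
  match m with
  | 0%N => sin (2 * pi * (x - y)) *: e_z
  | 1%N => sin (2 * pi * (y - z)) *: e_x
  | _ => sin (2 * pi * (z - x)) *: e_y
  end.

(* The sum over Z is the library's finitely supported sum: for fixed t at most
   one term is nonzero, since supp eta is contained in [0,1] and eta, being
   continuous, vanishes at 0 and 1. *)
Definition velocity (eta : R -> R) (theta : int -> R3 R) (t : R) (p : R3 R)
    : R3 R :=
  \sum_(j \in [set: int])
    eta (t - j%:~R) *: shear `|(j %% 3)%Z|%N (p + theta j).

Definition jointly_continuous_for_positive_times (F : R -> R3 R -> R3 R)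
    : Prop :=
  forall t p, 0 < t ->
    {for (t, p), continuous (fun q : R * R3 R => F q.1 q.2)}.

(* Values of B at negative times are irrelevant. *)
Definition C1_2_for_positive_times (B : R -> R3 R -> R3 R) : Prop :=
  [/\ forall t p, 0 < t -> derivable (B ^~ p) t 1,
      jointly_continuous_for_positive_times (fun t p => 'D_1 (B ^~ p) t),
      forall i, (forall t p, 0 < t -> derivable (B t) p (basis3 i)) /\
        jointly_continuous_for_positive_times (fun t => 'D_(basis3 i) (B t)) &
      forall i j,
        (forall t p, 0 < t ->
           derivable ('D_(basis3 i) (B t)) p (basis3 j)) /\
        jointly_continuous_for_positive_times
          (fun t => 'D_(basis3 j) ('D_(basis3 i) (B t)))].

(* Classical solution on [0,oo) x T^3 of
     d_t B - kappa Lap B + U . nabla B - B . nabla U = 0,   B(0) = B0. *)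
Definition induction_solution (kappa : R) (U : R -> R3 R -> R3 R)
    (B0 : R3 R -> R3 R) (B : R -> R3 R -> R3 R) : Prop :=
  [/\ forall t, 0 <= t -> Z3_periodic (B t),
      {within [set q : R * R3 R | 0 <= q.1],
         continuous (fun q => B q.1 q.2)},
      C1_2_for_positive_times B,
      forall t p, 0 < t ->
        'D_1 (B ^~ p) t - kappa *: laplacian (B t) p
        + advect (U t) (B t) p - advect (B t) (U t) p = 0 &
      forall p, B 0 p = B0 p].

Definition initial_field (p : R3 R) : R3 R :=
  (- (2 * Num.sqrt 2) * cos (2 * pi * p.1.1)) *: e_y.

End Induction.

(* Main.v *)
(** During [n, n + 1] only the field [B_ga] (axes al, be, ga in cyclic order) is
    stretched, by the shear [eta sin(2 pi (p_al - p_be + phi)) e_ga] with a fresh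
    uniform phase phi. Let [Y n] be the Fourier coefficient of [B_al - B_be] at
    time n and mode [e_al]. Integrating the Fourier coefficients exactly gives
    [|Y (n+1)| = |a + b exp(i psi) + c exp(- i psi)|], [psi = 2 pi phi], where a, b, c
    depend only on the phases before n and [|b| = pi exp(- 4 pi^2 kappa) |Y n|],
    which is at least [e |Y n|] in the given range of kappa.

    By Jensen's formula the mean over psi of [log |a + b exp(i psi) + c exp(- i psi)|^2]
    is at least [log |b|^2]; a uniform anti-concentration bound turns this into
    [E |a + ...|^(-2p) <= exp(p/2) |b|^(-2p)] for one small p, uniformly in a, b, c.
    Hence [E |Y n|^(-2p)] decays like [exp(- 3 p n / 2)], so that
    [sum_n exp(p n) |Y n|^(-2p)] has a finite mean bounded independently of kappa,
    and this sum controls the random constant, since the L2 norm of [B_t] dominates a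
    constant multiple of [|Y n|] on [n, n + 1]. *)

Require Import Defs.
From HB Require Import structures.
From mathcomp Require Import all_boot all_order all_algebra.
From mathcomp Require Import all_classical all_reals all_analysis.
From mathcomp Require Import measurable_realfun lebesgue_integral_under.
From mathcomp Require Import complex zify ring lra.
Import Order.TTheory GRing.Theory Num.Theory.
Import numFieldNormedType.Exports.

Set Implicit Arguments.
Unset Strict Implicit.
Unset Printing Implicit Defensive.

Local Open Scope classical_set_scope.
Local Open Scope ring_scope.
Local Open Scope complex_scope.

(** The mode is chosen so that [Y n] feeds [Y (n + 1)] exactly. Every frequency met in step n is a
    combination of [e_al] and [e_be], hence orthogonal to the direction [e_ga] of the velocity:
    transport contributes nothing, and only heat decay and stretching remain. At time n + 1 the axes
    turn to (be, ga, al), and the stretching factor, of frequency [e_al - e_be], times the new mode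
    [e_be] gives back [e_al]. As [e_al] and [e_be] decay at the same rate, the profile enters the
    weight of [Y n] only through its integral 1; the factor pi is 2 pi, from differentiating the
    sine, times 1/2, from a product of cosines.

    The moment step needs the phase of step n to be independent of a, b, c. But the solution is
    given sample by sample, with no measurability assumed. A maximum principle fills this gap: it
    bounds the effect of changing the phases, so that the field at time n is a continuous function
    of the phases before n, and therefore measurable for their sigma-algebra. *)

(** The radius [r] may depend on the point, and no factorisation of [f] through the [X i] is given:
    separability of R^n turns pointwise continuity in the observables into measurability. Used with
    the coordinates of the torus and, for the solution, with the past phases. *)
Lemma measurable_fun_of_modulus {R : realType} d (T : measurableType d) (n : nat)
    (X : 'I_n -> T -> R) (f : T -> R) :
  (forall i, measurable_fun setT (X i)) ->
  (forall (w : T) (e : R), 0 < e -> exists2 r : R, 0 < r &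
     forall w', (forall i, `|X i w - X i w'| < r) -> `|f w - f w'| < e) ->
  measurable_fun setT f.
Proof.
move=> mX modf.
apply: (measurability _ (RGenOInfty.measurableE R)) => //.
move=> _ [_ [a ->] <-]; rewrite setTI.
(* The superlevel set is the union of the rational cylinders it contains. *)
pose cyl (c : n.-tuple rat * rat) : set T :=
  [set w | forall i, `|X i w - ratr (tnth c.1 i)| < ratr c.2].
pose O : set T := f @^-1` `]a, +oo[.
pose g (k : nat) : set T :=
  if unpickle k is Some c then if `[< cyl c `<=` O >] then cyl c else set0
  else set0.
have mcyl c : measurable (cyl c).
  rewrite [cyl c](_ : _ = \bigcap_(i in [set: 'I_n])
      (X i @^-1` ball (ratr (tnth c.1 i) : R) (ratr c.2 : R))); last first.
    apply/seteqP; split => [w cw i _|w cw i].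
      by rewrite /preimage/= /ball/= distrC.
    by have := cw i I; rewrite /preimage/= /ball/= distrC.
  apply: fin_bigcap_measurable => [|i _]; first exact: finite_finset.
  by rewrite -[X in measurable X]setTI; apply: mX => //; exact: measurable_ball.
have mg k : measurable (g k).
  by rewrite /g; case: unpickle => [c|//]; case: ifP.
suff OE : O = \bigcup_k g k by rewrite -/O OE; exact: bigcupT_measurable.
apply/seteqP; split => [w|w [k _]]; last first.
  rewrite /g; case: unpickle => [c|//]; case: ifPn => // /asboolP cO; exact: cO.
rewrite /O /preimage/= in_itv/= andbT => afw.
have [r r0 hr] := modf w (f w - a) ltac:(by rewrite subr_gt0).
have [s /andP[s0 sr]] : exists s : rat, (0 < s) && (ratr s < r / 2 :> R).
  have [s] := rat_in_itvoo (divr_gt0 r0 (ltr0n _ 2)).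
  rewrite in_itv/= => /andP[s0 sr]; exists s; rewrite sr andbT.
  by move: s0; rewrite ltr0q.
have /choice[q hq] i : exists q : rat, `|X i w - ratr q| < ratr s :> R.
  have [|q] := @rat_in_itvoo R (X i w - ratr s) (X i w + ratr s).
    by rewrite ltrD2l -subr_gt0 opprK addr_gt0// ltr0q.
  rewrite in_itv/= => /andP[q1 q2]; exists q.
  by rewrite ltr_distl; apply/andP; split; lra.
have cw : cyl ([tuple q i | i < n], s) w.
  by move=> i; rewrite tnth_mktuple.
exists (pickle ([tuple q i | i < n], s)) => //.
rewrite /g pickleK; case: asboolP => // ncO; case: ncO => w' cw'.
 rewrite /O /preimage/= in_itv/= andbT.
have /hr : forall i, `|X i w - X i w'| < r.
  move=> i; have := cw i; have := cw' i; rewrite /= !tnth_mktuple => h1 h2.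
  rewrite (le_lt_trans (ler_distD (ratr (q i)) _ _))//.
  rewrite (_ : r = r / 2 + r / 2); last by rewrite -splitr.
  apply: ltrD; first exact: lt_trans sr.
  by rewrite distrC; exact: lt_trans sr.
rewrite ltr_distl => /andP[_]; rewrite addrCA ltrDl subr_gt0; exact.
Qed.

Lemma ord3_ind (Q : 'I_3 -> Prop) :
  Q (@Ordinal 3 0 isT) -> Q (@Ordinal 3 1 isT) -> Q (@Ordinal 3 2 isT) ->
  forall i, Q i.
Proof.
move=> q0 q1 q2 [[|[|[|k]]] hi]; last by [].
- by rewrite (bool_irrelevance hi isT).
- by rewrite (bool_irrelevance hi isT).
- by rewrite (bool_irrelevance hi isT).
Qed.

(** * Integration over the torus *)

Section TorusIntegral.
Context {R : realType}.
Implicit Types (f g : R3 R -> R) (p : R3 R).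
Local Notation mu1 := (@lebesgue_measure R).
Local Notation I01 := (`[0%R, 1%R[%classic : set (measurableTypeR R)).

Lemma cubeE : cube = (I01 `*` I01) `*` I01 :> set (R3 R).
Proof.
apply/seteqP; split => [[[x y] z] h|[[x y] z] [[hx hy] hz] i] /=.
  have /= h0 := h (inord 0); have /= h1 := h (inord 1); have /= h2 := h (inord 2).
  move: h0 h1 h2; rewrite /comp3/= !inordK//=.
move: i; move: hx hy hz; rewrite /= !in_itv/= => hx hy hz.
exact: ord3_ind.
Qed.

Lemma measurable_I01 : measurable I01.
Proof. exact: measurable_itv. Qed.

Lemma measurable_cube : measurable (cube : set (R3 (measurableTypeR R))).
Proof.
rewrite cubeE; apply: measurableX; last exact: measurable_I01.
by apply: measurableX; exact: measurable_I01.
Qed.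

Lemma lebesgue_I01 : mu1 I01 = 1%E.
Proof. by rewrite lebesgue_measure_itv/= lte01 sube0. Qed.

Lemma lebesgue3_cube : @lebesgue3 R cube = 1%E.
Proof.
rewrite cubeE /lebesgue3.
have m2 : measurable (I01 `*` I01) by apply: measurableX; exact: measurable_I01.
rewrite [LHS](product_measure1E (mu1 \x mu1)%E mu1 m2 measurable_I01)/=.
rewrite [X in (X * _)%E](product_measure1E mu1 mu1 measurable_I01 measurable_I01).
by rewrite /= lebesgue_I01 !mule1.
Qed.

Lemma continuous_modulus3 f : continuous f ->
  forall (p : R3 R) (e : R), 0 < e -> exists2 r : R, 0 < r &
     forall q, (forall i, `|comp3 p i - comp3 q i| < r) -> `|f p - f q| < e.
Proof.
move=> cf p e e0; have /cvgrPdist_lt /(_ e e0) := cf p.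
rewrite -nbhs_ballE => -[r /= r0 h]; exists r => // q hq.
apply: h; case: p q hq => [[x y] z] [[x' y'] z'] hq.
have /= h0 := hq (inord 0); have /= h1 := hq (inord 1).
have /= h2 := hq (inord 2); move: h0 h1 h2; rewrite /comp3/= !inordK//=.
Qed.

Lemma measurable_comp3 (i : 'I_3) : measurable_fun setT
  ((fun p => comp3 p i) : R3 (measurableTypeR R) -> R).
Proof.
move: i; apply: ord3_ind; rewrite /comp3/=.
- by apply: (measurableT_comp measurable_fst); exact: measurable_fst.
- by apply: (measurableT_comp measurable_snd); exact: measurable_fst.
- exact: measurable_snd.
Qed.

(** Measurability refers to the product sigma-algebra on triples, so open sets have to be countable
    unions of boxes; the coordinates serve as observables. *)
Lemma measurable_continuous3 f : continuous f ->
  measurable_fun setT (f : R3 (measurableTypeR R) -> R).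
Proof.
move=> cf; apply: (@measurable_fun_of_modulus R _ (R3 (measurableTypeR R)) 3
  (fun i p => comp3 p i) f).
  exact: measurable_comp3.
exact: continuous_modulus3.
Qed.

(** The compact companion of the fundamental domain: it bounds continuous functions and carries
    maxima. *)
Definition ccube : set (R3 R) := (`[0, 1] `*` `[0, 1]) `*` `[0, 1].

Lemma cube_ccube : cube `<=` ccube.
Proof.
rewrite cubeE => -[[x y] z]/= [[]]; rewrite !in_itv/= => hx hy hz.
by rewrite /ccube/=; split=> /=; [split => /=|]; rewrite in_itv/=; lra.
Qed.

Lemma compact_ccube : compact ccube.
Proof.
by apply: compact_setX; [apply: compact_setX|]; exact: segment_compact.
Qed.

Lemma bounded_on_box (u : R * R3 R -> R) (a b : R) : continuous u ->
  exists M : R, forall t p, a <= t <= b -> ccube p -> `|u (t, p)| <= M.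
Proof.
move=> cu.
have := @continuous_compact _ _ u (`[a, b] `*` ccube)
  (continuous_subspaceT cu)
  (compact_setX (@segment_compact _ _ _) compact_ccube).
move/compact_bounded => [M [Mr hM]]; exists (M + 1) => t p tab pc.
apply: (hM (M + 1)); first by rewrite ltrDl.
by exists (t, p) => //; split.
Qed.

Lemma bounded_on_ccube f : continuous f ->
  exists M : R, forall p, ccube p -> `|f p| <= M.
Proof.
move=> cf; have [|M hM] := @bounded_on_box (f \o snd) 0 0.
  by move=> q; apply: continuous_comp; [exact: cvg_snd|exact: cf].
by exists M => p pc; apply: (hM 0) => //; rewrite lexx.
Qed.

Lemma integrable_cube f : continuous f ->
  (@lebesgue3 R).-integrable cube (EFin \o f).
Proof.
move=> cf; have [M hM] := bounded_on_ccube cf.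
apply: (@le_integrable _ _ _ _ _ measurable_cube _ (EFin \o cst M)).
- apply/measurable_EFinP; apply: measurable_funTS; exact: measurable_continuous3.
- move=> p pc /=; rewrite lee_fin (le_trans (hM _ (cube_ccube pc)))//.
  exact: ler_norm.
- apply/integrableP; split.
    by apply/measurable_EFinP; exact: measurable_cst.
  rewrite /= integral_cst/=; last exact: measurable_cube.
  by rewrite lebesgue3_cube mule1 ltry.
Qed.

Definition tint f : R := \int[@lebesgue3 R]_(p in cube) f p.

Lemma tintD f g : continuous f -> continuous g ->
  tint (fun p => f p + g p) = tint f + tint g.
Proof.
by move=> cf cg; apply: RintegralD; [exact: measurable_cube|exact: integrable_cube..].
Qed.

Lemma tintZ (a : R) f : continuous f -> tint (fun p => a * f p) = a * tint f.
Proof.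
by move=> cf; apply: RintegralZl; [exact: measurable_cube|exact: integrable_cube].
Qed.

Lemma tint_eq f g : f =1 g -> tint f = tint g.
Proof. by move=> fg; congr tint; exact/funext. Qed.

Lemma tint_le f g : continuous f -> continuous g ->
  (forall p, f p <= g p) -> tint f <= tint g.
Proof.
move=> cf cg fg; apply: le_Rintegral => //.
- exact: measurable_cube.
- exact: integrable_cube.
- exact: integrable_cube.
Qed.

Lemma tint_cst (a : R) : tint (cst a) = a.
Proof.
rewrite /tint Rintegral_cst; last exact: measurable_cube.
by rewrite lebesgue3_cube mulr1.
Qed.

Lemma integrable_patch f : continuous f ->
  (@lebesgue3 R).-integrable setT ((EFin \o f) \_ cube).
Proof.
move=> cf; apply/integrable_restrict; rewrite ?setTI.
- exact: measurable_cube.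
- by [].
- exact: integrable_cube.
Qed.

End TorusIntegral.

Section LineDerivative.
Context {R : realType}.

Lemma is_derive_line (V : normedModType R) (u du : V -> R) (v : V) :
  (forall p, is_derive p v u (du p)) ->
  forall p (s : R), is_derive s (1 : R) (fun s : R => u (p + s *: v)) (du (p + s *: v)).
Proof.
move=> hu p s; have [dv de] := hu (p + s *: v).
have E : (fun h : R => h^-1 *: (u (p + (h *: (1 : R) + s) *: v) - u (p + s *: v))) =
         (fun h : R => h^-1 *: (u (h *: v + (p + s *: v)) - u (p + s *: v))).
  apply/funext => h; congr (_ *: (u _ - _)).
  by rewrite scaler1 scalerDl addrCA.
split.
- by move: dv; rewrite /derivable -E.
- by move: de; rewrite /derive -E.
Qed.

Lemma integral_derive_itv01 (F f : R -> R) :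
  (forall s : R, -1 < s -> is_derive s (1 : R) F (f s)) -> continuous f ->
  (\int[@lebesgue_measure R]_(s in `[0%R, 1%R[) (f s)%:E = (F 1 - F 0)%:E)%E.
Proof.
move=> hF cf; have cF s : -1 < s -> {for s, continuous F}.
  move=> s1; apply: differentiable_continuous; apply/derivable1_diffP.
  by have [] := hF s s1.
rewrite integral_itv_bndo_bndc; last first.
  by apply: measurable_funTS; apply/measurable_EFinP; exact: continuous_measurable_fun.
rewrite (@continuous_FTC2 _ f F)//.
- exact: continuous_subspaceT.
- split => //.
  + by move=> s; rewrite in_itv/= => /andP[s0 _]; have [] := hF s (lt_trans (ltrN10 _) s0).
  + by apply: cvg_at_right_filter; apply: cF; rewrite ltrN10.
  + by apply: cvg_at_left_filter; apply: cF; lra.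
- move=> s; rewrite in_itv/= => /andP[s0 _].
  by rewrite derive1E; have [_ ->] := hF s (lt_trans (ltrN10 _) s0).
Qed.

End LineDerivative.

Section ProductSigmaFinite.
Context d1 d2 (T1 : measurableType d1) (T2 : measurableType d2) (R : realType).
Variables (m1 : {sigma_finite_measure set T1 -> \bar R})
  (m2 : {sigma_finite_measure set T2 -> \bar R}).

Lemma sigma_finite_product : sigma_finite setT (m1 \x m2)%E.
Proof.
have [F FT Foo] := sigma_finiteT m1; have [G GT Goo] := sigma_finiteT m2.
pose H k : set (T1 * T2) :=
  if unpickle k is Some (i, j) then F i `*` G j else set0.
exists H.
  apply/seteqP; split => // -[x y] _.
  have [i _ Fx] : (\bigcup_i F i) x by rewrite -FT.
  have [j _ Gy] : (\bigcup_j G j) y by rewrite -GT.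
  by exists (pickle (i, j)) => //; rewrite /H pickleK.
move=> k; rewrite /H; case: unpickle => [[i j]|]; last by rewrite measure0; split.
have [mF Fi] := Foo i; have [mG Gj] := Goo j.
split; first exact: measurableX.
by rewrite product_measure1E//; apply: lte_mul_pinfty => //; rewrite ge0_fin_numE.
Qed.

(* The library reserves the canonical sigma-finite structure of [\x] for
   products of probabilities, hence a separate constant. *)
Definition sigma_finite_prod : set (T1 * T2) -> \bar R := (m1 \x m2)%E.

HB.instance Definition _ := Measure.copy sigma_finite_prod (m1 \x m2)%E.

HB.instance Definition _ := Measure_isSigmaFinite.Build _ _ _ sigma_finite_prod
  sigma_finite_product.

End ProductSigmaFinite.

Section TorusFubini.
Context {R : realType}.
Implicit Types (f g : R3 R -> R) (p : R3 R).
Local Notation mu1 := (@lebesgue_measure R).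
Local Notation I01 := (`[0%R, 1%R[%classic : set (measurableTypeR R)).

Local Notation R1 := (measurableTypeR R).
Local Notation mu2 := (mu1 \x mu1)%E.

Definition lebesgue2 : {sigma_finite_measure set (R1 * R1)%type -> \bar R} :=
  sigma_finite_prod mu1 mu1.

Lemma tint_iter_z g : continuous g ->
  tint g = fine (\int[mu2]_xy \int[mu1]_z ((EFin \o g) \_ cube) (xy, z))%E.
Proof.
move=> cg; rewrite /tint /Rintegral integral_mkcond; congr fine.
exact: (esym (@integral12_prod_meas1 _ _ _ _ R lebesgue2 mu1 _ (integrable_patch cg))).
Qed.

Lemma tint_iter_xy g : continuous g ->
  tint g = fine (\int[mu1]_z \int[mu2]_xy ((EFin \o g) \_ cube) (xy, z))%E.
Proof.
move=> cg; rewrite /tint /Rintegral integral_mkcond; congr fine.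
exact: (esym (@integral21_prod_meas1 _ _ _ _ R lebesgue2 mu1 _ (integrable_patch cg))).
Qed.

Lemma tint_z0 g : continuous g ->
  (forall x y, \int[mu1]_(z in I01) (g (x, y, z))%:E = 0)%E -> tint g = 0.
Proof.
move=> cg h; rewrite (tint_iter_z cg).
rewrite integral0_eq ?fine0// => -[x y] _.
rewrite [LHS](_ : _ = \int[mu1]_(z in I01) if (x \in I01) && (y \in I01) then (g (x, y, z))%:E
    else 0)%E.
  by case: (_ && _); [exact: h|exact: integral0].
rewrite [RHS]integral_mkcond; apply: eq_integral => z _.
by rewrite !patchE cubeE !in_setX/=; case: (z \in _); rewrite ?andbT ?andbF.
Qed.

Lemma tint_xy0 g : continuous g ->
  (forall y z, \int[mu1]_(x in I01) (g (x, y, z))%:E = 0)%E \/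
  (forall x z, \int[mu1]_(y in I01) (g (x, y, z))%:E = 0)%E -> tint g = 0.
Proof.
move=> cg h; rewrite (tint_iter_xy cg).
rewrite integral0_eq ?fine0// => z _.
pose G xy : \bar R := if (xy.1 \in I01) && (xy.2 \in I01) && (z \in I01) then (g (xy, z))%:E else
    0%E.
rewrite [LHS](_ : _ = \int[(mu1 \x mu1)%E]_xy G xy)%E; last first.
  apply: eq_integral => -[x y] _.
  by rewrite patchE cubeE !in_setX/=.
(* The slice at height [z] needs its own integrability before a second Fubini; it comes from the
   bound of [g] on the closed cube. *)
have iG : (mu1 \x mu1)%E.-integrable setT G.
  have [M hM] := bounded_on_ccube cg.
  have mS : measurable (I01 `*` I01) by apply: measurableX; exact: measurable_I01.
  rewrite (_ : G = (fun xy => (if z \in I01 then (g (xy, z)) else 0)%:E) \_ (I01 `*` I01)); last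
      first.
    by apply/funext => -[x y]; rewrite patchE in_setX /G/=; case: (x \in _); case: (y \in _);
        case: (z \in _).
  apply/integrable_restrict; rewrite ?setTI//.
  apply: (@le_integrable _ _ _ _ _ mS _ (EFin \o cst M)).
  - apply/measurable_EFinP; apply: measurable_funTS; case: (z \in _); last exact: measurable_cst.
    by apply: (measurableT_comp (measurable_continuous3 cg)); exact: measurable_pair2.
  - move=> [x y]; rewrite /= !in_itv/= => -[hx hy]; case: ifPn => hz; rewrite lee_fin.
      rewrite (le_trans (hM (x, y, z) _)) ?ler_norm//.
      by move: hz; rewrite inE/= in_itv/= => hz; split => /=; [split|]; rewrite /= in_itv/=; lra.
    by rewrite normr0.
  - apply/integrableP; split.
      by apply/measurable_EFinP; exact: measurable_cst.
    rewrite /= integral_cst/=; last exact: mS.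
    rewrite [X in (_ * X)%E](product_measure1E mu1 mu1 measurable_I01 measurable_I01).
    by rewrite /= lebesgue_I01 !mule1 ltry.
case: h => h.
- rewrite -(integral21_prod_meas1 iG) integral0_eq// => y _.
  rewrite [LHS](_ : _ = \int[mu1]_(x in I01) if (y \in I01) && (z \in I01) then (g (x, y, z))%:E
      else 0)%E.
    by case: (_ && _); [exact: h|exact: integral0].
  rewrite [RHS]integral_mkcond; apply: eq_integral => x _.
  by rewrite patchE /G/=; case: (x \in _).
- rewrite -(integral12_prod_meas1 iG) integral0_eq// => x _.
  rewrite [LHS](_ : _ = \int[mu1]_(y in I01) if (x \in I01) && (z \in I01) then (g (x, y, z))%:E
      else 0)%E.
    by case: (_ && _); [exact: h|exact: integral0].
  rewrite [RHS]integral_mkcond; apply: eq_integral => y _.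
  by rewrite patchE /G/=; case: (y \in _); rewrite ?andbT ?andbF.
Qed.

(** Fubini makes the axis [i] the innermost one; along it the integral of a derivative over one
    period vanishes. Integration by parts on the torus rests on this. *)
Lemma tint_derive0 (i : 'I_3) (u du : R3 R -> R) :
  (forall p, is_derive p (basis3 i) u (du p)) -> continuous du ->
  (forall p, u (p + basis3 i) = u p) -> tint du = 0.
Proof.
move=> hu cdu pu.
have key p : (\int[mu1]_(s in I01) (du (p + s *: basis3 i))%:E = 0)%E.
  rewrite (integral_derive_itv01 (fun s _ => is_derive_line hu p s)).
    by rewrite scale1r pu scale0r addr0 subrr.
  have cl : continuous (fun s : R => p + s *: basis3 i).
    by move=> s; apply: cvgD; [exact: cvg_cst|exact: scalel_continuous].
  by move=> s; exact: (continuous_comp (cl s) (cdu _)).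
move: i hu pu key; apply: ord3_ind => _ _ key.
- apply: tint_xy0 => //; left => y z; rewrite -[RHS](key (0, y, z)).
  apply: eq_integral => s _; congr (du _)%:E; rewrite /basis3/=.
  by congr (_, _, _); rewrite /= /GRing.scale/= ?mulr1 ?mulr0 ?add0r ?addr0.
- apply: tint_xy0 => //; right => x z; rewrite -[RHS](key (x, 0, z)).
  apply: eq_integral => s _; congr (du _)%:E; rewrite /basis3/=.
  by congr (_, _, _); rewrite /= /GRing.scale/= ?mulr1 ?mulr0 ?add0r ?addr0.
- apply: tint_z0 => // x y; rewrite -[RHS](key (x, y, 0)).
  apply: eq_integral => s _; congr (du _)%:E; rewrite /basis3/=.
  by congr (_, _, _); rewrite /= /GRing.scale/= ?mulr1 ?mulr0 ?add0r ?addr0.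
Qed.

End TorusFubini.

(** * Negative moments of trigonometric polynomials *)

Section TrigPoly.
Context {R : realType}.
Implicit Types (a b c z w : R[i]) (s t : R).

(** The squared modulus, which keeps estimates polynomial in real and imaginary parts. *)
Definition csq z : R := complex.Re z ^+ 2 + complex.Im z ^+ 2.

Lemma csqM z w : csq (z * w) = csq z * csq w.
Proof. by case: z => x y; case: w => x' y'; rewrite /csq/=; ring. Qed.

Lemma csq_ge0 z : 0 <= csq z.
Proof. by rewrite addr_ge0 ?sqr_ge0. Qed.

Lemma csqN z : csq (- z) = csq z.
Proof. by case: z => x y; rewrite /csq/= !sqrrN. Qed.

Lemma csqD3 a b c : csq (a + b + c) <= 3 * (csq a + csq b + csq c).
Proof.
case: a b c => [a a'] [b b'] [c c']; rewrite /csq/=.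
rewrite -subr_ge0 (_ : _ - _ = (a - b) ^+ 2 + (a - c) ^+ 2 + (b - c) ^+ 2
  + ((a' - b') ^+ 2 + (a' - c') ^+ 2 + (b' - c') ^+ 2)); last by ring.
by rewrite !addr_ge0 ?sqr_ge0.
Qed.

Lemma csqD2 a b : csq (a + b) <= 2 * (csq a + csq b).
Proof.
case: a b => [a a'] [b b']; rewrite /csq/=.
rewrite -subr_ge0 (_ : _ - _ = (a - b) ^+ 2 + (a' - b') ^+ 2); last by ring.
by rewrite !addr_ge0 ?sqr_ge0.
Qed.

Definition cexp s : R[i] := (cos s +i* sin s)%C.
Definition cexpN s : R[i] := (cos s -i* sin s)%C.

Lemma cexpK s : cexp s * cexpN s = 1.
Proof.
apply/eqP; rewrite eq_complex/=; apply/andP; split; apply/eqP.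
  by rewrite -(cos2Dsin2 s); ring.
by ring.
Qed.

Lemma csq_cexp s : csq (cexp s) = 1.
Proof. exact: cos2Dsin2. Qed.

Lemma csq_cexpN s : csq (cexpN s) = 1.
Proof. by rewrite /csq/= sqrrN cos2Dsin2. Qed.

Lemma cexpD s t : cexp (s + t) = cexp s * cexp t.
Proof.
apply/eqP; rewrite eq_complex/= cosD sinD; apply/andP; split; apply/eqP => //.
by rewrite addrC.
Qed.

Definition tpoly a b c s : R[i] := a + b * cexp s + c * cexpN s.

(* Graeffe root squaring: the coefficients b and c are squared, which lets a
   lower bound for the mean logarithm be iterated and its error halved. *)
Lemma tpoly_graeffe a b c s :
  tpoly a b c s * tpoly a b c (s + pi) =
  tpoly (a ^+ 2 - 2 * b * c) (- b ^+ 2) (- c ^+ 2) (s + s).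
Proof.
have e1 : cexp (s + pi) = - cexp s.
  by rewrite /cexp cosDpi sinDpi.
have e2 : cexpN (s + pi) = - cexpN s.
  by rewrite /cexpN cosDpi sinDpi.
have e3 : cexp (s + s) = cexp s ^+ 2 by rewrite cexpD expr2.
have e4 : cexpN (s + s) = cexpN s ^+ 2.
  by rewrite /cexpN cosD sinD expr2; apply/eqP; rewrite eq_complex/=;
    apply/andP; split; apply/eqP; ring.
have zw := cexpK s.
rewrite /tpoly e1 e2 e3 e4; set z := cexp s in zw *; set w := cexpN s in zw *.
transitivity (a ^+ 2 - 2 * b * c * (z * w) + - b ^+ 2 * z ^+ 2 + - c ^+ 2 * w ^+ 2).
  by ring.
by rewrite zw mulr1.
Qed.

(** Here [36 = 3 * 3 * 4]: the factor of [csqD3], three terms, and the largest squared distance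
    between two points of the unit circle. *)
Lemma csq_lagrange_bound (q1 q2 q3 d1 d2 d3 x D : R[i]) (M : R) :
  x * D = q1 * d1 + q2 * d2 + q3 * d3 ->
  csq q1 <= M -> csq q2 <= M -> csq q3 <= M ->
  csq d1 <= 4 -> csq d2 <= 4 -> csq d3 <= 4 ->
  csq x * csq D <= 36 * M.
Proof.
move=> xD h1 h2 h3 k1 k2 k3.
have M0 : 0 <= M := le_trans (csq_ge0 q1) h1.
rewrite -csqM xD (le_trans (csqD3 _ _ _))// !csqM.
have H q d : csq q <= M -> csq d <= 4 -> csq q * csq d <= M * 4.
  by move=> hq hd; apply: ler_pM => //; exact: csq_ge0.
by have := H _ _ h1 k1; have := H _ _ h2 k2; have := H _ _ h3 k3; lra.
Qed.

(* Lagrange interpolation: if the polynomial is small at three separated points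
   then its coefficients are small. *)
Lemma tpoly_three_points a b c s1 s2 s3 (M : R) :
  csq (tpoly a b c s1) <= M -> csq (tpoly a b c s2) <= M ->
  csq (tpoly a b c s3) <= M ->
  let D := csq (cexp s1 - cexp s2) * csq (cexp s1 - cexp s3) * csq (cexp s2 - cexp s3) in
  [/\ csq a * D <= 36 * M, csq b * D <= 36 * M & csq c * D <= 36 * M].
Proof.
move=> h1 h2 h3 D.
have := cexpK s1; have := cexpK s2; have := cexpK s3.
have n1 := csq_cexp s1; have n2 := csq_cexp s2; have n3 := csq_cexp s3.
set z1 := cexp s1 in D n1 *; set z2 := cexp s2 in D n2 *; set z3 := cexp s3 in D n3 *.
set w1 := cexpN s1; set w2 := cexpN s2; set w3 := cexpN s3 => zw3 zw2 zw1.
(* Multiplying by a point of the unit circle keeps the modulus and leaves a quadratic polynomial.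
   Cramer's rule for its values at [z1], [z2], [z3], with Vandermonde determinant
   [(z1 - z2) * (z1 - z3) * (z2 - z3)], then yields the three coefficients. *)
have {}h1 : csq (z1 * tpoly a b c s1) <= M by rewrite csqM n1 mul1r.
have {}h2 : csq (z2 * tpoly a b c s2) <= M by rewrite csqM n2 mul1r.
have {}h3 : csq (z3 * tpoly a b c s3) <= M by rewrite csqM n3 mul1r.
have Q1 : z1 * tpoly a b c s1 = a * z1 + b * z1 ^+ 2 + c.
  by rewrite /tpoly -/z1 -/w1 -[in RHS](mulr1 c) -zw1; ring.
have Q2 : z2 * tpoly a b c s2 = a * z2 + b * z2 ^+ 2 + c.
  by rewrite /tpoly -/z2 -/w2 -[in RHS](mulr1 c) -zw2; ring.
have Q3 : z3 * tpoly a b c s3 = a * z3 + b * z3 ^+ 2 + c.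
  by rewrite /tpoly -/z3 -/w3 -[in RHS](mulr1 c) -zw3; ring.
rewrite Q1 in h1; rewrite Q2 in h2; rewrite Q3 in h3.
have DE : D = csq ((z1 - z2) * (z1 - z3) * (z2 - z3)) by rewrite !csqM.
have B z z' : csq z = 1 -> csq z' = 1 -> csq (z - z') <= 4.
  by move=> hz hz'; rewrite (le_trans (csqD2 _ _))// csqN hz hz'; lra.
have B' z z' : csq z = 1 -> csq z' = 1 -> csq (z + z') <= 4.
  by move=> hz hz'; rewrite (le_trans (csqD2 _ _))// hz hz'; lra.
rewrite DE; split.
- apply: (@csq_lagrange_bound _ _ _ (- ((z2 - z3) * (z2 + z3)))
    ((z1 - z3) * (z1 + z3)) (- ((z1 - z2) * (z1 + z2))) _ _ _ _ h1 h2 h3).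
  + by ring.
  + rewrite csqN (_ : _ * _ = z2 ^+ 2 - z3 ^+ 2); last by ring.
    by apply: B; rewrite expr2 csqM ?n2 ?n3 mulr1.
  + rewrite (_ : _ * _ = z1 ^+ 2 - z3 ^+ 2); last by ring.
    by apply: B; rewrite expr2 csqM ?n1 ?n3 mulr1.
  + rewrite csqN (_ : _ * _ = z1 ^+ 2 - z2 ^+ 2); last by ring.
    by apply: B; rewrite expr2 csqM ?n1 ?n2 mulr1.
- apply: (@csq_lagrange_bound _ _ _ (z2 - z3) (- (z1 - z3)) (z1 - z2)
    _ _ _ _ h1 h2 h3).
  + by ring.
  + exact: B.
  + by rewrite csqN; exact: B.
  + exact: B.
- apply: (@csq_lagrange_bound _ _ _ (z2 * z3 * (z2 - z3)) (- (z1 * z3 * (z1 - z3)))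
    (z1 * z2 * (z1 - z2)) _ _ _ _ h1 h2 h3).
  + by ring.
  + by rewrite !csqM n2 n3 !mul1r; exact: B.
  + by rewrite csqN !csqM n1 n3 !mul1r; exact: B.
  + by rewrite !csqM n1 n2 !mul1r; exact: B.
Qed.

Lemma cos_piquarter_ge : 1 / 2 <= cos (pi / 4 : R).
Proof.
have c0 : 0 <= cos (pi / 4 : R).
  by apply: cos_ge0_pihalf; have := pi_gt0 R; lra.
have : cos ((pi / 4 : R) *+ 2) = 0.
  rewrite (_ : _ *+ 2 = pi / 2) ?cos_pihalf// mulr2n; lra.
by rewrite cos_mulr2n; nra.
Qed.

Lemma sin_piquarter_ge : 1 / 2 <= sin (pi / 4 : R).
Proof.
have <- : cos (pi / 4 : R) = sin (pi / 4 : R); last exact: cos_piquarter_ge.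
by rewrite -cosBpihalf -cosN; congr cos; lra.
Qed.

(** Up to pi/4 by the mean value theorem, the cosine being at least 1/2 there; beyond, the sine is
    at least 1/2, and [s / 4 <= 1 / 2] because pi/2 < 2. *)
Lemma sin_ge_quarter s : 0 <= s <= pi / 2 -> s / 4 <= sin s.
Proof.
move=> /andP[s0 s1]; have pi0 := pi_gt0 R.
have [->|sn0] := eqVneq s 0; first by rewrite sin0 mul0r.
have {sn0}s0 : 0 < s by rewrite lt_neqAle eq_sym sn0.
have [s4|s4] := leP s (pi / 4).
  have [|x] := @MVT R sin cos 0 s s0 (fun x _ => is_derive_sin x).
    by apply: continuous_subspaceT; exact: continuous_sin.
  rewrite in_itv/= sin0 !subr0 => /andP[x0 xs] ->.
  have : cos (pi / 4) <= cos x.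
    have [->//|xn] := eqVneq x (pi / 4).
    apply: ltW; rewrite ltr_cos ?in_itv/=; last 2 first.
      by apply/andP; split; lra.
      by apply/andP; split; lra.
    by lra.
  by move: cos_piquarter_ge => h1 h2; nra.
have : sin (pi / 4) <= sin s.
  apply: ltW; rewrite ltr_sin ?in_itv/=.
  - exact: s4.
  - by apply/andP; split; lra.
  - by apply/andP; split; lra.
by move: sin_piquarter_ge (pihalf_lt2 R) => h1 h2; lra.
Qed.

Lemma csq_cexpB s t : csq (cexp s - cexp t) = 4 * sin ((s - t) / 2) ^+ 2.
Proof.
have E : cos (s - t) = 1 - 2 * sin ((s - t) / 2) ^+ 2.
  rewrite {1}(_ : s - t = (s - t) / 2 *+ 2); last by rewrite mulr2n; lra.
  by rewrite cos_mulr2n cos2sin2 mulr2n; lra.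
have := cos2Dsin2 s; have := cos2Dsin2 t; move: E.
by rewrite cosB /csq/=; nra.
Qed.

(** For [x = |s - t| <= 1 / 2] the chord has length [2 sin (pi x) >= pi x / 2 >= x]. Beyond half a
    period the chord shrinks again. *)
Lemma csq_chord_ge s t : `|s - t| <= 1 / 2 ->
  (s - t) ^+ 2 <= csq (cexp (2 * pi * s) - cexp (2 * pi * t)).
Proof.
move=> st; rewrite csq_cexpB (_ : _ / 2 = pi * (s - t)); last by lra.
have pi0 := pi_ge2 R.
have -> : sin (pi * (s - t)) ^+ 2 = sin (pi * `|s - t|) ^+ 2.
  have [_|_] := ger0P (s - t) => //.
  by rewrite mulrN sinN sqrrN.
have h : pi * `|s - t| / 4 <= sin (pi * `|s - t|).
  apply: sin_ge_quarter; rewrite mulr_ge0//=; last by lra.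
  by nra.
rewrite -(@real_normK _ (s - t)) ?num_real//.
have := normr_ge0 (s - t); set x := `|s - t| in st h *; move=> x0.
have : 2 * x / 4 <= sin (pi * x) by nra.
by nra.
Qed.

End TrigPoly.

(** * Integration over the unit interval *)

Section Integral01.
Context {R : realType}.
Implicit Types (f g F G : R -> R).
Local Notation mu := (@lebesgue_measure R).

Definition int01 f : R := \int[mu]_(s in `[0%R, 1%R[) f s.

Lemma integrable01 f : continuous f -> mu.-integrable `[0%R, 1%R[ (EFin \o f).
Proof.
move=> cf; apply: (@integrableS _ _ _ mu `[0%R, 1%R]) => //.
  by apply: subset_itvl; rewrite bnd_simp.
apply: continuous_compact_integrable; first exact: segment_compact.
exact: continuous_subspaceT.
Qed.

Lemma int01D f g : continuous f -> continuous g ->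
  int01 (fun s => f s + g s) = int01 f + int01 g.
Proof. by move=> cf cg; apply: RintegralD => //; exact: integrable01. Qed.

Lemma int01Z (a : R) f : continuous f -> int01 (fun s => a * f s) = a * int01 f.
Proof. by move=> cf; apply: RintegralZl => //; exact: integrable01. Qed.

Lemma int01_le f g : continuous f -> continuous g -> (forall s, f s <= g s) ->
  int01 f <= int01 g.
Proof. by move=> cf cg fg; apply: le_Rintegral => //; exact: integrable01. Qed.

Lemma int01_cst (a : R) : int01 (cst a) = a.
Proof. by rewrite /int01 Rintegral_cst//= lebesgue_measure_itv/= lte01 sube0 mulr1. Qed.

Lemma EFin_int01 f : continuous f ->
  (int01 f)%:E = (\int[mu]_(s in `[0%R, 1%R[) (f s)%:E)%E.
Proof. by move=> cf; rewrite fineK// integrable_fin_num//; exact: integrable01. Qed.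

(** The integral starts at -1 so that 0 is an interior point and the primitive has a two-sided
    derivative there. *)
Lemma antiderivative f : continuous f ->
  exists F, forall s : R, -1 < s -> is_derive s (1 : R) F (f s).
Proof.
move=> cf; exists (fun x => \int[mu]_(t in `[-1, x]) f t) => s s1.
have fi : mu.-integrable `[-1, (s + 1)] (EFin \o f).
  apply: continuous_compact_integrable; first exact: segment_compact.
  exact: continuous_subspaceT.
have ss : s < s + 1 by rewrite ltrDl.
have [dF F's] := continuous_FTC1_closed ss fi s1 (cf s).
split; first exact: dF.
by rewrite -derive1E; exact: F's.
Qed.

Lemma int01_antiderivative f F : continuous f ->
  (forall s : R, -1 < s -> is_derive s (1 : R) F (f s)) -> int01 f = F 1 - F 0.
Proof. by move=> cf hF; rewrite /int01 /Rintegral (integral_derive_itv01 hF cf). Qed.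

(** The substitution [x = s + s] over half a period, carried out on primitives: [Psi] has a
    nonnegative derivative, and its increment over [0, 1/2] is [int01 f - int01 g / 2]. *)
Lemma int01_doubling f g : continuous f -> continuous g ->
  (forall s, g (s + s) <= f s + f (s + 1 / 2)) -> int01 g <= 2 * int01 f.
Proof.
move=> cf cg gf.
have [F hF] := antiderivative cf; have [G hG] := antiderivative cg.
rewrite (int01_antiderivative cf hF) (int01_antiderivative cg hG).
pose Psi (x : R) := F x + F (x + 1 / 2) - 2^-1 * G (x + x).
have dPsi (x : R) : -(1/4) < x -> is_derive x (1 : R) Psi (f x + f (x + 1 / 2) - g (x + x)).
  move=> x0.
  have d1 : is_derive x (1 : R) F (f x) by apply: hF; lra.
  have d2 : is_derive (x + 1 / 2) (1 : R) F (f (x + 1 / 2)) by apply: hF; lra.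
  have d3 : is_derive (x + x) (1 : R) G (g (x + x)) by apply: hG; lra.
  have s2 : is_derive x (1 : R) (fun y : R => y + 1 / 2) 1.
    have d := is_deriveD (is_derive_id x (1 : R)) (is_derive_cst (1 / 2 : R) x (1 : R)).
    by apply: (is_derive_eq d); rewrite addr0.
  have s3 : is_derive x (1 : R) (fun y : R => y + y) 2.
    by have d := is_deriveD (is_derive_id x (1 : R)) (is_derive_id x (1 : R)).
  have d2' := @is_derive1_comp _ F (fun y => y + 1 / 2) x _ _ d2 s2.
  have d3' := @is_derive1_comp _ G (fun y => y + y) x _ _ d3 s3.
  have d := is_deriveB (is_deriveD d1 d2') (is_deriveZ 2^-1 d3').
  by apply: (is_derive_eq d); rewrite mulr1 /GRing.scale/= mulrCA mulVf ?mulr1.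
have dP (x : R) : x \in `]0, 1 / 2[ -> is_derive x (1 : R) Psi (f x + f (x + 1 / 2) - g (x + x)).
  by rewrite in_itv/= => /andP[x0 _]; apply: dPsi; lra.
have cP : {within `[0, 1 / 2], continuous Psi}.
  apply: continuous_in_subspaceT => x; rewrite inE/= in_itv/= => /andP[x0 _].
  apply: differentiable_continuous; apply/derivable1_diffP.
  by have [] := dPsi x ltac:(lra).
have h2 : 0 < 1 / 2 :> R by lra.
have [x] := MVT h2 dP cP.
rewrite in_itv/= => _ E; have := gf x; move: E; rewrite /Psi.
rewrite !add0r (_ : 1 / 2 + 1 / 2 = 1 :> R) ?addr0; last by lra.
by move=> E1 E2; nra.
Qed.

(** Two intervals of radius [h] suffice to cover [E]: one around any point of it, one around a point
    that the first interval misses. *)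
Lemma measure_no_three_separated (E : set R) (h : R) : 0 < h -> measurable E ->
  (forall x y z, E x -> E y -> E z ->
     h < `|x - y| -> h < `|x - z| -> h < `|y - z| -> False) ->
  (mu E <= (4 * h)%:E)%E.
Proof.
move=> h0 mE sep.
pose J x : set (measurableTypeR R) := `[x - h, x + h]%classic.
have mJ x : measurable (J x) by exact: measurable_itv.
have muJ x : mu (J x) = (2 * h)%:E.
  rewrite /J lebesgue_measure_itv/= ifT ?lte_fin; last by lra.
  by rewrite -EFinB; congr EFin; lra.
have JP x y : ~ J x y -> h < `|x - y|.
  rewrite /J/= in_itv/= => n; rewrite ltNge; apply/negP => xy; apply: n.
  by move: xy; rewrite ler_norml; lra.
have [[x [Ex hx]]|none1] := pselect (exists x, E x /\ exists y, E y /\ ~ J x y).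
  have [y [Ey Jxy]] := hx.
  apply: (@le_trans _ _ (mu (J x `|` J y))).
    apply: le_measure; [exact: mem_set| |]; first by apply: mem_set; apply: measurableU.
    move=> z Ez; apply: contrapT => /not_orP[nx ny].
    by apply: (sep x y z) => //; exact: JP.
  have -> : (4 * h)%:E = (mu (J x) + mu (J y))%E.
    by rewrite !muJ -EFinD; congr EFin; lra.
  exact: (measureU2 (mu : {measure set (measurableTypeR R) -> \bar R})).
have [[x Ex]|none] := pselect (exists x, E x).
  apply: (@le_trans _ _ (mu (J x))).
    apply: le_measure; [exact: mem_set|exact: mem_set|].
    move=> z Ez; apply: contrapT => nz.
    by apply: none1; exists x; split => //; exists z.
  by rewrite muJ lee_fin; lra.
rewrite (_ : E = set0) ?measure0 ?lee_fin; first by lra.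
by apply/seteqP; split => // x Ex; apply: none; exists x.
Qed.

End Integral01.

(** * Anti-concentration of trigonometric polynomials *)

Section LogTrigPoly.
Context {R : realType}.
Implicit Types (a b c : R[i]) (s t eps : R).
Local Notation mu := (@lebesgue_measure R).

Lemma csq_tpolyE a b c t : csq (tpoly a b c t) =
  (complex.Re a + (complex.Re b + complex.Re c) * cos t
     + (complex.Im c - complex.Im b) * sin t) ^+ 2 +
  (complex.Im a + (complex.Im b + complex.Im c) * cos t
     + (complex.Re b - complex.Re c) * sin t) ^+ 2.
Proof. by case: a => a a'; case: b => b b'; case: c => c c'; rewrite /csq/=; ring. Qed.

Lemma continuous_trig1 (k : R) (p q r : R) :
  continuous (fun s : R => p + q * cos (k * s) + r * sin (k * s)).
Proof.
have ck : continuous (fun s : R => k * s) by exact: mulrl_continuous.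
move=> s; apply: cvgD; first apply: cvgD; first exact: cvg_cst.
- apply: cvgMl_tmp; apply: continuous_comp; [exact: ck|exact: continuous_cos].
- apply: cvgMl_tmp; apply: continuous_comp; [exact: ck|exact: continuous_sin].
Qed.

Lemma continuous_csq_tpoly a b c (k : R) :
  continuous (fun s : R => csq (tpoly a b c (k * s))).
Proof.
under eq_fun do rewrite csq_tpolyE.
move=> s; apply: cvgD; rewrite expr2; under eq_fun do rewrite expr2;
  by apply: cvgM; exact: continuous_trig1.
Qed.

(** The regularisation keeps the logarithm continuous at zeros of the polynomial. The estimates are
    uniform in [eps], which is sent to 0 in [neg_moment]. *)
Definition logR eps a b c s : R := ln (csq (tpoly a b c (2 * pi * s)) + eps).

Lemma csq_eps_gt0 eps a : 0 < eps -> 0 < csq a + eps.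
Proof. by move=> e0; rewrite ltr_wpDl// csq_ge0. Qed.

Lemma expR_logR eps a b c s : 0 < eps ->
  expR (logR eps a b c s) = csq (tpoly a b c (2 * pi * s)) + eps.
Proof. by move=> e0; rewrite lnK// posrE csq_eps_gt0. Qed.

Lemma continuous_logR eps a b c : 0 < eps -> continuous (logR eps a b c).
Proof.
move=> e0 s; apply: continuous_comp; last by apply: continuous_ln; exact: csq_eps_gt0.
by apply: cvgD; [exact: continuous_csq_tpoly|exact: cvg_cst].
Qed.

Lemma continuous_expR_affine (f : R -> R) (k : R) : continuous f ->
  continuous (fun s => expR (k * f s)).
Proof.
move=> cf s; apply: continuous_comp; last exact: continuous_expR.
by apply: cvgMl_tmp; exact: cf.
Qed.

(** Within half a period, three points of the set that are pairwise more than [h] apart would make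
    the product of squared chords at least [h ^+ 6], and interpolation would give [csq x * h ^+ 6 <=
    36 / 37 * (csq x * h ^+ 6)]. So each half period contributes at most [4 * h]. *)
Lemma small_ball eps a b c (x : R[i]) (h : R) : 0 < eps -> 0 < h ->
  (x = a \/ x = b \/ x = c) ->
  (mu (`[0%R, 1%R[ `&` [set s | (csq (tpoly a b c (2 * pi * s)) + eps < csq x * h ^+ 6 / 37)%R])
    <= (8 * h)%:E)%E.
Proof.
move=> e0 h0 xabc.
set E : set (measurableTypeR R) := [set s | (_ < _)%R].
have mE : measurable E.
  rewrite (_ : E = (fun s => csq (tpoly a b c (2 * pi * s))) @^-1` `]-oo, csq x * h ^+ 6 / 37 -
      eps[%classic).
    rewrite -[X in measurable X]setTI.
    have mf := continuous_measurable_fun (@continuous_csq_tpoly a b c (2 * pi)).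
    by apply: mf => //; exact: measurable_itv.
  by apply/seteqP; split => s; rewrite /E/= in_itv/= ltrBrDr.
have half (u : R) : (mu (`[u, (u + 1 / 2)%R[ `&` E) <= (4 * h)%:E)%E.
  apply: measure_no_three_separated => //.
    by apply: measurableI => //; exact: measurable_itv.
  move=> y1 y2 y3 [] + E1 [] + E2 [] + E3; rewrite /= !in_itv/= => i1 i2 i3 d12 d13 d23.
  have k12 : `|y1 - y2| <= 1 / 2 by rewrite ler_norml; lra.
  have k13 : `|y1 - y3| <= 1 / 2 by rewrite ler_norml; lra.
  have k23 : `|y2 - y3| <= 1 / 2 by rewrite ler_norml; lra.
  have P y : E y -> csq (tpoly a b c (2 * pi * y)) <= csq x * h ^+ 6 / 37.
    by rewrite /E/= => Ey; rewrite ltW// (lt_trans _ Ey)// ltrDl.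
  have xh0 : 0 < csq x * h ^+ 6 / 37.
    by apply: lt_trans E1; exact: csq_eps_gt0.
  have [+ + +] := tpoly_three_points (P _ E1) (P _ E2) (P _ E3).
  set D := csq _ * csq _ * csq _ => Da Db Dc.
  have Dx : csq x * D <= 36 * (csq x * h ^+ 6 / 37).
    by case: xabc => [xE|[xE|xE]]; rewrite {1}xE.
  have sq y z : h < `|y - z| -> `|y - z| <= 1 / 2 ->
      h ^+ 2 <= csq (cexp (2 * pi * y) - cexp (2 * pi * z)).
    move=> h1 h2; rewrite (le_trans _ (csq_chord_ge h2))//.
    rewrite -(@real_normK _ (y - z)) ?num_real// ler_sqr ?nnegrE ?ltW//.
    exact: lt_trans h1.
  have : h ^+ 6 <= D.
    rewrite (_ : h ^+ 6 = h ^+ 2 * h ^+ 2 * h ^+ 2); last by ring.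
    have h2 : 0 <= h ^+ 2 by exact: sqr_ge0.
    exact: ler_pM (mulr_ge0 h2 h2) h2 (ler_pM h2 h2 (sq _ _ d12 k12) (sq _ _ d13 k13)) (sq _ _
        d23 k23).
  move=> hD; have : csq x * h ^+ 6 <= csq x * D by rewrite ler_wpM2l// csq_ge0.
  by lra.
rewrite (_ : `[0%R, 1%R[%classic `&` E =
    (`[0, (0 + 1 / 2)[%classic `&` E) `|` (`[(1 / 2), (1 / 2 + 1 / 2)[%classic `&` E)).
  rewrite (_ : (8 * h)%:E = ((4 * h)%:E + (4 * h)%:E)%E); last first.
    by rewrite -EFinD; congr EFin; lra.
  apply: le_trans (leeD (half 0) (half (1 / 2))).
  by apply: (measureU2 (mu : {measure set (measurableTypeR R) -> \bar R}));
    apply: measurableI => //; exact: measurable_itv.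
apply/seteqP; split => s /=; rewrite !in_itv/=.
  move=> [s01 Es]; have [s2|s2] := ltP s (1 / 2); [left|right]; split => //; lra.
by move=> [|] [? ?]; split => //; lra.
Qed.

(** Dyadic summation of [small_ball]. The bound is uniform and may refer to any of the three
    coefficients, but [K] is far from 1; only Jensen's inequality will bring the constant close to
    1. *)
Lemma crude_moment : exists K r : R, [/\ 1 <= K, 0 < r &
  forall eps a b c x, 0 < eps -> 0 < csq x -> (x = a \/ x = b \/ x = c) ->
  int01 (fun s => expR (- r * (logR eps a b c s - ln (csq x)))) <= K].
Proof.
have l64 : 0 < ln 64 :> R by rewrite ln_gt0//; lra.
have l32 : 0 < ln (3 / 2) :> R by rewrite ln_gt0//; lra.
(* Chosen so that 64 to the power [r] is 3/2. Lowering the threshold by the factor [64 = 2 ^ 6]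
   halves the measure bound and multiplies the integrand by 3/2, so level J contributes a multiple
   of [(3 / 4) ^ J]. *)
pose r : R := ln (3 / 2) / ln 64.
have r0 : 0 < r by rewrite divr_gt0.
have q32 : expR (r * ln 64) = 3 / 2 by rewrite mulfVK ?gt_eqF// lnK// posrE; lra.
pose K0 : R := expR (r * ln 37).
have K01 : 1 <= K0.
  rewrite -expR0 ler_expR mulr_ge0 ?(ltW r0)// ln_ge0//; lra.
exists (49 * K0), r; split => //; first by lra.
move=> eps a b c x e0 x0 xabc.
pose f s := logR eps a b c s - ln (csq x).
have cf : continuous f.
  by move=> s; apply: cvgB; [exact: continuous_logR|exact: cvg_cst].
pose th J : R := - ln 37 - J%:R * ln 64.
pose G J s := expR (- r * Num.max (f s) (th J)).
have cmaxf J : continuous (fun s => Num.max (f s) (th J)).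
  by move=> s; apply: continuous_max; [exact: cf|exact: cvg_cst].
have cG J : continuous (G J) by exact: continuous_expR_affine.
(* Level J adds [8 * (3 / 2) * (3 / 4) ^ J] times [K0]; these sum to 48, and the remaining 1 is the
   truncation at level 0. *)
have iG J : (\int[mu]_(s in `[0%R, 1%R[) (G J s)%:E <= (K0 * (49 - 48 * (3 / 4) ^+ J))%:E)%E.
  elim: J => [|J IH].
    apply: (@le_trans _ _ (\int[mu]_(s in `[0%R, 1%R[) (cst K0 s)%:E)%E).
      apply: ge0_le_integral => //.
      - by move=> s _; rewrite lee_fin expR_ge0.
      - by apply/measurable_EFinP; apply: measurable_funTS; exact: continuous_measurable_fun.
      - by apply/measurable_EFinP; exact: measurable_cst.
      - move=> s _; rewrite lee_fin ler_expR mulNr -mulrN ler_pM2l//.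
        by rewrite /th mul0r subr0 -[leRHS]opprK lerN2 le_max lexx orbT.
    rewrite -(@EFin_int01 _ (cst K0)); last exact: cst_continuous.
    rewrite int01_cst lee_fin.
    by rewrite expr0; lra.
  pose E : set (measurableTypeR R) := [set s | csq (tpoly a b c (2 * pi * s)) + eps < csq x *
      (2^-1 ^+ J) ^+ 6 / 37].
  have fE s : (f s < th J) = (csq (tpoly a b c (2 * pi * s)) + eps < csq x * (2^-1 ^+ J) ^+ 6 / 37).
    rewrite /f ltrBlDr -ltr_expR expR_logR// /th !expRD lnK ?posrE//.
    rewrite !expRN lnK ?posrE; last by lra.
    rewrite expRM_natl lnK ?posrE; last by lra.
    rewrite (_ : 64 = 2 ^+ 6 :> R); last by ring.
    by rewrite -exprM mulnC exprM -!exprVn; congr (_ < _); ring.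
  have mE : measurable E.
    rewrite (_ : E = f @^-1` `]-oo, th J[%classic); last first.
      by apply/seteqP; split => s; rewrite /E/= in_itv/= fE.
    rewrite -[X in measurable X]setTI.
    have mf := continuous_measurable_fun cf.
    by apply: mf => //; exact: measurable_itv.
  pose w : R := K0 * (3 / 2) ^+ J.+1.
  have w0 : 0 <= w by rewrite mulr_ge0 ?exprn_ge0 ?expR_ge0//; lra.
  apply: (@le_trans _ _ (\int[mu]_(s in `[0%R, 1%R[) ((G J s)%:E + w%:E * (\1_E s)%:E))%E).
    apply: ge0_le_integral => //.
    - by move=> s _; rewrite lee_fin expR_ge0.
    - by apply/measurable_EFinP; apply: measurable_funTS; exact: continuous_measurable_fun.
    - apply: emeasurable_funD.
        by apply/measurable_EFinP; apply: measurable_funTS; exact: continuous_measurable_fun.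
      apply: emeasurable_funM; first exact: measurable_cst.
      by apply/measurable_EFinP; apply: measurable_funTS; exact: measurable_indic.
    - move=> s _; rewrite -EFinM -EFinD lee_fin indicE.
      have [Es|nEs] := boolP (s \in E).
        rewrite mulr1 -[leLHS]add0r lerD ?expR_ge0//.
        rewrite /w -q32 -expRM_natl -expRD ler_expR mulNr -mulrN.
        rewrite (_ : r * ln 37 + _ = r * (ln 37 + J.+1%:R * ln 64)); last by ring.
        rewrite ler_pM2l// lerNl le_max; apply/orP; right.
        by rewrite /th; lra.
      rewrite mulr0 addr0 ler_expR !mulNr lerN2 ler_pM2l//.
      have : th J <= f s.
        by rewrite leNgt fE; apply: contra nEs => h; rewrite inE.
      move=> h; rewrite ge_max !le_max lexx/=; apply/orP; left.
      exact: h.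
  have mG : measurable_fun (`[0%R, 1%R[%classic : set (measurableTypeR R)) (fun s => (G J s)%:E).
    by apply/measurable_EFinP; apply: measurable_funTS; exact: continuous_measurable_fun.
  have mw : measurable_fun (`[0%R, 1%R[%classic : set (measurableTypeR R)) (fun s => w%:E * (\1_E
      s)%:E)%E.
    apply: emeasurable_funM; first exact: measurable_cst.
    by apply/measurable_EFinP; apply: measurable_funTS; exact: measurable_indic.
  have -> : (\int[mu]_(s in `[0%R, 1%R[) ((G J s)%:E + w%:E * (\1_E s)%:E) =
      \int[mu]_(s in `[0%R, 1%R[) (G J s)%:E + \int[mu]_(s in `[0%R, 1%R[) (w%:E * (\1_E s)%:E))%E.
    by apply: ge0_integralD => //; first
      [by move=> s _; rewrite lee_fin expR_ge0|by move=> s _; rewrite -EFinM lee_fin mulr_ge0].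
  rewrite ge0_integralZl_EFin//=; last first.
    by apply/measurable_EFinP; apply: measurable_funTS; exact: measurable_indic.
  rewrite integral_indic//=.
  have h2 : 0 < 2^-1 ^+ J :> R by rewrite exprn_gt0// invr_gt0; lra.
  have := small_ball e0 h2 xabc; rewrite setIC => sb.
  have : (w%:E * mu (E `&` `[0%R, 1%R[) <= w%:E * (8 * 2^-1 ^+ J)%:E)%E.
    by rewrite lee_wpmul2l// lee_fin.
  move=> /(leeD IH) /le_trans; apply; rewrite -EFinM -EFinD lee_fin.
  rewrite /w !exprS (_ : (3 / 4) ^+ J = (3 / 2) ^+ J * 2^-1 ^+ J :> R); last first.
    by rewrite -exprMn; congr (_ ^+ _); field.
  by lra.
(* The regularised logarithm is at least [ln eps], so from some level on the truncation is
   inactive. *)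
have [J hJ] : exists J : nat, th J <= ln eps - ln (csq x).
  exists (Num.bound `|(ln (csq x) - ln eps) / ln 64|).
  set n := Num.bound _.
  have : (ln (csq x) - ln eps) / ln 64 < n%:R.
    apply: le_lt_trans (ler_norm _) _; exact: archi_boundP.
  rewrite ltr_pdivrMr// /th => h.
  have : 0 <= ln 37 :> R by rewrite ln_ge0//; lra.
  by lra.
have GE : G J = (fun s => expR (- r * (logR eps a b c s - ln (csq x)))).
  apply/funext => s; rewrite /G; congr (expR (_ * _)); apply/max_idPl.
  apply: le_trans hJ _; rewrite /f lerD2r ler_ln ?posrE ?csq_eps_gt0//.
  by rewrite lerDr csq_ge0.
have := iG J; rewrite -EFin_int01// GE lee_fin => /le_trans; apply.
have : 0 <= (3 / 4) ^+ J :> R by rewrite exprn_ge0//; lra.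
by nra.
Qed.

End LogTrigPoly.

(** * Jensen's inequality and small negative powers *)

Section NegativeMoments.
Context {R : realType}.
Implicit Types (a b c d x : R[i]) (s t eps p : R).
Local Notation mu := (@lebesgue_measure R).

(** The inequality [(A + eps) * (B + eps) >= A * B + eps ^+ 2] carries [tpoly_graeffe] over to the
    regularised logarithm; this is why [eps] is squared. *)
Lemma graeffe_step eps a b c : 0 < eps ->
  int01 (logR (eps ^+ 2) (a ^+ 2 - 2 * b * c) (- b ^+ 2) (- c ^+ 2))
    <= 2 * int01 (logR eps a b c).
Proof.
move=> e0; have ee0 : 0 < eps ^+ 2 by rewrite exprn_gt0.
apply: int01_doubling; [exact: continuous_logR|exact: continuous_logR|move=> s].
rewrite /logR -lnM ?posrE ?csq_eps_gt0// ler_ln ?posrE ?mulr_gt0 ?csq_eps_gt0//.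
rewrite (_ : 2 * pi * (s + s) = 2 * pi * s + 2 * pi * s); last by ring.
rewrite (_ : 2 * pi * (s + 1 / 2) = 2 * pi * s + pi); last by field.
rewrite -tpoly_graeffe csqM.
by have := csq_ge0 (tpoly a b c (2 * pi * s)); have := csq_ge0 (tpoly a b c (2 * pi * s + pi)); nra.
Qed.

(** The tangent inequality for the exponential turns the crude moment into a lower bound for the
    mean logarithm, with additive error [(K - 1) / r]. *)
Lemma jensen_crude : exists2 K : R, 0 <= K &
  forall eps a b c d, 0 < eps -> 0 < csq d -> (d = b \/ d = c) ->
  ln (csq d) - K <= int01 (logR eps a b c).
Proof.
have [K [r [K1 r0 hK]]] := @crude_moment R.
exists ((K - 1) / r); first by apply: divr_ge0; [rewrite subr_ge0|exact: ltW].
move=> eps a b c d e0 d0 dbc.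
have cl := @continuous_logR R eps a b c e0.
have cdl : continuous (fun s => logR eps a b c s - ln (csq d)).
  by move=> s; apply: cvgB; [exact: cl|exact: cvg_cst].
have := hK eps a b c d e0 d0 (or_intror dbc).
have : int01 (fun s => 1 + r * ln (csq d) + - r * logR eps a b c s)
    <= int01 (fun s => expR (- r * (logR eps a b c s - ln (csq d)))).
  apply: int01_le.
  - by move=> s; apply: cvgD; [exact: cvg_cst|apply: cvgMl_tmp; exact: cl].
  - exact: continuous_expR_affine.
  - by move=> s; rewrite (le_trans _ (expR_ge1Dx _))//; lra.
rewrite int01D; last 2 first.
- exact: cst_continuous.
- by move=> s; apply: cvgMl_tmp; exact: cl.
rewrite (@int01_cst R (1 + r * ln (csq d))) int01Z// => h1 h2.
by rewrite lerBlDr -lerBlDl ler_pdivlMr//; nra.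
Qed.

(* Each Graeffe step halves the error K of [jensen_crude]. *)
Lemma jensen eps a b c d : 0 < eps -> 0 < csq d -> (d = b \/ d = c) ->
  ln (csq d) <= int01 (logR eps a b c).
Proof.
have [K K0 hK] := jensen_crude.
have iter n : forall eps a b c d, 0 < eps -> 0 < csq d -> (d = b \/ d = c) ->
    ln (csq d) - K / 2 ^+ n <= int01 (logR eps a b c).
  elim: n => [|n IH] {}eps {}a {}b {}c {}d e0 d0 dbc; first by rewrite expr0 divr1; exact: hK.
  have := graeffe_step a b c e0.
  have d2 : csq (- d ^+ 2) = csq d ^+ 2 by rewrite csqN !expr2 csqM.
  have /le_trans h := IH (eps ^+ 2) (a ^+ 2 - 2 * b * c) (- b ^+ 2) (- c ^+ 2) (- d ^+ 2)
    (exprn_gt0 2 e0) ltac:(by rewrite d2 exprn_gt0) ltac:(by case: dbc => ->; [left|right]).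
  move=> /h; rewrite d2 lnXn// mulr2n exprS invfM; nra.
move=> e0 d0 dbc; rewrite leNgt; apply/negP; rewrite -subr_gt0 => gap.
set J := int01 _ in gap; set n := Num.bound (K / (ln (csq d) - J)).
have : K / (ln (csq d) - J) < n%:R by apply: archi_boundP; rewrite divr_ge0// ltW.
have := iter n eps a b c d e0 d0 dbc; rewrite -/J => h1.
have n2 : n%:R <= 2 ^+ n :> R by rewrite -natrX ler_nat ltnW// ltn_expl.
have p2 : 0 < 2 ^+ n :> R by rewrite exprn_gt0.
rewrite ltr_pdivrMr// => h2.
have : ln (csq d) - J <= K / 2 ^+ n by rewrite lerBlDl -lerBlDr.
rewrite ler_pdivlMr// => h3.
have := lt_le_trans h2 (ler_wpM2r (ltW gap) n2).
by rewrite mulrC ltNge h3.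
Qed.

Lemma expR_le_quadratic (u : R) : expR u <= 1 + u + u ^+ 2 * expR `|u|.
Proof.
have [u0|u0] := ger0P u.
  have h : expR u * (1 - u) <= 1.
    rewrite -[leRHS](expRxMexpNx_1 u) ler_pM2l ?expR_gt0//.
    by have := expR_ge1Dx (- u); lra.
  have h1 := expR_ge1Dx u.
  have : u * (expR u - 1) <= u * (u * expR u) by rewrite ler_wpM2l//; lra.
  by rewrite expr2; lra.
have h1 := expR_ge1Dx (- u); have h2 := expRxMexpNx_1 u; have h3 := expR_gt0 u.
have h4 : 1 <= expR (- u) by rewrite -expR0 ler_expR; lra.
have h5 : expR u * (1 - u) <= 1 by rewrite -[leRHS]h2 ler_pM2l.
have h6 : u ^+ 2 <= u ^+ 2 * expR (- u) by rewrite ler_peMr// sqr_ge0.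
suff : expR u <= 1 + u + u ^+ 2 by lra.
rewrite -(@ler_pM2r _ (1 - u)); last by lra.
rewrite (le_trans h5)// (_ : _ * _ = 1 - u ^+ 3); last by ring.
rewrite lerDl oppr_ge0 (_ : u ^+ 3 = u * u ^+ 2); last by ring.
by rewrite mulr_le0_ge0 ?sqr_ge0// ltW.
Qed.

(** Convexity of the exponential between 0 and [u], from its tangent at [l * u] evaluated at both
    ends. *)
Lemma expR_convex_bound (l u : R) : 0 <= l <= 1 -> expR (l * u) <= l * expR u + (1 - l).
Proof.
move=> /andP[l0 l1]; set v := l * u; have v0 := expR_gt0 v.
have h1 : expR v * (1 + (u - v)) <= expR u.
  have -> : expR u = expR v * expR (u - v) by rewrite -expRD; congr expR; ring.
  by rewrite ler_pM2l// expR_ge1Dx.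
have h2 : expR v * (1 - v) <= 1.
  by rewrite -[leRHS](expRxMexpNx_1 v) ler_pM2l//; have := expR_ge1Dx (- v); lra.
have h3 : l * (expR v * (1 + (u - v))) <= l * expR u by rewrite ler_wpM2l.
have h4 : (1 - l) * (expR v * (1 - v)) <= (1 - l) * 1 by rewrite ler_wpM2l// subr_ge0.
have E : expR v = l * (expR v * (1 + (u - v))) + (1 - l) * (expR v * (1 - v)).
  by rewrite /v; ring.
by lra.
Qed.

(** A second-order expansion whose remainder is controlled by an [r]-moment: with [y = |g|],
    [y <= 4 / r * expR (r * y / 4)] yields the factor [16 / r ^+ 2], and half of the exponent [r] is
    kept for [p]. The upper bound [X] takes care of positive [g]. *)
Lemma expR_small_power (r p g X : R) : 0 < r -> 0 <= p <= r / 2 -> g <= X ->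
  expR (- p * g) <= 1 + - p * g + p ^+ 2 * (16 / r ^+ 2) * (expR (r * X) + expR (- r * g)).
Proof.
move=> r0 /andP[p0 pr] gX.
apply: (le_trans (expR_le_quadratic _)); rewrite lerD2l.
set y := `|g|; have y0 : 0 <= y by exact: normr_ge0.
have -> : (- p * g) ^+ 2 = p ^+ 2 * y ^+ 2.
  by rewrite exprMn sqrrN (@real_normK _ g) ?num_real.
have -> : `|- p * g| = p * y by rewrite normrM normrN (ger0_norm p0).
have h1 : r / 4 * y <= expR (r / 4 * y) by have := expR_ge1Dx (r / 4 * y); lra.
have ry0 : 0 <= r / 4 * y by rewrite mulr_ge0// divr_ge0// ltW.
have h2 : y ^+ 2 <= 16 / r ^+ 2 * expR (r / 2 * y).
  have -> : expR (r / 2 * y) = expR (r / 4 * y) ^+ 2.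
    by rewrite -expRM_natl; congr expR; field.
  have h : (r / 4 * y) ^+ 2 <= expR (r / 4 * y) ^+ 2 by rewrite ler_sqr ?nnegrE ?expR_ge0.
  have k : 0 <= 16 / r ^+ 2 by rewrite divr_ge0// sqr_ge0.
  apply: le_trans (ler_wpM2l k h); rewrite (_ : 16 / r ^+ 2 * _ = y ^+ 2)//; field.
  by rewrite gt_eqF.
have h3 : expR (p * y) <= expR (r / 2 * y) by rewrite ler_expR ler_wpM2r.
have h4 : expR (r * y) <= expR (r * X) + expR (- r * g).
  have [g0|g0] := ger0P g; rewrite /y.
    rewrite ger0_norm// -[leLHS]addr0 lerD ?expR_ge0// ler_expR ler_pM2l//.
  by rewrite ltr0_norm// mulrN mulNr -[leLHS]add0r lerD ?expR_ge0.
have k0 : 0 <= 16 / r ^+ 2 by rewrite divr_ge0// sqr_ge0.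
have : y ^+ 2 * expR (p * y) <= 16 / r ^+ 2 * expR (r / 2 * y) * expR (r / 2 * y).
  by rewrite ler_pM ?sqr_ge0 ?expR_ge0.
rewrite -mulrA -expRD (_ : r / 2 * y + r / 2 * y = r * y); last by field.
move=> /le_trans h5; rewrite -!(mulrA (p ^+ 2)) ler_wpM2l ?sqr_ge0//.
by apply: h5; rewrite ler_wpM2l.
Qed.

(** Jensen's inequality makes the first-order term in [p] nonpositive, and the second-order term
    [p ^+ 2 * K2] is at most [p / 2] for small [p]. One [p] has to serve all a, b, c, so [K2] must
    not depend on them; this forces a separate treatment of coefficients much larger than [d]. *)
Lemma neg_moment_eps : exists2 p : R, 0 < p <= 1 &
  forall eps a b c d, 0 < eps -> eps <= csq d -> (d = b \/ d = c) ->
  int01 (fun s => expR (- p * (logR eps a b c s - ln (csq d)))) <= expR (p / 2).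
Proof.
have [K [r [K1 r0 hK]]] := @crude_moment R.
have K0 : 0 < K by lra.
pose R0 : R := expR (ln K / r).
have R01 : 1 <= R0 by rewrite -expR0 ler_expR divr_ge0 ?ln_ge0// ltW.
(* [9 * R0] is [csqD3] applied to three coefficients of squared modulus at most [R0 * csq d]; the 1
   pays for [eps <= csq d]. *)
pose X : R := ln (9 * R0 + 1).
pose K2 : R := 16 / r ^+ 2 * (expR (r * X) + K).
have K20 : 0 < K2.
  by rewrite mulr_gt0 ?divr_gt0 ?exprn_gt0// addr_gt0// expR_gt0.
pose p : R := Num.min (Num.min 1 (r / 2)) ((2 * K2)^-1).
have p0 : 0 < p.
  by rewrite !lt_min ltr01 divr_gt0//= invr_gt0 mulr_gt0.
have pr : p <= r / 2 by rewrite !ge_min lexx orbT.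
have pK : p * K2 <= 1 / 2.
  have : p <= (2 * K2)^-1 by rewrite !ge_min lexx orbT.
  move=> /(ler_wpM2r (ltW K20)) /le_trans; apply.
  by rewrite invfM -mulrA mulVf ?gt_eqF// mulr1; lra.
exists p; first by rewrite p0 !ge_min lexx.
move=> eps a b c d e0 ed dbc.
have d0 : 0 < csq d := lt_le_trans e0 ed.
have cg x : continuous (fun s => logR eps a b c s - ln (csq x)).
  by move=> s; apply: cvgB; [exact: continuous_logR|exact: cvg_cst].
have ce q x : continuous (fun s => expR (q * (logR eps a b c s - ln (csq x)))).
  exact: continuous_expR_affine.
have [x [xabc [xa xb xc]]] : exists x, (x = a \/ x = b \/ x = c) /\
    [/\ csq a <= csq x, csq b <= csq x & csq c <= csq x].
  have [ab|/ltW ba] := leP (csq a) (csq b).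
    have [bc|/ltW cb] := leP (csq b) (csq c).
      by exists c; split; [right; right|split => //; exact: le_trans bc].
    by exists b; split; [right; left|split].
  have [ac|/ltW ca] := leP (csq a) (csq c).
    by exists c; split; [right; right|split => //; exact: le_trans ac].
  by exists a; split; [left|split].
have dx : csq d <= csq x by case: dbc => ->.
have x0 : 0 < csq x := lt_le_trans d0 dx.
have hx := hK eps a b c x e0 x0 xabc.
have hd := hK eps a b c d e0 d0 (or_intror dbc).
(* If the largest coefficient [x] exceeds [d] by this much, its crude bound gives an [r]-moment
   relative to [d] of at most [K^-1 * K], and convexity passes from [r] to [p]. Otherwise all
   coefficients are comparable to [d] and the expansion applies. *)
have [big|small] := leP (ln K / r) (ln (csq x) - ln (csq d)).
  have i1 : int01 (fun s => expR (- r * (logR eps a b c s - ln (csq d)))) <= 1.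
    rewrite [X in int01 X](_ : _ = (fun s => expR (- r * (ln (csq x) - ln (csq d))) *
        expR (- r * (logR eps a b c s - ln (csq x))))); last first.
      by apply/funext => s; rewrite -expRD; congr expR; ring.
    rewrite int01Z//; apply: (@le_trans _ _ (K^-1 * K)); last by rewrite mulVf ?gt_eqF.
    apply: ler_pM; [exact: expR_ge0| | |exact: hx].
      rewrite -(int01_cst 0); apply: int01_le; [exact: cst_continuous|exact: ce|].
      by move=> s; exact: expR_ge0.
    rewrite (_ : K^-1 = expR (- ln K)); last by rewrite expRN lnK.
    by rewrite ler_expR mulNr lerN2 mulrC -ler_pdivrMr.
  have l01 : 0 <= p / r <= 1.
    apply/andP; split; first exact: divr_ge0 (ltW p0) (ltW r0).
    rewrite ler_pdivrMr// mul1r; apply: le_trans pr _.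
    by rewrite ler_pdivrMr// ler_peMr ?(ltW r0)// ler1n.
  apply: (@le_trans _ _ (p / r * 1 + (1 - p / r))).
    apply: (@le_trans _ _ (int01 (fun s => p / r * expR (- r * (logR eps a b c s - ln (csq d))) +
        (1 - p / r)))).
      apply: int01_le => //.
        by move=> s; apply: cvgD; [apply: cvgMl_tmp; exact: ce|exact: cvg_cst].
      move=> s; rewrite (_ : - p * _ = p / r * (- r * (logR eps a b c s - ln (csq d)))).
        exact: expR_convex_bound.
      by field; rewrite gt_eqF.
    rewrite int01D; last 2 first.
    - by move=> s; apply: cvgMl_tmp; exact: ce.
    - exact: cst_continuous.
    rewrite int01Z// (@int01_cst R (1 - p / r)) lerD2r ler_wpM2l//.
    by case/andP: l01.
  by rewrite mulr1 addrC subrK -expR0 ler_expR; exact: divr_ge0 (ltW p0) _.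
have gX s : logR eps a b c s - ln (csq d) <= X.
  have xR : csq x <= csq d * R0.
    move: small; rewrite -ln_div ?posrE// -ltr_expR lnK ?posrE ?divr_gt0// => h.
    by rewrite -ler_pdivrMl// mulrC ltW.
  have R90 : 0 < 9 * R0 + 1 by rewrite addr_gt0// mulr_gt0// expR_gt0.
  rewrite lerBlDr -ler_expR (expR_logR _ _ _ _ e0) expRD lnK ?posrE// lnK ?posrE//.
  have := csqD3 a (b * cexp (2 * pi * s)) (c * cexpN (2 * pi * s)).
  rewrite -/(tpoly a b c _) !csqM csq_cexp csq_cexpN !mulr1 => h.
  rewrite [leRHS](_ : _ = 3 * (csq d * R0 + csq d * R0 + csq d * R0) + csq d); last by ring.
  apply: lerD ed; apply: (le_trans h); rewrite ler_pM2l//.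
  by apply: lerD; [apply: lerD|]; exact: le_trans xR.
pose W s := 1 + - p * (logR eps a b c s - ln (csq d)) + p ^+ 2 * (16 / r ^+ 2) * (expR (r * X) +
    expR (- r * (logR eps a b c s - ln (csq d)))).
have c1 : continuous (fun s => - p * (logR eps a b c s - ln (csq d))).
  by move=> s; apply: cvgMl_tmp; exact: cg.
have c2 : continuous (fun s => 1 + - p * (logR eps a b c s - ln (csq d))).
  by move=> s; apply: cvgD; [exact: cvg_cst|exact: c1].
have c3 : continuous (fun s => expR (r * X) + expR (- r * (logR eps a b c s - ln (csq d)))).
  by move=> s; apply: cvgD; [exact: cvg_cst|exact: ce].
have c4 : continuous (fun s => p ^+ 2 * (16 / r ^+ 2) * (expR (r * X) + expR (- r * (logR eps a b
    c s - ln (csq d))))).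
  by move=> s; apply: cvgMl_tmp; exact: c3.
apply: (@le_trans _ _ (int01 W)).
  apply: int01_le => //; first by move=> s; apply: cvgD; [exact: c2|exact: c4].
  by move=> s; apply: expR_small_power => //; rewrite ltW.
rewrite /W int01D// (@int01D R (cst 1))//; last exact: cst_continuous.
rewrite !int01Z// (@int01D R (cst (expR (r * X))))//; last exact: cst_continuous.
rewrite !int01_cst (@int01D R (logR eps a b c) (cst (- ln (csq d)))); last 2 first.
- exact: continuous_logR.
- exact: cst_continuous.
rewrite int01_cst.
have J := @jensen eps a b c d e0 d0 dbc.
apply: (@le_trans _ _ (1 + p ^+ 2 * K2)).
  apply: lerD.
    rewrite gerDl mulNr oppr_le0; apply: mulr_ge0; first exact: ltW.
    by rewrite subr_ge0.
  rewrite /K2 [leRHS]mulrA ler_wpM2l ?lerD2l//.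
  by rewrite mulr_ge0 ?sqr_ge0// divr_ge0// sqr_ge0.
apply: le_trans (expR_ge1Dx _) _; rewrite ler_expR expr2 -mulrA mulrC.
have := p0; nra.
Qed.

End NegativeMoments.

Section NegPow.
Context {R : realType}.
Implicit Types (a b c d : R[i]) (s t p y : R).
Local Notation mu := (@lebesgue_measure R).

(* [y ^ (- p)]; unlike with [powR], the value at 0 has to be infinite. *)
Definition negpow p y : \bar R := if y == 0 then +oo%E else (expR (- p * ln y))%:E.

Lemma negpow_ge0 p y : (0 <= negpow p y)%E.
Proof. by rewrite /negpow; case: ifP => // _; rewrite lee_fin expR_ge0. Qed.

Lemma measurable_negpow p : measurable_fun setT (negpow p).
Proof.
apply: measurable_fun_ifT.
- by apply: measurable_fun_eqr; [exact: measurable_id|exact: measurable_cst].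
- exact: measurable_cst.
- apply/measurable_EFinP; apply: measurableT_comp => //.
  by apply: measurable_funM; [exact: measurable_cst|exact: measurable_ln].
Qed.

Lemma cvg_negpow p y (e : R) : 0 < p -> 0 <= y -> 0 < e ->
  (expR (- p * ln (y + e / n.+1%:R)))%:E @[n --> \oo] --> negpow p y.
Proof.
move=> p0 y0 e0; rewrite /negpow.
have en0 : (e / n.+1%:R) @[n --> \oo] --> (0 : R).
  rewrite -[X in _ --> X](mulr0 e); apply: cvgMl_tmp; exact: cvg_harmonic.
case: eqP => [->|/eqP yn].
  apply/cvgeryP/cvgryPge => A.
  exists (Num.bound (e * expR (`|A| / p))) => // n /= hn.
  have n0 : 0 < n.+1%:R :> R by rewrite ltr0n.
  have : e * expR (`|A| / p) < n.+1%:R.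
    apply: (@lt_le_trans _ _ (Num.bound (e * expR (`|A| / p)))%:R).
      by apply: archi_boundP; rewrite mulr_ge0 ?expR_ge0// ltW.
    by rewrite ler_nat (leq_trans hn).
  rewrite mulrC -ltr_pdivlMr// => h.
  rewrite add0r -[e / _]invrK invf_div lnV ?posrE ?divr_gt0// mulrNN.
  have : `|A| / p <= ln (n.+1%:R / e).
    by rewrite -ler_expR lnK ?posrE ?divr_gt0// ltW.
  rewrite ler_pdivrMr// mulrC => h2.
  apply: le_trans (expR_ge1Dx _); apply: le_trans (ler_norm A) _.
  by apply: (le_trans h2); rewrite lerDr.
have {yn}y0 : 0 < y by rewrite lt_neqAle eq_sym yn.
apply: cvg_EFin; first by near=> n.
rewrite /comp/=; apply: (continuous_cvg _ (@continuous_expR _ _)).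
apply: cvgMl_tmp; apply: (continuous_cvg _ (continuous_ln y0)).
rewrite -[X in _ --> X]addr0; apply: cvgD; [exact: cvg_cst|exact: en0].
Unshelve. all: by end_near. Qed.

(** Monotone convergence along [csq d / n.+1%:R], a sequence that respects the constraint
    [eps <= csq d]. For [d = 0] the right-hand side is infinite. *)
Lemma neg_moment : exists2 p : R, 0 < p <= 1 &
  forall a b c d, (d = b \/ d = c) ->
  (\int[mu]_(s in `[0%R, 1%R[) negpow p (csq (tpoly a b c (2 * pi * s))%R)
    <= (expR (p / 2))%:E * negpow p (csq d))%E.
Proof.
have [p /andP[p0 p1] hp] := @neg_moment_eps R.
exists p; first by rewrite p0.
move=> a b c d dbc.
rewrite [in leRHS]/negpow; case: eqP => [_|/eqP dn].
  by rewrite gt0_muley ?leey// lte_fin expR_gt0.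
have d0 : 0 < csq d by rewrite lt_neqAle eq_sym dn csq_ge0.
pose e n := csq d / n.+1%:R.
have e0 n : 0 < e n by rewrite divr_gt0.
have ed n : e n <= csq d.
  by rewrite /e ler_pdivrMr// ler_peMr ?csq_ge0// ler1n.
pose g n s : \bar R := (expR (- p * logR (e n) a b c s))%:E.
have cg n : continuous (fun s => expR (- p * logR (e n) a b c s)).
  by apply: continuous_expR_affine; exact: continuous_logR.
have gcvg s : g n s @[n --> \oo] --> negpow p (csq (tpoly a b c (2 * pi * s))).
  by apply: cvg_negpow => //; exact: csq_ge0.
have -> : (\int[mu]_(s in `[0%R, 1%R[) negpow p (csq (tpoly a b c (2 * pi * s))%R) =
    \int[mu]_(s in `[0%R, 1%R[) limn (g ^~ s))%E.
  by apply: eq_integral => s _; apply/esym/cvg_lim => //; exact: gcvg.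
rewrite monotone_convergence//; last 3 first.
- move=> n; apply/measurable_EFinP; apply: measurable_funTS.
  exact: continuous_measurable_fun.
- by move=> n s _; rewrite lee_fin expR_ge0.
- move=> s _ n m nm; rewrite lee_fin ler_expR !mulNr lerN2 ler_pM2l//.
  rewrite ler_ln ?posrE ?csq_eps_gt0// lerD2l ler_pM2l// lef_pV2 ?posrE ?ltr0n//.
  by rewrite ler_nat ltnS.
have gle n : (\int[mu]_(s in `[0%R, 1%R[) g n s <= (expR (p / 2))%:E * (expR (- p * ln (csq
    d)))%:E)%E.
  rewrite /g -EFin_int01// -EFinM lee_fin.
  rewrite [X in int01 X](_ : _ = (fun s => expR (- p * ln (csq d)) *
      expR (- p * (logR (e n) a b c s - ln (csq d))))); last first.
    by apply/funext => s; rewrite -expRD; congr expR; ring.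
  rewrite int01Z; last first.
    apply: continuous_expR_affine => s.
    by apply: cvgB; [exact: continuous_logR|exact: cvg_cst].
  by rewrite mulrC ler_pM2r ?expR_gt0//; exact: hp.
apply: lime_le; last by apply: nearW.
apply: ereal_nondecreasing_is_cvgn => n m nm; apply: ge0_le_integral => //.
- by move=> s _; rewrite lee_fin expR_ge0.
- by apply/measurable_EFinP; apply: measurable_funTS; exact: continuous_measurable_fun.
- by apply/measurable_EFinP; apply: measurable_funTS; exact: continuous_measurable_fun.
- move=> s _; rewrite lee_fin ler_expR !mulNr lerN2 ler_pM2l//.
  rewrite ler_ln ?posrE ?csq_eps_gt0// lerD2l ler_pM2l// lef_pV2 ?posrE ?ltr0n//.
  by rewrite ler_nat ltnS.
Qed.

Lemma tpoly_shift a b c s t :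
  tpoly a b c (s - t) = tpoly a (b * cexpN t) (c * cexp t) s.
Proof.
have e1 : cexp (s - t) = cexp s * cexpN t.
  by rewrite cexpD; congr (_ * _); rewrite /cexp /cexpN cosN sinN.
have e2 : cexpN (s - t) = cexpN s * cexp t.
  by apply/eqP; rewrite eq_complex/= cosB sinB; apply/andP; split; apply/eqP; ring.
by rewrite /tpoly e1 e2; ring.
Qed.

(** Reflection swaps [b] and [c]; for its sake the moment bounds allow [d] to be either of them. *)
Lemma tpoly_opp a b c s : tpoly a b c (- s) = tpoly a c b s.
Proof.
have e1 : cexp (- s) = cexpN s by rewrite /cexp /cexpN cosN sinN.
have e2 : cexpN (- s) = cexp s by rewrite /cexp /cexpN cosN sinN opprK.
by rewrite /tpoly e1 e2 addrAC.
Qed.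

End NegPow.

(** * Independence of the phases *)

Section CubeTonelli.
Context {R : realType}.
Local Notation mu1 := (@lebesgue_measure R).
Local Notation R1 := (measurableTypeR R).
Local Notation I01 := (`[0%R, 1%R[%classic : set R1).
Implicit Types (F : R3 R1 -> \bar R) (C : \bar R).

Lemma measurable_patch_cube F : measurable_fun setT F -> measurable_fun setT (F \_ cube).
Proof.
move=> mF; apply/(measurable_restrictT F); first exact: measurable_cube.
exact: measurable_funTS.
Qed.

Lemma patch_cube_ge0 F : (forall p, 0 <= F p)%E -> forall p, (0 <= (F \_ cube) p)%E.
Proof. by move=> F0 p; rewrite patchE; case: ifP. Qed.

(** The outer coordinates have total mass 1, so a uniform bound of the inner integral suffices.
    Tonelli is used because [F] may be infinite. Each phase involves the coordinate y or z, hence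
    one version for each. *)
Lemma cube_le_z F C : measurable_fun setT F -> (forall p, 0 <= F p)%E -> (0 <= C)%E ->
  (forall x y, \int[mu1]_(z in I01) F (x, y, z) <= C)%E ->
  (\int[@lebesgue3 R]_(p in cube) F p <= C)%E.
Proof.
move=> mF F0 C0 h; rewrite integral_mkcond.
have mP := measurable_patch_cube mF; have P0 := patch_cube_ge0 F0.
rewrite [leLHS](@fubini_tonelli1 _ _ _ _ R (@lebesgue2 R) mu1 _ mP P0).
pose sq : set (R1 * R1) := I01 `*` I01.
have msq : measurable sq by apply: measurableX; exact: measurable_I01.
apply: (@le_trans _ _ (\int[@lebesgue2 R]_xy ((cst C) \_ sq) xy)%E).
  apply: ge0_le_integral => //.
  - by move=> xy _; apply: integral_ge0 => z _; exact: P0.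
  - exact: measurable_fun_fubini_tonelli_F.
  - by apply/(measurable_restrictT _ msq); exact: measurable_cst.
  - move=> [x y] _; rewrite /fubini_F patchE.
    have [sxy|nxy] := boolP ((x, y) \in sq).
      rewrite (le_trans _ (h x y))// [leRHS]integral_mkcond le_eqVlt; apply/orP; left.
      apply/eqP/eq_integral => z _; rewrite !patchE cubeE in_setX.
      by rewrite -/sq sxy.
    rewrite integral0_eq// => z _; rewrite patchE cubeE in_setX.
    by rewrite -/sq (negbTE nxy).
rewrite -integral_mkcond integral_cst//.
rewrite [X in (_ * X)%E](product_measure1E mu1 mu1 measurable_I01 measurable_I01).
by rewrite /= lebesgue_I01 !mule1.
Qed.

Lemma cube_le_y F C : measurable_fun setT F -> (forall p, 0 <= F p)%E -> (0 <= C)%E ->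
  (forall x z, \int[mu1]_(y in I01) F (x, y, z) <= C)%E ->
  (\int[@lebesgue3 R]_(p in cube) F p <= C)%E.
Proof.
move=> mF F0 C0 h; rewrite integral_mkcond.
have mP := measurable_patch_cube mF; have P0 := patch_cube_ge0 F0.
rewrite [leLHS](@fubini_tonelli2 _ _ _ _ R (@lebesgue2 R) mu1 _ mP P0).
apply: (@le_trans _ _ (\int[mu1]_z ((cst C) \_ I01) z)%E); last first.
  rewrite -integral_mkcond integral_cst//.
  by rewrite [X in (_ * X)%E](_ : _ = 1%E) ?mule1//; exact: lebesgue_I01.
apply: ge0_le_integral => //.
- by move=> z _; apply: integral_ge0 => xy _; exact: P0.
- exact: measurable_fun_fubini_tonelli_G.
- by apply/(measurable_restrictT _ measurable_I01); exact: measurable_cst.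
move=> z _; rewrite /fubini_G patchE.
have [Iz|nz] := boolP (z \in I01); last first.
  by rewrite integral0_eq// => -[x y] _; rewrite patchE cubeE !in_setX/= (negbTE nz) andbF.
have mPz : measurable_fun setT (fun xy => (F \_ cube) (xy, z)).
  by apply: (measurableT_comp mP); exact: measurable_pair2.
rewrite [leLHS](@fubini_tonelli1 _ _ _ _ R mu1 mu1 (fun xy => (F \_ cube) (xy, z)) mPz
  (fun xy => P0 (xy, z))).
apply: (@le_trans _ _ (\int[mu1]_x ((cst C) \_ I01) x)%E); last first.
  rewrite -integral_mkcond integral_cst//.
  by rewrite [X in (_ * X)%E](_ : _ = 1%E) ?mule1//; exact: lebesgue_I01.
apply: ge0_le_integral => //.
- by move=> x _; apply: integral_ge0 => y _; exact: P0.
- exact: (@measurable_fun_fubini_tonelli_F _ _ _ _ R mu1 (fun xy => (F \_ cube) (xy, z)) mPz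
    (fun xy => P0 (xy, z))).
- by apply/(measurable_restrictT _ measurable_I01); exact: measurable_cst.
move=> x _; rewrite /fubini_F patchE.
have [Ix|nx] := boolP (x \in I01).
  rewrite (le_trans _ (h x z))// [leRHS]integral_mkcond le_eqVlt; apply/orP; left.
  by apply/eqP/eq_integral => y _; rewrite !patchE cubeE !in_setX/= Ix Iz andbT.
by rewrite integral0_eq// => y _; rewrite patchE cubeE !in_setX/= (negbTE nx).
Qed.

End CubeTonelli.

Section Independence.
Context {R : realType} d (T : measurableType d) (P : probability T R).

(** The joint law is the product of the laws, by uniqueness on rectangles; Tonelli then freezes
    [V]. *)
Lemma ge0_integral_indep d1 d2 (T1 : measurableType d1) (T2 : measurableType d2)
    (V : {RV P >-> T1}) (X : {RV P >-> T2}) (F : T1 * T2 -> \bar R) :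
  (forall A B, measurable A -> measurable B ->
     P (V @^-1` A `&` X @^-1` B) = (P (V @^-1` A) * P (X @^-1` B))%E) ->
  measurable_fun setT F -> (forall z, 0 <= F z)%E ->
  (\int[P]_w F (V w, X w) = \int[P]_w \int[P]_w' F (V w, X w'))%E.
Proof.
move=> VX mF F0.
have mVX : measurable_fun setT (fun w => (V w, X w)).
  by apply: measurable_fun_pair.
pose VXrv : {RV P >-> (T1 * T2)%type} := mfun_Sub (mem_set mVX).
transitivity (\int[distribution P VXrv]_z F z)%E.
  by rewrite ge0_integral_distribution.
transitivity (\int[(distribution P V \x distribution P X)%E]_z F z)%E.
  apply: eq_measure_integral => A mA _; symmetry.
  apply: (@product_measure_unique _ _ _ _ R (distribution P V) (distribution P X)
    (distribution P VXrv)) => //.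
transitivity (\int[distribution P V]_x \int[distribution P X]_y F (x, y))%E.
  exact: (@fubini_tonelli1 _ _ _ _ R (distribution P V) (distribution P X) F mF F0).
have mI : measurable_fun setT (fun x => \int[distribution P X]_y F (x, y))%E.
  exact: (@measurable_fun_fubini_tonelli_F _ _ _ _ R (distribution P X) F mF F0).
rewrite ge0_integral_distribution//; last by move=> y; apply: integral_ge0.
apply: eq_integral => w _ /=.
rewrite ge0_integral_distribution//.
by apply: (measurableT_comp mF); exact: measurable_pair1.
Qed.

End Independence.

(** * Conditioning on the earlier phases *)

Section Past.
Context {R : realType} d (T : measurableType d) (P : probability T R).
Variable phi : nat -> T -> R.
Hypothesis mphi : forall n, measurable_fun setT (phi n).

(* A pi-system generating the sigma-algebra of the first n phases. *)
Definition past (n : nat) : set (set T) :=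
  [set F | exists2 A : nat -> set R, forall j, measurable (A j) &
                      F = \bigcap_(j in `I_n) (phi j @^-1` A j)].

Lemma past_setI n : setI_closed (past n).
Proof.
move=> F1 F2 [A1 mA1 ->] [A2 mA2 ->].
exists (fun j => A1 j `&` A2 j); first by move=> j; exact: measurableI.
by rewrite -bigcapI; apply: eq_bigcapr => j _; rewrite preimage_setI.
Qed.

Lemma past_setT n : past n setT.
Proof.
exists (fun=> setT) => //.
by apply/seteqP; split => // w _ j _.
Qed.

Lemma past_measurable n : past n `<=` measurable.
Proof.
move=> F [A mA ->]; apply: fin_bigcap_measurable; first exact: finite_II.
by move=> j _; rewrite -[X in measurable X]setTI; exact: mphi.
Qed.

Lemma measurable_past n (i : 'I_n) :
  measurable_fun setT (phi i : g_sigma_algebraType (past n) -> R).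
Proof.
move=> _ B mB; rewrite setTI; apply: sub_sigma_algebra.
exists (fun j => if j == i :> nat then B else setT).
  by move=> j; case: ifP.
apply/seteqP; split => [w Bw j jn|w /(_ i (ltn_ord i))].
  by rewrite /preimage/=; case: eqP => [->|].
by rewrite /preimage/= eqxx.
Qed.

Lemma past_measurable_fun n d1 (T1 : measurableType d1) (V : T -> T1) :
  measurable_fun setT (V : g_sigma_algebraType (past n) -> T1) ->
  measurable_fun setT V.
Proof.
move=> mV mT B mB.
have sub : <<s past n >> `<=` d.-measurable.
  by apply: smallest_sub; [exact: sigma_algebra_measurable|exact: past_measurable].
exact: sub (mV measurableT B mB).
Qed.

Hypothesis indep_rect : forall n (A : nat -> set R) (B : set R),
  (forall j, measurable (A j)) -> measurable B ->
  P (\bigcap_(j in `I_n) (phi j @^-1` A j) `&` phi n @^-1` B) =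
  (P (\bigcap_(j in `I_n) (phi j @^-1` A j)) * P (phi n @^-1` B))%E.

(** Both sides are finite measures in [F], a restriction of [P] and a multiple of [P]; they agree on
    the pi-system [past n], hence on the sigma-algebra it generates. *)
Lemma past_indep n (F : set T) (B : set R) :
  <<s past n >> F -> measurable B ->
  P (F `&` phi n @^-1` B) = (P F * P (phi n @^-1` B))%E.
Proof.
move=> sF mB.
have mE : measurable (phi n @^-1` B) by rewrite -[X in measurable X]setTI; exact: mphi.
have Pf : P (phi n @^-1` B) \is a fin_num by exact: fin_num_measure.
have r0 : 0 <= fine (P (phi n @^-1` B)) by exact: fine_ge0.
rewrite muleC -[X in (X * _)%E]fineK//.
apply: (g_sigma_algebra_measure_unique (past n) (@past_measurable n)
  (fun=> setT) (fun=> @past_setT n) _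
  (mrestr P mE) (mscale (NngNum r0) P) (@past_setI n) _ _ F sF).
- by rewrite bigcup_const//; exists 0%N.
- move=> _ [A mA ->]; rewrite [LHS](indep_rect n mA mB) muleC.
  by congr (_ * _)%E; rewrite -[LHS]fineK.
- move=> _; rewrite [X in (X < _)%E](_ : _ = P (setT `&` phi n @^-1` B))// setTI; apply:
    (le_lt_trans (probability_le1 P mE)).
  exact: ltry.
Qed.

Variable p : R.
Hypothesis p0 : 0 < p.
Variable n : nat.
Hypothesis phase_bound : forall a b c : R[i],
  (\int[P]_w negpow p (csq (tpoly a b c (2 * pi * phi n w))) <=
   (expR (p / 2))%:E * negpow p (csq b))%E.

(** Independence freezes the coefficients, which are functions of the past, and [phase_bound] then
    integrates over the phase of step n alone. The three complex coefficients are encoded as six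
    reals to live in a product measurable space. *)
Lemma expect_step (a b c y : T -> R[i]) :
  (forall z, z = a \/ z = b \/ z = c ->
    measurable_fun setT ((fun w => complex.Re (z w)) : g_sigma_algebraType (past n) -> R) /\
    measurable_fun setT ((fun w => complex.Im (z w)) : g_sigma_algebraType (past n) -> R)) ->
  (forall w, csq (y w) = csq (tpoly (a w) (b w) (c w) (2 * pi * phi n w))) ->
  (\int[P]_w negpow p (csq (y w)) <=
   (expR (p / 2))%:E * \int[P]_w negpow p (csq (b w)))%E.
Proof.
move=> mabc yE.
have [ma ma'] := mabc a (or_introl erefl).
have [mb mb'] := mabc b (or_intror (or_introl erefl)).
have [mc mc'] := mabc c (or_intror (or_intror erefl)).
pose R2 := (R * R)%type.
pose V w : R2 * R2 * R2 :=
  ((complex.Re (a w), complex.Im (a w)), (complex.Re (b w), complex.Im (b w)),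
   (complex.Re (c w), complex.Im (c w))).
have mV : measurable_fun setT (V : g_sigma_algebraType (past n) -> _).
  by apply: measurable_fun_pair; [apply: measurable_fun_pair|];
    apply: measurable_fun_pair.
have mV' := past_measurable_fun mV.
pose Vrv : {RV P >-> (R2 * R2 * R2)%type} := mfun_Sub (mem_set mV').
pose Xrv : {RV P >-> R} := mfun_Sub (mem_set (mphi n)).
pose G (z : R2 * R2 * R2 * R) : R :=
  csq (tpoly (Complex z.1.1.1.1 z.1.1.1.2) (Complex z.1.1.2.1 z.1.1.2.2)
    (Complex z.1.2.1 z.1.2.2) (2 * pi * z.2)).
have mG : measurable_fun setT G.
  rewrite /G; under eq_fun do rewrite csq_tpolyE/=.
  have m1 := @measurable_fst _ _ (R2 * R2 * R2)%type R.
  have m2 := @measurable_snd _ _ (R2 * R2 * R2)%type R.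
  have m11 := measurableT_comp (@measurable_fst _ _ (R2 * R2)%type R2) m1.
  have m12 := measurableT_comp (@measurable_snd _ _ (R2 * R2)%type R2) m1.
  have m111 := measurableT_comp (@measurable_fst _ _ R2 R2) m11.
  have m112 := measurableT_comp (@measurable_snd _ _ R2 R2) m11.
  have q1 := measurableT_comp (@measurable_fst _ _ R R) m111.
  have q2 := measurableT_comp (@measurable_snd _ _ R R) m111.
  have q3 := measurableT_comp (@measurable_fst _ _ R R) m112.
  have q4 := measurableT_comp (@measurable_snd _ _ R R) m112.
  have q5 := measurableT_comp (@measurable_fst _ _ R R) m12.
  have q6 := measurableT_comp (@measurable_snd _ _ R R) m12.
  have ms := measurable_funM (measurable_cst (2 * pi : R)) m2.
  have mcos := measurableT_comp (continuous_measurable_fun (@continuous_cos R)) ms.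
  have msin := measurableT_comp (continuous_measurable_fun (@continuous_sin R)) ms.
  apply: measurable_funD; apply: measurable_funX.
    apply: measurable_funD; first apply: measurable_funD; first exact: q1.
      by apply: measurable_funM; [exact: measurable_funD|exact: mcos].
    by apply: measurable_funM; [exact: measurable_funB|exact: msin].
  apply: measurable_funD; first apply: measurable_funD; first exact: q2.
    by apply: measurable_funM; [exact: measurable_funD|exact: mcos].
  by apply: measurable_funM; [exact: measurable_funB|exact: msin].
have mF : measurable_fun setT (negpow p \o G).
  by apply: measurableT_comp => //; exact: measurable_negpow.
have VE w s : (negpow p \o G) (V w, s) = negpow p (csq (tpoly (a w) (b w) (c w) (2 * pi * s))).
  by rewrite /G /V/=; case: (a w); case: (b w); case: (c w).
have -> : (\int[P]_w negpow p (csq (y w)) = \int[P]_w (negpow p \o G) (Vrv w, Xrv w))%E.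
  by apply: eq_integral => w _; rewrite yE -VE.
rewrite ge0_integral_indep//; last 2 first.
- move=> A B mA mB; apply: past_indep => //.
  by rewrite -[X in <<s _ >> X]setTI; apply: mV.
- by move=> z; exact: negpow_ge0.
have mb2 : measurable_fun setT (fun w => negpow p (csq (b w))).
  have mm : measurable_fun setT (fun w => csq (b w)).
    by apply: measurable_funD; apply: measurable_funX;
      [exact: (past_measurable_fun mb)|exact: (past_measurable_fun mb')].
  exact: measurableT_comp (measurable_negpow p) mm.
rewrite -ge0_integralZl//; last by move=> w _; exact: negpow_ge0.
pose H (z : R2 * R2 * R2 * T) : \bar R := (negpow p \o G) (z.1, Xrv z.2).
have mH : measurable_fun setT H.
  apply: (measurableT_comp mF); apply: measurable_fun_pair; first exact: measurable_fst.
  exact: (measurableT_comp (mphi n) measurable_snd).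
have mI : measurable_fun setT (fun v => \int[P]_w' H (v, w'))%E.
  exact: (@measurable_fun_fubini_tonelli_F _ _ _ _ R P H mH (fun z => negpow_ge0 _ _)).
apply: ge0_le_integral => //.
- by move=> w _; apply: integral_ge0 => w' _; exact: negpow_ge0.
- exact: (measurableT_comp mI mV').
- by apply: measurable_funeM.
- move=> w _; apply: le_trans (phase_bound (a w) (b w) (c w)).
  by rewrite le_eqVlt; apply/orP; left; apply/eqP/eq_integral => w' _; exact: VE.
Qed.

End Past.

(* At step n the axes x, y, z are numbered so that [ax n.+2] is the direction of the
   velocity and [ax n], [ax n.+1] are those in its sine. *)
Definition ax (n : nat) : 'I_3 := inord (n %% 3).

Lemma axE n : ax n = (n %% 3)%N :> nat.
Proof. by rewrite /ax inordK// ltn_mod. Qed.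

(** Phrased on natural numbers so that each of the three cyclic cases reduces by computation. *)
Lemma ax_modn3 (Q : nat -> nat -> nat -> Prop) :
  Q 0 1 2 -> Q 1 2 0 -> Q 2 0 1 -> forall n, Q (ax n) (ax n.+1) (ax n.+2).
Proof.
move=> q0 q1 q2 n; rewrite !axE.
have e1 : (n.+1 = (n %% 3).+1 %[mod 3])%N by rewrite -addn1 -modnDml addn1.
have e2 : (n.+2 = (n %% 3).+2 %[mod 3])%N by rewrite -addn2 -modnDml addn2.
rewrite e1 e2; have : (n %% 3 < 3)%N by rewrite ltn_mod.
by case: (n %% 3)%N => [|[|[|]]].
Qed.

Section Phases.
Context {R : realType} d (T : measurableType d) (P : probability T R).
Variable theta : int -> {RV P >-> R3 R}.

(** All that the velocity on [n, n + 1] sees of [theta], because the shear depends on a difference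
    of two coordinates. It is not reduced modulo 1. *)
Definition phase (n : nat) (w : T) : R :=
  comp3 (theta n%:Z w) (ax n) - comp3 (theta n%:Z w) (ax n.+1).

Lemma measurable_comp3R (i : 'I_3) : measurable_fun setT ((fun v => comp3 v i) : R3 R -> R).
Proof.
move: i; apply: ord3_ind; rewrite /comp3/=.
- by apply: (measurableT_comp measurable_fst); exact: measurable_fst.
- by apply: (measurableT_comp measurable_snd); exact: measurable_fst.
- exact: measurable_snd.
Qed.

Lemma measurable_phase n : measurable_fun setT (phase n).
Proof.
by apply: measurable_funB; apply: (measurableT_comp (measurable_comp3R _)); exact: measurable_funPT.
Qed.

Hypothesis htheta : iid_uniform_on_torus theta.

Lemma phase_indep n (A : nat -> set R) (B : set R) :
  (forall j, measurable (A j)) -> measurable B ->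
  P (\bigcap_(j in `I_n) (phase j @^-1` A j) `&` phase n @^-1` B) =
  (P (\bigcap_(j in `I_n) (phase j @^-1` A j)) * P (phase n @^-1` B))%E.
Proof.
move=> mA mB; have [ind _] := htheta.
pose D j : set (R3 R) := (fun v => comp3 v (ax j) - comp3 v (ax j.+1)) @^-1` (if (j < n)%N then A
    j else B).
have mD j : measurable (D j).
  rewrite -[X in measurable X]setTI.
  apply: (measurable_funB (measurable_comp3R _) (measurable_comp3R _)) => //.
  by case: ifP.
pose C (z : int) : set (R3 R) := D `|z|%N.
pose s (k : nat) := [seq (Posz j) | j <- iota 0 k].
have us k : uniq (s k) by rewrite map_inj_uniq ?iota_uniq// => x y [].
have E k : (k <= n.+1)%N -> \bigcap_(i in [set` s k]) (theta i @^-1` C i) =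
    \bigcap_(j in `I_k) (phase j @^-1` (if (j < n)%N then A j else B)).
  move=> kn; apply/seteqP; split => w Hw i /=.
    move=> ik; have := Hw (Posz i); apply; rewrite /= map_f// mem_iota//.
  by move=> /mapP[j + ->]; rewrite mem_iota/= add0n => jk; exact: Hw.
have M k : (k <= n.+1)%N -> P (\bigcap_(j in `I_k) (phase j @^-1` (if (j < n)%N then A j else B))) =
    (\prod_(j <- iota 0 k) P (phase j @^-1` (if (j < n)%N then A j else B)))%E.
  by move=> kn; rewrite -E// ind//; [rewrite big_map|move=> i; exact: mD].
have En : \bigcap_(j in `I_n) (phase j @^-1` A j) =
    \bigcap_(j in `I_n) (phase j @^-1` (if (j < n)%N then A j else B)).
  by apply: eq_bigcapr => j /= ->.
have En1 : \bigcap_(j in `I_n) (phase j @^-1` A j) `&` phase n @^-1` B =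
    \bigcap_(j in `I_n.+1) (phase j @^-1` (if (j < n)%N then A j else B)).
  rewrite En; apply/seteqP; split => [w [h1 h2] j /=|w h].
    rewrite ltnS leq_eqVlt => /predU1P[->|jn]; last exact: h1.
    by rewrite ltnn.
  split; first by move=> j /= jn; apply: h; rewrite /= ltnW.
  by have := h n (ltnSn n); rewrite ltnn.
rewrite En1 En M ?ltnSn// M ?leqnSn// -[in LHS]addn1 iotaD big_cat/= big_seq1 add0n.
by rewrite ltnn.
Qed.

(** The phase is a difference of two coordinates. With one of them fixed it is a translated or
    reflected uniform variable; the translation multiplies the coefficients by unimodular numbers
    and the reflection swaps [b] and [c], which leaves the bound unchanged. *)
Lemma phase_bound (p : R) n :
  (forall a b c x : R[i], (x = b \/ x = c) ->
   (\int[@lebesgue_measure R]_(s in `[0%R, 1%R[) negpow p (csq (tpoly a b c (2 * pi * s))%R)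
    <= (expR (p / 2))%:E * negpow p (csq x))%E) ->
  forall a b c : R[i],
  (\int[P]_w negpow p (csq (tpoly a b c (2 * pi * phase n w))) <=
   (expR (p / 2))%:E * negpow p (csq b))%E.
Proof.
move=> hp a b c.
pose toR1 (v : R3 R) : R3 (measurableTypeR R) := v.
have mth : measurable_fun setT (toR1 \o theta n%:Z).
  exact: (measurable_funPT (theta n%:Z)).
pose X : {RV P >-> R3 (measurableTypeR R)} := mfun_Sub (mem_set mth).
pose R1 := measurableTypeR R.
pose h (s : R) : \bar R := negpow p (csq (tpoly a b c (2 * pi * s))).
have mh : measurable_fun setT (h : R1 -> _).
  apply: (measurableT_comp (measurable_negpow p)).
  exact: (continuous_measurable_fun (@continuous_csq_tpoly R a b c (2 * pi))).
pose H (v : R3 R1) : \bar R := h (comp3 v (ax n) - comp3 v (ax n.+1)).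
have mH : measurable_fun setT H.
  by apply: (measurableT_comp mh); apply: measurable_funB; exact: measurable_comp3.
have H0 v : (0 <= H v)%E by exact: negpow_ge0.
have mcube := @measurable_cube R.
have XE A : measurable A -> distribution P X A = lebesgue3 (A `&` cube).
  by move=> mA; have [_ unif] := htheta; exact: (unif n%:Z A mA).
have -> : (\int[P]_w negpow p (csq (tpoly a b c (2 * pi * phase n w))) =
    \int[distribution P X]_v H v)%E.
  by rewrite ge0_integral_distribution.
have mC : measurable (~` cube : set (R3 (measurableTypeR R))) by exact: measurableC.
have C0' : distribution P X (~` cube) = 0%E by rewrite XE// setICl measure0.
have -> : (\int[distribution P X]_v H v = \int[distribution P X]_(v in setT `\` ~` cube) H v)%E.
  exact: ge0_negligible_integral.
rewrite setTD setCK.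
have -> : (\int[distribution P X]_(v in cube) H v = \int[@lebesgue3 R]_(v in cube) H v)%E.
  by apply: eq_measure_integral => A mA Ac; rewrite [LHS](XE A mA) setIidl.
have C0 : (0 <= (expR (p / 2))%:E * negpow p (csq b))%E.
  by rewrite mule_ge0 ?negpow_ge0// lee_fin expR_ge0.
have shiftR (t : R) : (\int[@lebesgue_measure R]_(s in `[0%R, 1%R[) h (s - t)%R <=
    (expR (p / 2))%:E * negpow p (csq b))%E.
  rewrite /h; under eq_integral do rewrite mulrBr tpoly_shift.
  have -> : csq b = csq (b * cexpN (2 * pi * t)) by rewrite csqM csq_cexpN mulr1.
  by apply: hp; left.
have shiftL (t : R) : (\int[@lebesgue_measure R]_(s in `[0%R, 1%R[) h (t - s)%R <=
    (expR (p / 2))%:E * negpow p (csq b))%E.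
  rewrite /h; under eq_integral do rewrite -opprB mulrN tpoly_opp mulrBr tpoly_shift.
  have -> : csq b = csq (b * cexp (2 * pi * t)) by rewrite csqM csq_cexp mulr1.
  by apply: hp; right.
pose K i j (v : R3 (measurableTypeR R)) : R := [:: v.1.1; v.1.2; v.2]`_i - [:: v.1.1; v.1.2;
    v.2]`_j.
pose Q i j (k : nat) := measurable_fun setT (h \o K i j) ->
  (forall v, 0 <= (h \o K i j) v)%E ->
  (\int[@lebesgue3 R]_(v in cube) (h \o K i j) v <= (expR (p / 2))%:E * negpow p (csq b))%E.
suff : Q (ax n) (ax n.+1) (ax n.+2) by apply.
apply: (@ax_modn3 Q _ _ _ n); rewrite /Q/= => mF F0.
- by apply: (cube_le_y mF F0 C0) => x z; exact: (shiftL x).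
- by apply: (cube_le_z mF F0 C0) => x y; exact: (shiftL y).
- by apply: (cube_le_z mF F0 C0) => x y; exact: (shiftR x).
Qed.

End Phases.

(** * Maximum principle *)

Section OneDimensionalTests.
Context {R : realType}.
Implicit Types (f g : R -> R) (a c d s t : R).

Lemma is_derive_cvg f t d : is_derive t (1 : R) f d ->
  h^-1 * (f (h + t) - f t) @[h --> 0^'] --> d.
Proof.
move=> [df <-]; rewrite (_ : (fun h => _) =
  (fun h : R => h^-1 *: ((f \o shift t) (h *: (1 : R)) - f t))); first exact: df.
by apply/funext => h /=; rewrite /GRing.scale/= mulr1.
Qed.

(** Only earlier times are compared, since the maximum may sit at the end of the time interval. *)
Lemma derive_ge0_of_left_max f (a t d : R) : a < t -> is_derive t (1 : R) f d ->
  (forall s, a <= s <= t -> f s <= f t) -> 0 <= d.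
Proof.
move=> at0 /is_derive_cvg df fmax; rewrite leNgt; apply/negP => d0.
have := cvgr_lt _ df _ d0.
rewrite /dnbhs near_withinE -nbhs_ballE => -[r /= r0 hr].
pose h := - Num.min (r / 2) (t - a).
have m0 : 0 < Num.min (r / 2) (t - a) by rewrite lt_min divr_gt0//= subr_gt0.
have h0 : h < 0 by rewrite oppr_lt0.
have hr' : ball (0 : R) r h.
  rewrite /ball/= sub0r normrN normrN gtr0_norm//.
  by rewrite gt_min; apply/orP; left; lra.
have hn : h != 0 by rewrite lt_eqF.
have := hr h hr' hn; rewrite -[X in _ < X](mulr0 h^-1) ltr_nM2l ?invr_lt0// subr_gt0.
rewrite ltNge fmax//; apply/andP; split; last by lra.
by rewrite /h addrC lerBrDr -lerBrDl ge_min lexx orbT.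
Qed.

(** If [c] were positive, [g] would be positive just to the right of 0 and [f] would increase
    there. *)
Lemma second_derivative_test f g c :
  (forall s, is_derive s (1 : R) f (g s)) -> is_derive 0 (1 : R) g c ->
  (forall s, f s <= f 0) -> g 0 = 0 /\ c <= 0.
Proof.
move=> df dg fmax.
have g0 : g 0 = 0.
  have [_ <-] := df 0.
  have h1 : -1 <= 1 :> R by lra.
  have h2 (t : R) : t \in `](-1), 1[ -> derivable f t 1 by have [] := df t.
  have h3 : (0 : R) \in `](-1), 1[ by rewrite in_itv/=; lra.
  by have [_ ->] := derive1_at_max h1 h2 h3 (fun t _ => fmax t).
split => //; rewrite leNgt; apply/negP => c0.
have := cvgr_gt _ (is_derive_cvg dg) _ c0.
rewrite /dnbhs near_withinE -nbhs_ballE => -[r /= r0 hr].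
have gpos s : 0 < s -> s < r -> 0 < g s.
  move=> s0 sr; have sn : s != 0 by rewrite gt_eqF.
  have := hr s _ sn; rewrite /ball/= sub0r normrN gtr0_norm// => /(_ sr).
  by rewrite addr0 g0 subr0 pmulr_rgt0// invr_gt0.
have r2 : 0 < r / 2 by rewrite divr_gt0.
have cf : {within `[0, r / 2], continuous f}.
  apply: continuous_subspaceT => s.
  by apply: differentiable_continuous; apply/derivable1_diffP; have [] := df s.
have [s] := MVT r2 (fun s _ => df s) cf.
rewrite in_itv/= subr0 => /andP[s0 sr] E.
have : 0 < f (r / 2) - f 0 by rewrite E mulr_gt0// gpos//; lra.
by rewrite subr_gt0 ltNge fmax.
Qed.

End OneDimensionalTests.

Section Periodic.
Context {R : realType}.
Implicit Types (p q : R3 R).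

Definition zvec (k : 'I_3 -> int) : R3 R :=
  ((k (@Ordinal 3 0 isT))%:~R, (k (@Ordinal 3 1 isT))%:~R, (k (@Ordinal 3 2 isT))%:~R).

Lemma ccube_representative p : exists2 k : 'I_3 -> int, True & ccube (p + zvec k).
Proof.
case: p => [[x y] z].
exists (fun i => nth 0 [:: - Num.floor x; - Num.floor y; - Num.floor z] i) => //.
have H (s : R) : `[0, 1]%classic (s + (- Num.floor s)%:~R).
  rewrite /= in_itv/= mulrNz; have := real_floor_le (num_real s).
  by have := real_floorD1_gt (num_real s); rewrite intrD; lra.
by split => /=; [split => /=|]; exact: H.
Qed.

End Periodic.

Section MaximumPrinciple.
Context {R : realType}.
Variables (D Dt : 'I_3 -> R -> R3 R -> R) (Dx Dxx : 'I_3 -> 'I_3 -> R -> R3 R -> R).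
Variables (a kappa M : R) (V : R -> R3 R -> R) (gam : 'I_3) (src : 'I_3 -> R -> R3 R -> R).
Hypothesis kappa0 : 0 <= kappa.
Hypothesis M0 : 0 <= M.
Hypothesis cD : forall i, continuous (fun q : R * R3 R => D i (Num.max q.1 a) q.2).
Hypothesis perD : forall i (t : R) (p : R3 R) k, a <= t -> D i t (p + zvec k) = D i t p.
Hypothesis dt : forall i t p, a < t -> is_derive t (1 : R) (D i ^~ p) (Dt i t p).
Hypothesis dx : forall i j t (p : R3 R), a < t -> is_derive p (basis3 j) (D i t) (Dx i j t p).
Hypothesis dxx : forall i j t (p : R3 R), a < t -> is_derive p (basis3 j) (Dx i j t) (Dxx i j t p).
Hypothesis eqD : forall i t p, a < t -> t <= a + 1 ->
  Dt i t p = kappa * (\sum_(j < 3) Dxx i j t p) - V t p * Dx i gam t p + src i t p.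
Hypothesis srcD : forall i t p (m : R), a < t -> t <= a + 1 ->
  (forall j, `|D j t p| <= m) -> src i t p <= M * m /\ - src i t p <= M * m.

(** The maximum runs jointly over components, time and space, because the source of one component is
    controlled only by all three. At a maximum later than [a] the gradient vanishes, which removes
    the transport, and the diffusion term has a favourable sign; [kappa = 0] is allowed. *)
Lemma max_principle (e : R) : 0 <= e ->
  (forall i p, `|D i a p| <= e) ->
  forall i t p, a <= t <= a + 1 -> `|D i t p| <= e * expR (M + 1).
Proof.
move=> e0 De.
(* The rate M + 1 > M excludes an interior maximum of exp(- K (t - a)) |D|. *)
pose K : R := M + 1.
have K0 : 0 < K by rewrite ltr_wpDl.
pose F i (q : R * R3 R) := expR (- K * (q.1 - a)) * `|D i (Num.max q.1 a) q.2|.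
have cF i : continuous (F i).
  move=> q; apply: cvgM; last by apply: cvg_norm; exact: cD.
  apply: continuous_comp; last exact: continuous_expR.
  by apply: cvgMl_tmp; apply: cvgB; [exact: cvg_fst|exact: cvg_cst].
pose Q : set (R * R3 R) := `[a, a + 1]%classic `*` ccube.
have cQ : compact Q by apply: compact_setX; [exact: segment_compact|exact: compact_ccube].
have Q0 : Q !=set0.
  exists (a, (0, 0, 0)); split => /=; first by rewrite in_itv/= lexx lerDl ler01.
  by split => /=; [split => /=|]; rewrite in_itv/= lexx ler01.
have mx i : exists2 q, q \in Q & forall q', q' \in Q -> F i q' <= F i q.
  by apply: compact_EVT_max => //; apply: continuous_subspaceT; exact: cF.
have [i0 [q0 [q0Q hmax]]] : exists i0 q0, q0 \in Q /\ forall i q, q \in Q -> F i q <= F i0 q0.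
  pose o0 : 'I_3 := @Ordinal 3 0 isT; pose o1 : 'I_3 := @Ordinal 3 1 isT; pose o2 : 'I_3 :=
      @Ordinal 3 2 isT.
  have [q0 q0Q h0] := mx o0; have [q1 q1Q h1] := mx o1; have [q2 q2Q h2] := mx o2.
  have conclude i0 q (qQ : q \in Q) : F o0 q0 <= F i0 q -> F o1 q1 <= F i0 q -> F o2 q2 <= F i0 q ->
      exists i0 q0, q0 \in Q /\ forall i q, q \in Q -> F i q <= F i0 q0.
    move=> k0 k1 k2; exists i0, q; split => //; apply: ord3_ind => q' q'Q.
    - exact: le_trans (h0 _ q'Q) k0.
    - exact: le_trans (h1 _ q'Q) k1.
    - exact: le_trans (h2 _ q'Q) k2.
  have [l01|/ltW l01] := leP (F o0 q0) (F o1 q1).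
    have [l12|/ltW l12] := leP (F o1 q1) (F o2 q2).
      by apply: (conclude o2 q2) => //; exact: le_trans l12.
    exact: (conclude o1 q1).
  have [l02|/ltW l02] := leP (F o0 q0) (F o2 q2).
    by apply: (conclude o2 q2) => //; exact: le_trans l02.
  exact: (conclude o0 q0).
pose m := F i0 q0.
have m0 : 0 <= m by rewrite mulr_ge0 ?expR_ge0.
have bound i t p : a <= t <= a + 1 -> `|D i t p| <= m * expR (K * (t - a)).
  move=> /andP[at0 ta1]; have [k _ pk] := ccube_representative p.
  have := hmax i (t, p + zvec k); rewrite /F/= max_l// perD// => /(_ _).
  have tQ : (t, p + zvec k) \in Q by rewrite inE; split => //=; rewrite in_itv/= at0.
  move=> /(_ tQ); rewrite mulNr expRN => h.
  by rewrite -ler_pdivrMr ?expR_gt0// mulrC.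
suff me : m <= e.
  move=> i t p ta; apply: (le_trans (bound i t p ta)).
  apply: ler_pM; [exact: m0|exact: expR_ge0|exact: me|].
  by rewrite ler_expR ler_piMr ?(ltW K0)//; lra.
rewrite leNgt; apply/negP => em.
case: q0 q0Q hmax @m m0 bound em => t0 p0 q0Q hmax m m0 bound em.
have [/= t0a p0c] : Q (t0, p0) by rewrite inE in q0Q.
move: t0a; rewrite in_itv/= => /andP[at0 ta1].
have {at0}at0 : a < t0.
  rewrite lt_neqAle at0 andbT; apply/negP => /eqP E.
  move: em; rewrite /m /F/= -E subrr mulr0 expR0 mul1r max_l// ltNge.
  by rewrite De.
have Dm : `|D i0 t0 p0| = m * expR (K * (t0 - a)).
  rewrite /m /F/= max_l; last exact: ltW.
  by rewrite mulNr expRN mulrAC mulVf ?mul1r ?gt_eqF ?expR_gt0.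
have m1 : 0 < m by exact: le_lt_trans em.
(* [s * D] is differentiable, stays below the absolute value of [D] and equals it at the maximum
   point, so the derivative tests are applied to it. *)
pose s := Num.sg (D i0 t0 p0).
have sD : s * D i0 t0 p0 = `|D i0 t0 p0| by rewrite /s normrEsg.
have sle x : s * x <= `|x|.
  apply: (le_trans (ler_norm _)); rewrite normrM ler_piMl//.
  by rewrite /s; case: sgrP; rewrite ?normr0 ?normrN ?normr1.
have sp j : s * Dx i0 j t0 p0 = 0 /\ s * Dxx i0 j t0 p0 <= 0.
  pose f (r : R) := s * D i0 t0 (p0 + r *: basis3 j).
  pose g (r : R) := s * Dx i0 j t0 (p0 + r *: basis3 j).
  have df r : is_derive r (1 : R) f (g r).
    exact: (is_deriveZ s (is_derive_line (fun p => dx i0 j p at0) p0 r)).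
  have dg : is_derive (0 : R) (1 : R) g (s * Dxx i0 j t0 (p0 + 0 *: basis3 j)).
    exact: (is_deriveZ s (is_derive_line (fun p => dxx i0 j p at0) p0 0)).
  have fm r : f r <= f 0.
    rewrite /f scale0r addr0 sD Dm; apply: (le_trans (sle _)); apply: bound.
    by rewrite ltW.
  have [] := second_derivative_test df dg fm.
  by rewrite /g !scale0r !addr0.
have time : s * Dt i0 t0 p0 - m * (expR (K * (t0 - a)) * K) >= 0.
  pose f t := s * D i0 t p0 - m * expR (K * (t - a)).
  have de : is_derive t0 (1 : R) (fun t => expR (K * (t - a))) (expR (K * (t0 - a)) * K).
    apply: (@is_derive1_comp _ expR (fun t => K * (t - a))).
    have d1 := is_deriveB (is_derive_id t0 (1 : R)) (is_derive_cst (a : R) t0 (1 : R)).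
    by apply: (is_derive_eq (is_deriveZ K d1)); rewrite subr0 /GRing.scale/= mulr1.
  have df : is_derive t0 (1 : R) f (s * Dt i0 t0 p0 - m * (expR (K * (t0 - a)) * K)).
    exact: (is_deriveB (is_deriveZ s (dt i0 p0 at0)) (is_deriveZ m de)).
  apply: (derive_ge0_of_left_max at0 df) => t /andP[ta tt0].
  rewrite [leRHS](_ : _ = 0); last by rewrite /f sD Dm subrr.
  rewrite subr_le0; apply: (le_trans (sle _)); apply: bound.
  by rewrite ta (le_trans tt0).
have [src1 src2] := @srcD i0 t0 p0 (m * expR (K * (t0 - a))) at0 ta1
  (fun j => bound j t0 p0 ltac:(by rewrite (ltW at0) ta1)).
have ssrc : s * src i0 t0 p0 <= M * (m * expR (K * (t0 - a))).
  apply: (le_trans (sle _)); rewrite ler_norml; apply/andP; split; last exact: src1.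
  by rewrite lerNl.
have lap : kappa * (s * \sum_(j < 3) Dxx i0 j t0 p0) <= 0.
  rewrite mulr_ge0_le0// mulr_sumr; apply: sumr_le0 => j _.
  by have [] := sp j.
have E : s * Dt i0 t0 p0 = kappa * (s * \sum_(j < 3) Dxx i0 j t0 p0)
    - V t0 p0 * (s * Dx i0 gam t0 p0) + s * src i0 t0 p0.
  by rewrite eqD//; ring.
move: time; rewrite E (sp gam).1 mulr0 subr0 => time.
have pos : 0 < m * expR (K * (t0 - a)) by rewrite mulr_gt0// expR_gt0.
have : m * (expR (K * (t0 - a)) * K) <= M * (m * expR (K * (t0 - a))) by lra.
have -> : m * (expR (K * (t0 - a)) * K) = M * (m * expR (K * (t0 - a))) + m * expR (K * (t0 - a)).
  by rewrite /K; ring.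
by rewrite gerDl leNgt pos.
Qed.

End MaximumPrinciple.

(** * Fourier coefficients *)

Section TestFunctions.
Context {R : realType}.
Implicit Types (p q : R3 R) (k l : 'I_3 -> int) (x y : R).

Lemma comp3D p q j : comp3 (p + q) j = comp3 p j + comp3 q j.
Proof. by move: j; apply: ord3_ind. Qed.

Lemma comp3Z x p j : comp3 (x *: p) j = x * comp3 p j.
Proof. by move: j; apply: ord3_ind. Qed.

Lemma comp3_basis i j : comp3 (basis3 i : R3 R) j = (i == j)%:R.
Proof. by move: i j; do 2 apply: ord3_ind. Qed.

Lemma comp3_continuous j : continuous (fun p => comp3 p j).
Proof.
move: j; apply: ord3_ind => p; rewrite /comp3/=.
- by apply: (@continuous_comp _ _ _ fst fst); exact: cvg_fst.
- by apply: (@continuous_comp _ _ _ fst snd); [exact: cvg_fst|exact: cvg_snd].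
- exact: cvg_snd.
Qed.

Definition unit_mode (i : 'I_3) : 'I_3 -> int := fun j => (i == j)%:Z.

Lemma basis3_zvec i : basis3 i = zvec (unit_mode i) :> R3 R.
Proof. by move: i; apply: ord3_ind. Qed.

Definition dot k p : R := \sum_(j < 3) (k j)%:~R * comp3 p j.

Lemma dotD k p q : dot k (p + q) = dot k p + dot k q.
Proof. by rewrite /dot -big_split/=; apply: eq_bigr => j _; rewrite comp3D mulrDr. Qed.

Lemma dotZ k x p : dot k (x *: p) = x * dot k p.
Proof. by rewrite /dot mulr_sumr; apply: eq_bigr => j _; rewrite comp3Z mulrCA. Qed.

Lemma dot_basis k j : dot k (basis3 j) = (k j)%:~R.
Proof.
rewrite /dot (bigD1 j)//= comp3_basis eqxx mulr1 big1 ?addr0// => i ij.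
by rewrite comp3_basis eq_sym (negbTE ij) mulr0.
Qed.

Lemma dot_continuous k : continuous (dot k).
Proof.
have ck j : continuous (fun p => (k j)%:~R * comp3 p j).
  by move=> p; apply: cvgMl_tmp; exact: comp3_continuous.
have -> : dot k = (fun p => (k ord0)%:~R * comp3 p ord0 +
    ((k (lift ord0 ord0))%:~R * comp3 p (lift ord0 ord0) +
     (k (lift ord0 (lift ord0 ord0)))%:~R * comp3 p (lift ord0 (lift ord0 ord0)))).
  by apply/funext => p; rewrite /dot !big_ord_recl big_ord0 addr0.
by move=> p; apply: cvgD; [exact: ck|apply: cvgD; exact: ck].
Qed.

(** Real modes with a phase: [x = 0] is the cosine, [x = - (pi / 2)] the sine. Differentiation
    shifts [x] by [pi / 2], and products stay in the linear span. *)
Definition tf k x p : R := cos (2 * pi * dot k p + x).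

Lemma tf_continuous k x : continuous (tf k x).
Proof.
move=> p; apply: continuous_comp; last exact: continuous_cos.
by apply: cvgD; [apply: cvgMl_tmp; exact: dot_continuous|exact: cvg_cst].
Qed.

Lemma is_derive_of_line (V : normedModType R) (u : V -> R) (p v : V) (d : R) :
  is_derive (0 : R) (1 : R) (fun s => u (p + s *: v)) d -> is_derive p v u d.
Proof.
move=> [dv de].
have E : (fun h : R => h^-1 *: (u (p + (h *: (1 : R) + 0) *: v) - u (p + 0 *: v))) =
         (fun h : R => h^-1 *: (u (h *: v + p) - u p)).
  apply/funext => h; congr (_ *: (u _ - u _)).
    by rewrite addr0 scaler1 addrC.
  by rewrite scale0r addr0.
split.
- by move: dv; rewrite /derivable E.
- by move: de; rewrite /derive E.
Qed.

Lemma is_derive_tf k x j p :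
  is_derive p (basis3 j) (tf k x) (2 * pi * (k j)%:~R * tf k (x + pi / 2) p).
Proof.
apply: is_derive_of_line.
have E : (fun s : R => tf k x (p + s *: basis3 j)) =
    cos \o (fun s : R => 2 * pi * (k j)%:~R * s + (2 * pi * dot k p + x)).
  by apply/funext => s; rewrite /tf/= dotD dotZ dot_basis; congr cos; ring.
have d1 : is_derive (0 : R) (1 : R) (fun s : R => 2 * pi * (k j)%:~R * s + (2 * pi * dot k p +
    x)) (2 * pi * (k j)%:~R).
  have d := is_deriveD (is_deriveZ (2 * pi * (k j)%:~R) (is_derive_id (0 : R) (1 : R)))
    (is_derive_cst (2 * pi * dot k p + x) (0 : R) (1 : R)).
  by apply: (is_derive_eq d); rewrite addr0 /GRing.scale/= mulr1.
rewrite E; have d2 := @is_derive1_comp _ cos _ 0 _ _ (is_derive_cos _) d1.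
apply: (is_derive_eq d2).
by rewrite mulr0 add0r /tf addrA cosDpihalf mulrC.
Qed.

Lemma cos_int_periodic x (m : int) : cos (x + 2 * pi * m%:~R) = cos x.
Proof.
have H n : cos (x + 2 * pi * n%:R) = cos x.
  have -> : 2 * pi * n%:R = (pi *+ 2) *+ n :> R by rewrite -[RHS]mulr_natr -[pi *+ 2]mulr_natl.
  exact: (periodicn (@cosD2pi R)).
case: m => n; first exact: H.
rewrite NegzE mulrNz mulrN -[in RHS](subrK (2 * pi * n.+1%:R) x).
have -> : (n.+1 : int)%:~R = n.+1%:R :> R by [].
rewrite (_ : cos (x - _ + _) = cos (x - 2 * pi * n.+1%:R))//.
set y := x - _; have -> : y + 2 * pi * n.+1%:R = y + (pi *+ 2) *+ n.+1.
  by congr (_ + _); rewrite -[RHS]mulr_natr -[pi *+ 2]mulr_natl.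
exact: (periodicn (@cosD2pi R)).
Qed.

Lemma tf_periodic k x p j : tf k x (p + basis3 j) = tf k x p.
Proof. by rewrite /tf dotD dot_basis mulrDr addrAC cos_int_periodic. Qed.

Lemma tfM k l x y p : tf k x p * tf l y p =
  2^-1 * (tf (fun j => k j + l j) (x + y) p + tf (fun j => k j - l j) (x - y) p).
Proof.
have d1 : dot (fun j => k j + l j) p = dot k p + dot l p.
  by rewrite /dot -big_split/=; apply: eq_bigr => j _; rewrite intrD mulrDl.
have d2 : dot (fun j => k j - l j) p = dot k p - dot l p.
  by rewrite /dot -sumrB; apply: eq_bigr => j _; rewrite intrB mulrBl.
rewrite /tf d1 d2; set a := dot k p; set b := dot l p.
rewrite (_ : 2 * pi * (a + b) + (x + y) = (2 * pi * a + x) + (2 * pi * b + y)); last by ring.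
rewrite (_ : 2 * pi * (a - b) + (x - y) = (2 * pi * a + x) - (2 * pi * b + y)); last by ring.
set X := 2 * pi * a + x; set Y := 2 * pi * b + y; rewrite (cosD X Y) (cosB X Y); lra.
Qed.

Lemma tint_by_parts (j : 'I_3) (f fx g gx : R3 R -> R) :
  (forall p, is_derive p (basis3 j) f (fx p)) ->
  (forall p, is_derive p (basis3 j) g (gx p)) ->
  continuous f -> continuous fx -> continuous g -> continuous gx ->
  (forall p, f (p + basis3 j) = f p) -> (forall p, g (p + basis3 j) = g p) ->
  tint (fun p => fx p * g p) = - tint (fun p => f p * gx p).
Proof.
move=> df dg cf cfx cg cgx pf pg; apply/eqP; rewrite -addr_eq0 addrC.
rewrite -tintD; last 2 first.
- by move=> p; apply: cvgM; [exact: cf|exact: cgx].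
- by move=> p; apply: cvgM; [exact: cfx|exact: cg].
apply/eqP; apply: (@tint_derive0 _ j (fun p => f p * g p)).
- move=> p; have d := is_deriveM (df p) (dg p).
  by apply: (is_derive_eq d); rewrite /GRing.scale/= [g p * _]mulrC.
- by move=> p; apply: cvgD; apply: cvgM; [exact: cf|exact: cgx|exact: cfx|exact: cg].
- by move=> p; rewrite pf pg.
Qed.

End TestFunctions.

Lemma continuous_pairing {X Y Z : topologicalType} (f : X -> Y) (g : X -> Z) :
  continuous f -> continuous g -> continuous (fun x => (f x, g x)).
Proof.
move=> cf cg x.
by apply: (@cvg_pair _ _ _ _ (nbhs (f x)) (nbhs (g x))); [exact: cf|exact: cg].
Qed.

Section FourierCoefficients.
Context {R : realType}.
Implicit Types (p q : R3 R) (k l : 'I_3 -> int) (x y t s : R).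
Local Notation R1 := (measurableTypeR R).

(* The regularity of one component of a solution; it is clipped at time 0 so that
   continuity can be stated on the whole space. *)
Record c12 (u ut : R -> R3 R -> R) (ux uxx : 'I_3 -> R -> R3 R -> R) : Prop := C12 {
  c12_per : forall t p k, 0 <= t -> u t (p + zvec k) = u t p;
  c12_cont : continuous (fun q : R * R3 R => u (Num.max q.1 0) q.2);
  c12_dt : forall t p, 0 < t -> is_derive t (1 : R) (u ^~ p) (ut t p);
  c12_dtc : forall t p, 0 < t -> {for (t, p), continuous (fun q : R * R3 R => ut q.1 q.2)};
  c12_dx : forall j t p, 0 < t -> is_derive p (basis3 j) (u t) (ux j t p);
  c12_dxc : forall j t p, 0 < t -> {for (t, p), continuous (fun q : R * R3 R => ux j q.1 q.2)};
  c12_dxx : forall j t p, 0 < t -> is_derive p (basis3 j) (ux j t) (uxx j t p);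
  c12_dxxc : forall j t p, 0 < t -> {for (t, p), continuous (fun q : R * R3 R => uxx j q.1 q.2)}
}.

Lemma continuous_slice (f : R * R3 R -> R) t :
  (forall p, {for (t, p), continuous f}) -> continuous (fun p => f (t, p)).
Proof.
move=> cf p; apply: (@continuous_comp _ _ _ (fun p => (t, p)) f); last exact: cf.
by apply: continuous_pairing => q; [exact: cvg_cst|exact: cvg_id].
Qed.

Lemma continuous_clip (f : R * R3 R -> R) (a : R) :
  (forall t p, a <= t -> {for (t, p), continuous f}) ->
  continuous (fun q : R * R3 R => f (Num.max q.1 a, q.2)).
Proof.
move=> cf q; apply: (@continuous_comp _ _ _ (fun q : R * R3 R => (Num.max q.1 a, q.2)) f).
  apply: continuous_pairing => r; last exact: cvg_snd.
  by apply: (@continuous_comp _ _ _ fst (fun t => Num.max t a)); [exact: cvg_fst|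
    apply: continuous_max; [exact: cvg_id|exact: cvg_cst]].
by apply: cf; rewrite le_max lexx orbT.
Qed.

Variables (u ut : R -> R3 R -> R) (ux uxx : 'I_3 -> R -> R3 R -> R).
Hypothesis hu : c12 u ut ux uxx.

Lemma c12_slice t : 0 <= t -> continuous (u t).
Proof.
move=> t0; have cu : continuous (fun q : R * R3 R => u (Num.max q.1 0) q.2).
  exact: (c12_cont hu).
have := @continuous_slice (fun q : R * R3 R => u (Num.max q.1 0) q.2) t (fun p => cu (t, p)).
by rewrite /= max_l.
Qed.

Lemma c12_ux_slice j t : 0 < t -> continuous (ux j t).
Proof.
move=> t0; have H p : {for (t, p), continuous (fun z : R * R3 R => ux j z.1 z.2)}.
  exact: (c12_dxc hu).
exact: (@continuous_slice (fun z => ux j z.1 z.2) t H).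
Qed.

Lemma c12_uxx_slice j t : 0 < t -> continuous (uxx j t).
Proof.
move=> t0; have H p : {for (t, p), continuous (fun z : R * R3 R => uxx j z.1 z.2)}.
  exact: (c12_dxxc hu).
exact: (@continuous_slice (fun z => uxx j z.1 z.2) t H).
Qed.

Lemma c12_ux_periodic j i t p : 0 < t -> ux j t (p + basis3 i) = ux j t p.
Proof.
move=> t0; have [d1 <-] := c12_dx hu j (p + basis3 i) t0.
have [d2 <-] := c12_dx hu j p t0.
have E : (fun h : R => h^-1 *: ((u t \o shift (p + basis3 i)) (h *: basis3 j) - u t (p + basis3
    i))) =
    (fun h : R => h^-1 *: ((u t \o shift p) (h *: basis3 j) - u t p)).
  by apply/funext => h /=; rewrite (basis3_zvec i) addrA !(c12_per hu)// ltW.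
by rewrite /derive E.
Qed.

Definition fc (u : R -> R3 R -> R) k x t : R := tint (fun p => u t p * tf k x p).

Lemma fc_continuous k x : continuous (fun t => fc u k x (Num.max t 0)).
Proof.
pose f t (p : R3 R1) := u (Num.max t 0) p * tf k x p.
have cf : continuous (fun q : R * R3 R => f q.1 q.2).
  move=> q; apply: cvgM; first exact: (c12_cont hu).
  by apply: (@continuous_comp _ _ _ snd (tf k x)); [exact: cvg_snd|exact: tf_continuous].
move=> t.
have [M hM] := bounded_on_box (t - 1) (t + 1) cf.
have : {in `]t - 1, t + 1[%classic, continuous (fun s => \int[@lebesgue3 R]_(p in cube) f s p)}.
  apply: (@continuity_under_integral R _ (R3 R1) (@lebesgue3 R) f cube (@measurable_cube R)
    (t - 1) (t + 1) _ _ (cst M)).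
  - move=> s _; apply: integrable_cube.
    exact: (@continuous_slice (fun z => f z.1 z.2) s (fun p => cf (s, p))).
  - apply: aeW => p _ s _.
    apply: (@continuous_comp _ _ _ (fun s : R => (s, p : R3 R)) (fun z => f z.1 z.2)); last
        exact: cf.
    by apply: continuous_pairing => r; [exact: cvg_id|exact: cvg_cst].
  - by apply: integrable_cube; exact: cst_continuous.
  - move=> s; rewrite /= in_itv/= => /andP[s1 s2]; apply: aeW => p pc.
    by apply: hM; [rewrite (ltW s1) ltW|exact: cube_ccube].
by apply; rewrite inE/= in_itv/=; lra.
Qed.

Lemma fc_derive k x t : 0 < t ->
  is_derive t (1 : R) (fc u k x) (tint (fun p => ut t p * tf k x p)).
Proof.
move=> t0; pose f s (p : R3 R1) := u s p * tf k x p.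
have a0 : 0 < t / 2 by rewrite divr_gt0.
(* Continuity of [ut] is known only at positive times; clipping at [t / 2] makes the function
   continuous everywhere without changing it near [t]. *)
have cut : continuous (fun q : R * R3 R => ut (Num.max q.1 (t / 2)) q.2 * tf k x q.2).
  move=> q; apply: cvgM.
    apply: (@continuous_clip (fun z => ut z.1 z.2) (t / 2)) => s p ts.
    by apply: (c12_dtc hu); exact: lt_le_trans ts.
  by apply: (@continuous_comp _ _ _ snd (tf k x)); [exact: cvg_snd|exact: tf_continuous].
have [M hM] := bounded_on_box (t / 2) (2 * t) cut.
have df s (p : R3 R1) : 0 < s -> is_derive s (1 : R) (f ^~ p) (ut s p * tf k x p).
  move=> s0; have d := is_deriveM (c12_dt hu p s0) (is_derive_cst (tf k x p) s (1 : R)).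
  by apply: (is_derive_eq d); rewrite scaler0 add0r /GRing.scale/= mulrC.
have pE s (p : R3 R1) : 0 < s -> partial1of2 f s p = ut s p * tf k x p.
  by move=> s0; rewrite partial1of2E; have [_ ->] := df s p s0.
have Ip : (`]t / 2, 2 * t[%classic : set R) t by rewrite /= in_itv/=; lra.
have := @cvg_differentiation_under_integral R _ (R3 R1) (@lebesgue3 R) f cube (@measurable_cube R)
  t (t / 2) (2 * t) Ip _ _ (cst `|M|) _ _ _.
have -> : \int[@lebesgue3 R]_(p in cube) partial1of2 f t p = tint (fun p => ut t p * tf k x p).
  by apply: eq_Rintegral => p _; exact: pE.
move=> H; have {}H : h^-1 *: (fc u k x (h + t) - fc u k x t) @[h --> 0^'] -->
    tint (fun p => ut t p * tf k x p).
  apply: H.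
  - move=> s; rewrite /= in_itv/= => /andP[s1 _]; apply: integrable_cube.
    move=> p; apply: cvgM; last exact: tf_continuous.
    by apply: c12_slice; lra.
  - move=> s p; rewrite /= in_itv/= => /andP[s1 _] _.
    by have [] := df s p (lt_trans a0 s1).
  - by move=> p; exact: normr_ge0.
  - by apply: integrable_cube; exact: cst_continuous.
  - move=> s p; rewrite /= in_itv/= => /andP[s1 s2] pc.
    rewrite pE; last exact: lt_trans s1.
    have := hM s p; rewrite /= max_l; last exact: ltW.
    move=> h; apply: le_trans (ler_norm M); apply: h; last exact: cube_ccube.
    by rewrite !ltW.
have E : (fun h : R => h^-1 *: ((fc u k x \o shift t) (h *: (1 : R)) - fc u k x t)) =
    (fun h : R => h^-1 *: (fc u k x (h + t) - fc u k x t)).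
  by apply/funext => h; rewrite /= scaler1.
split.
- by apply/cvg_ex; exists (tint (fun p => ut t p * tf k x p)); rewrite E.
- by rewrite /derive E; exact: cvg_lim H.
Qed.

Lemma fc_shift_pi k x t : 0 <= t -> fc u k (x + pi / 2 + pi / 2) t = - fc u k x t.
Proof.
move=> t0; rewrite -[RHS]mulN1r -tintZ; last first.
  by move=> p; apply: cvgM; [exact: c12_slice|exact: tf_continuous].
apply: tint_eq => p; rewrite /tf (_ : _ + (x + pi / 2 + pi / 2) = (2 * pi * dot k p + x) + pi).
  by rewrite cosDpi; ring.
by lra.
Qed.

Lemma fc_ux j k x t : 0 < t ->
  tint (fun p => ux j t p * tf k x p) = - (2 * pi * (k j)%:~R * fc u k (x + pi / 2) t).
Proof.
move=> t0; have t0' := ltW t0.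
transitivity (- tint (fun p => u t p * (2 * pi * (k j)%:~R * tf k (x + pi / 2) p))).
  apply: (@tint_by_parts _ j).
  - by move=> p; exact: (c12_dx hu).
  - by move=> p; exact: is_derive_tf.
  - exact: c12_slice.
  - exact: c12_ux_slice.
  - exact: tf_continuous.
  - by move=> p; apply: cvgMl_tmp; exact: tf_continuous.
  - by move=> p; rewrite basis3_zvec (c12_per hu).
  - by move=> p; exact: tf_periodic.
congr (- _); rewrite -tintZ; last first.
  by move=> p; apply: cvgM; [exact: c12_slice|exact: tf_continuous].
by apply: tint_eq => p; rewrite mulrCA.
Qed.

Lemma fc_uxx j k x t : 0 < t ->
  tint (fun p => uxx j t p * tf k x p) = - ((2 * pi * (k j)%:~R) ^+ 2 * fc u k x t).
Proof.
move=> t0; have cux : continuous (ux j t) by exact: c12_ux_slice.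
transitivity (- tint (fun p => ux j t p * (2 * pi * (k j)%:~R * tf k (x + pi / 2) p))).
  apply: (@tint_by_parts _ j).
  - by move=> p; exact: (c12_dxx hu).
  - by move=> p; exact: is_derive_tf.
  - exact: cux.
  - exact: c12_uxx_slice.
  - exact: tf_continuous.
  - by move=> p; apply: cvgMl_tmp; exact: tf_continuous.
  - by move=> p; exact: c12_ux_periodic.
  - by move=> p; exact: tf_periodic.
have -> : tint (fun p => ux j t p * (2 * pi * (k j)%:~R * tf k (x + pi / 2) p)) =
    2 * pi * (k j)%:~R * tint (fun p => ux j t p * tf k (x + pi / 2) p).
  rewrite -tintZ; last by move=> p; apply: cvgM; [exact: cux|exact: tf_continuous].
  by apply: tint_eq => p; rewrite mulrCA.
by rewrite fc_ux// fc_shift_pi ?ltW//; ring.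
Qed.

End FourierCoefficients.

(** * Fourier coefficients over one time step *)

Section StepFourier.
Context {R : realType}.
Implicit Types (p : R3 R) (k l : 'I_3 -> int) (x t s : R).

(** Variation of constants with a given primitive [H] of the weighted source: [G] has zero
    derivative inside the interval and is continuous up to its ends. *)
Lemma ode_solution (F r H : R -> R) (a lam b : R) : 0 <= a -> a <= b ->
  continuous (fun t => F (Num.max t 0)) ->
  (forall t, a < t -> t < b -> is_derive t (1 : R) F (- lam * F t + r t)) ->
  continuous H ->
  (forall t, a < t -> t < b -> is_derive t (1 : R) H (expR (lam * (t - a)) * r t)) ->
  expR (lam * (b - a)) * F b - H b = F a - H a.
Proof.
move=> a0; rewrite le_eqVlt => /predU1P[->|ab] cF dF cH dH.
  by rewrite subrr mulr0 expR0 mul1r.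
pose G t := expR (lam * (t - a)) * F t - H t.
have de t : is_derive t (1 : R) (fun t => expR (lam * (t - a))) (expR (lam * (t - a)) * lam).
  apply: (@is_derive1_comp _ expR (fun t => lam * (t - a))).
  have d1 := is_deriveB (is_derive_id t (1 : R)) (is_derive_cst (a : R) t (1 : R)).
  by apply: (is_derive_eq (is_deriveZ lam d1)); rewrite subr0 /GRing.scale/= mulr1.
have dG t : t \in `]a, b[ -> is_derive t (1 : R) G 0.
  rewrite in_itv/= => /andP[at0 tb].
  have d := is_deriveB (is_deriveM (de t) (dF t at0 tb)) (dH t at0 tb).
  by apply: (is_derive_eq d); rewrite /GRing.scale/=; ring.
have cG : {within `[a, b], continuous G}.
  pose G' t := expR (lam * (t - a)) * F (Num.max t 0) - H t.
  apply: (@subspace_eq_continuous _ _ _ G').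
    move=> t; rewrite inE/= in_itv/= => /andP[at0 _].
    by rewrite /G /G' max_l// (le_trans a0).
  apply: continuous_subspaceT => t; apply: cvgB; last exact: cH.
  apply: cvgM; last exact: cF.
  apply: continuous_comp; last exact: continuous_expR.
  by apply: cvgMl_tmp; apply: cvgB; [exact: cvg_id|exact: cvg_cst].
have [t _] := MVT ab dG cG.
rewrite mul0r /G subrr mulr0 expR0 mul1r => /eqP; rewrite subr_eq0 => /eqP.
by [].
Qed.

Variables (n : nat) (kappa : R) (eta : R -> R) (ph : R) (al be ga : 'I_3).
Hypothesis al_ga : al != ga.
Hypothesis be_ga : be != ga.

Definition shear_mode (al be : 'I_3) : 'I_3 -> int := fun j => unit_mode al j - unit_mode be j.
Local Notation k0 := (shear_mode al be).

(** The eigenvalue of [- kappa] times the Laplacian on the mode [k]. *)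
Definition mode_rate (kappa : R) k : R := kappa * \sum_(j < 3) (2 * pi * (k j)%:~R) ^+ 2.

Lemma shear_mode_ga : k0 ga = 0.
Proof. by rewrite /shear_mode /unit_mode (negbTE al_ga) (negbTE be_ga). Qed.

Variables (u ut : R -> R3 R -> R) (ux uxx : 'I_3 -> R -> R3 R -> R).
Hypothesis hu : c12 u ut ux uxx.
Variable src : R -> R3 R -> R.
Hypothesis csrc : forall t, n%:R < t -> continuous (src t).
Hypothesis equ : forall t p, n%:R < t -> t <= n%:R + 1 ->
  ut t p = kappa * (\sum_(j < 3) uxx j t p)
    - (eta (t - n%:R) * tf k0 (ph - pi / 2) p) * ux ga t p + src t p.

Let pos t : n%:R < t -> 0 < t.
Proof. exact: le_lt_trans. Qed.

(** The velocity points along [ga] and is a mode without [ga] component. Its product with the mode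
    [k] has none either, so integrating the transport term by parts along [ga] gives zero. *)
Lemma fc_ut k x t : k ga = 0 -> n%:R < t -> t <= n%:R + 1 ->
  tint (fun p => ut t p * tf k x p) =
    - mode_rate kappa k * fc u k x t + tint (fun p => src t p * tf k x p).
Proof.
move=> kga nt tn; have t0 := pos nt.
have ctf l y : continuous (tf l y : R3 R -> R) by exact: tf_continuous.
have cuxx j : continuous (fun p => uxx j t p * tf k x p).
  by move=> p; apply: cvgM; [exact: (c12_uxx_slice hu)|exact: ctf].
have cux l y : continuous (fun p => ux ga t p * tf l y p).
  by move=> p; apply: cvgM; [exact: (c12_ux_slice hu)|exact: ctf].
have cs : continuous (fun p => src t p * tf k x p).
  by move=> p; apply: cvgM; [exact: csrc|exact: ctf].
pose o0 : 'I_3 := ord0; pose o1 : 'I_3 := lift ord0 ord0; pose o2 : 'I_3 := lift ord0 (lift ord0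
    ord0).
pose kp j := k0 j + k j; pose km j := k0 j - k j.
have E p : ut t p * tf k x p = (kappa * (uxx o0 t p * tf k x p) +
     (kappa * (uxx o1 t p * tf k x p) + kappa * (uxx o2 t p * tf k x p))) +
    ((- (eta (t - n%:R) / 2) * (ux ga t p * tf kp (ph - pi / 2 + x) p) +
      - (eta (t - n%:R) / 2) * (ux ga t p * tf km (ph - pi / 2 - x) p)) +
     src t p * tf k x p).
  rewrite equ// !big_ord_recl big_ord0 addr0 mulrDl mulrBl.
  have -> : eta (t - n%:R) * tf k0 (ph - pi / 2) p * ux ga t p * tf k x p =
      eta (t - n%:R) * ux ga t p * (tf k0 (ph - pi / 2) p * tf k x p) by ring.
  by rewrite tfM -/kp -/km -/o0 -/o1 -/o2; field.
rewrite (tint_eq E).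
have cZ (f : R3 R -> R) (c : R) : continuous f -> continuous (fun p => c * f p).
  by move=> cf p; apply: cvgMl_tmp; exact: cf.
have cD (f g : R3 R -> R) : continuous f -> continuous g -> continuous (fun p => f p + g p).
  by move=> cf cg p; apply: cvgD; [exact: cf|exact: cg].
have cA j : continuous (fun p => kappa * (uxx j t p * tf k x p)) by exact: cZ.
have cB l y (c : R) : continuous (fun p => c * (ux ga t p * tf l y p)) by exact: cZ.
have cAA : continuous (fun p => kappa * (uxx o1 t p * tf k x p) + kappa * (uxx o2 t p * tf k x p)).
  exact: cD.
have cBB : continuous (fun p => - (eta (t - n%:R) / 2) * (ux ga t p * tf kp (ph - pi / 2 + x) p) +
      - (eta (t - n%:R) / 2) * (ux ga t p * tf km (ph - pi / 2 - x) p)) by exact: cD.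
rewrite tintD; [|exact: (cD _ _ (cA o0) cAA)|exact: (cD _ _ cBB cs)].
rewrite [X in X + _]tintD; [|exact: cA|exact: cAA].
rewrite [X in (_ + X) + _]tintD; [|exact: cA|exact: cA].
rewrite [X in _ + X]tintD; [|exact: cBB|exact: cs].
rewrite [X in _ + (X + _)]tintD; [|exact: cB|exact: cB].
rewrite !tintZ// !(fc_uxx hu)// !(fc_ux hu)//.
have -> : kp ga = 0 by rewrite /kp shear_mode_ga kga.
have -> : km ga = 0 by rewrite /km shear_mode_ga kga.
rewrite !mulr0 !mul0r !oppr0 !mulr0 !addr0 add0r; congr (_ + _).
by rewrite /mode_rate !big_ord_recl big_ord0 -/o0 -/o1 -/o2; ring.
Qed.

End StepFourier.

Section StepSolutions.
Context {R : realType}.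
Implicit Types (p : R3 R) (k l : 'I_3 -> int) (x t s : R).
Variables (n : nat) (kappa : R) (eta : R -> R) (ph : R) (al be ga : 'I_3).
Hypothesis al_ga : al != ga.
Hypothesis be_ga : be != ga.
Hypothesis ceta : continuous eta.
Local Notation k0 := (shear_mode al be).

Lemma fc_decay (u ut : R -> R3 R -> R) (ux uxx : 'I_3 -> R -> R3 R -> R) k x t :
  c12 u ut ux uxx ->
  (forall t p, n%:R < t -> t <= n%:R + 1 ->
    ut t p = kappa * (\sum_(j < 3) uxx j t p)
      - (eta (t - n%:R) * tf k0 (ph - pi / 2) p) * ux ga t p) ->
  k ga = 0 -> n%:R <= t <= n%:R + 1 ->
  fc u k x t = expR (- mode_rate kappa k * (t - n%:R)) * fc u k x n%:R.
Proof.
move=> hu equ kga /andP[nt tn].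
have cF : continuous (fun t => fc u k x (Num.max t 0)) by exact: (fc_continuous hu).
have dF s : n%:R < s -> s < t ->
    is_derive s (1 : R) (fc u k x) (- mode_rate kappa k * fc u k x s + cst 0 s).
  move=> ns st; have s0 : 0 < s := le_lt_trans (ler0n _ _) ns.
  have sn : s <= n%:R + 1 := ltW (lt_le_trans st tn).
  have d := fc_derive hu k x s0; apply: (is_derive_eq d).
  rewrite (@fc_ut _ n kappa eta ph al be ga al_ga be_ga u ut ux uxx hu (fun _ => cst 0))//.
  - congr (_ + _); rewrite -[RHS](@tint_cst R 0); apply: tint_eq => p.
    by rewrite mul0r.
  - by move=> t' _; exact: cst_continuous.
  - by move=> t' p h1 h2; rewrite addr0; exact: equ.
have dH s : n%:R < s -> s < t ->
    is_derive s (1 : R) (cst 0) (expR (mode_rate kappa k * (s - n%:R)) * cst 0 s).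
  by move=> _ _; rewrite mulr0; exact: is_derive_cst.
have := ode_solution (ler0n _ _) nt cF dF (@cst_continuous _ _ _) dH.
by rewrite !subr0 => <-; rewrite mulrA -expRD mulNr addNr expR0 mul1r.
Qed.

(** The time integral in Duhamel's formula when the target mode and the driving mode have decay
    rates differing by [mu]. *)
Definition eta_weight (mu : R) : R := int01 (fun s => eta s * expR (mu * s)).

(** Duhamel's formula. The driving field [v] is not stretched, so by [fc_decay] its two relevant
    modes are explicit exponentials in time. *)
Lemma fc_source (u ut v vt : R -> R3 R -> R) (ux uxx vx vxx : 'I_3 -> R -> R3 R -> R) k x :
  c12 u ut ux uxx -> c12 v vt vx vxx ->
  (forall t p, n%:R < t -> t <= n%:R + 1 ->
    vt t p = kappa * (\sum_(j < 3) vxx j t p)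
      - (eta (t - n%:R) * tf k0 (ph - pi / 2) p) * vx ga t p) ->
  (forall t p, n%:R < t -> t <= n%:R + 1 ->
    ut t p = kappa * (\sum_(j < 3) uxx j t p)
      - (eta (t - n%:R) * tf k0 (ph - pi / 2) p) * ux ga t p
      + eta (t - n%:R) * (2 * pi * tf k0 ph p) * v t p) ->
  k ga = 0 ->
  let kp j := k0 j + k j in let km j := k0 j - k j in
  expR (mode_rate kappa k) * fc u k x (n%:R + 1) = fc u k x n%:R +
    pi * (eta_weight (mode_rate kappa k - mode_rate kappa kp) * fc v kp (ph + x) n%:R +
          eta_weight (mode_rate kappa k - mode_rate kappa km) * fc v km (ph - x) n%:R).
Proof.
move=> hu hv eqv equ kga kp km.
set lam := mode_rate kappa k.
have n1 : n%:R <= n%:R + 1 :> R by rewrite lerDl.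
pose w mu s := eta s * expR (mu * s).
have cw mu : continuous (w mu).
  move=> s; apply: cvgM; first exact: ceta.
  apply: continuous_comp; last exact: continuous_expR.
  exact: mulrl_continuous.
set mp := lam - mode_rate kappa kp; set mm := lam - mode_rate kappa km.
have [Hp dHp] := antiderivative (cw mp).
have [Hm dHm] := antiderivative (cw mm).
(* The primitives are controlled only to the right of -1, so their argument is clipped at 0, without
   effect for [t >= n]. *)
pose H t := pi * (fc v kp (ph + x) n%:R * Hp (Num.max (t - n%:R) 0) + fc v km (ph - x) n%:R * Hm
    (Num.max (t - n%:R) 0)).
have cmax (h f : R -> R) : (forall s, -1 < s -> is_derive s (1 : R) h (f s)) ->
    continuous (fun t => h (Num.max (t - n%:R) 0)).
  move=> dh t; apply: (@continuous_comp _ _ _ (fun t => Num.max (t - n%:R) 0) h).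
    apply: continuous_max; last exact: cvg_cst.
    by apply: cvgB; [exact: cvg_id|exact: cvg_cst].
  apply: differentiable_continuous; apply/derivable1_diffP.
  have h1 : -1 < Num.max (t - n%:R) 0 by rewrite lt_max ltrN10 orbT.
  by have [] := dh _ h1.
(* [pi] is the [2 * pi] of the stretching term times the 1/2 of [tfM]. *)
pose r s := eta (s - n%:R) * pi * (fc v kp (ph + x) s + fc v km (ph - x) s).
have kpga : kp ga = 0 by rewrite /kp shear_mode_ga// kga.
have kmga : km ga = 0 by rewrite /km shear_mode_ga// kga.
have cF : continuous (fun t => fc u k x (Num.max t 0)) by exact: (fc_continuous hu).
have dF s : n%:R < s -> s < n%:R + 1 -> is_derive s (1 : R) (fc u k x) (- lam * fc u k x s + r s).
  move=> ns st; have s0 : 0 < s := le_lt_trans (ler0n _ _) ns.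
    have d := fc_derive hu k x s0; apply: (is_derive_eq d).
    have cv : continuous (v s) by apply: (c12_slice hv); exact: ltW.
    have ctf l y : continuous (tf l y : R3 R -> R) by exact: tf_continuous.
    rewrite (@fc_ut _ n kappa eta ph al be ga al_ga be_ga u ut ux uxx hu
      (fun t p => eta (t - n%:R) * (2 * pi * tf k0 ph p) * v t p))//; last 2 first.
    + move=> t nt p; apply: cvgM.
        by apply: cvgMl_tmp; apply: cvgMl_tmp; exact: tf_continuous.
      by apply: (c12_slice hv); exact: ltW (le_lt_trans (ler0n _ _) nt).
    + exact: ltW.
    congr (_ + _); rewrite /r /fc -tintD; last 2 first.
    + by move=> p; apply: cvgM; [exact: cv|exact: ctf].
    + by move=> p; apply: cvgM; [exact: cv|exact: ctf].
    rewrite -tintZ; last first.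
      by move=> p; apply: cvgD; apply: cvgM; [exact: cv|exact: ctf|exact: cv|exact: ctf].
    apply: tint_eq => p.
    have -> : eta (s - n%:R) * (2 * pi * tf k0 ph p) * v s p * tf k x p =
      eta (s - n%:R) * (2 * pi) * v s p * (tf k0 ph p * tf k x p) by ring.
    by rewrite tfM -/kp -/km; field.
have cH : continuous H.
  move=> t; apply: cvgMl_tmp; apply: cvgD; apply: cvgMl_tmp.
    + exact: (cmax _ _ dHp).
    + exact: (cmax _ _ dHm).
have dH s : n%:R < s -> s < n%:R + 1 -> is_derive s (1 : R) H (expR (lam * (s - n%:R)) * r s).
  move=> ns st.
    have sn : n%:R <= s <= n%:R + 1 by rewrite !ltW.
    have shift (h f : R -> R) : (forall s, -1 < s -> is_derive s (1 : R) h (f s)) ->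
        is_derive s (1 : R) (fun t => h (Num.max (t - n%:R) 0)) (f (s - n%:R)).
      move=> dh.
      have sn0 : 0 < s - n%:R by rewrite subr_gt0.
      have d1 := is_deriveB (is_derive_id s (1 : R)) (is_derive_cst (n%:R : R) s (1 : R)).
      have d2 : is_derive s (1 : R) (h \o (fun t => t - n%:R)) (f (s - n%:R) * (1 - 0)).
        by apply: is_derive1_comp; apply: dh; exact: lt_trans sn0.
      have e : \forall t \near s, (h \o (fun t => t - n%:R)) t = h (Num.max (t - n%:R) 0).
        near=> t => /=; rewrite max_l// subr_ge0; apply: ltW.
        by near: t; exact: lt_nbhsr.
      have := near_eq_is_derive e d2.
      by rewrite subr0 mulr1.
    have d := is_deriveZ pi (is_deriveD (is_deriveZ (fc v kp (ph + x) n%:R) (shift _ _ dHp))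
      (is_deriveZ (fc v km (ph - x) n%:R) (shift _ _ dHm))).
    apply: (is_derive_eq d); rewrite /r /GRing.scale/= /w.
    rewrite (fc_decay _ hv eqv kpga sn) (fc_decay _ hv eqv kmga sn).
    have e1 : expR (mp * (s - n%:R)) = expR (lam * (s - n%:R)) * expR (- mode_rate kappa kp * (s
        - n%:R)).
      by rewrite -expRD; congr expR; rewrite /mp; ring.
    have e2 : expR (mm * (s - n%:R)) = expR (lam * (s - n%:R)) * expR (- mode_rate kappa km * (s
        - n%:R)).
      by rewrite -expRD; congr expR; rewrite /mm; ring.
    by rewrite e1 e2; ring.
have sol : expR lam * fc u k x (n%:R + 1) - H (n%:R + 1) = fc u k x n%:R - H n%:R.
  have := ode_solution (ler0n _ _) n1 cF dF cH dH.
  by rewrite [n%:R + 1 - n%:R]addrAC subrr add0r mulr1.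
have eP : eta_weight mp = Hp 1 - Hp 0 := int01_antiderivative (cw mp) dHp.
have eM : eta_weight mm = Hm 1 - Hm 0 := int01_antiderivative (cw mm) dHm.
rewrite eP eM; move/eqP: sol; rewrite subr_eq => /eqP ->.
have H1 : H (n%:R + 1) = pi * (fc v kp (ph + x) n%:R * Hp 1 + fc v km (ph - x) n%:R * Hm 1).
  by rewrite /H (_ : n%:R + 1 - n%:R = 1) ?max_l//; ring.
have H0 : H n%:R = pi * (fc v kp (ph + x) n%:R * Hp 0 + fc v km (ph - x) n%:R * Hm 0).
  by rewrite /H subrr maxxx.
by rewrite H1 H0; ring.
Unshelve. all: by end_near. Qed.

End StepSolutions.

(** * The induction equation *)

Section TimeProfile.
Context {R : realType}.
Variable eta : R -> R.
Hypothesis heta : is_time_profile eta.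

Lemma profile_continuous : continuous eta.
Proof.
have [sm _ _ _] := heta => s.
by apply: differentiable_continuous; apply/derivable1_diffP; exact: (sm 0%N).
Qed.

Lemma profile_support (s : R) : eta s != 0 -> 0 <= s <= 1.
Proof.
have [_ _ supp _] := heta => es.
have : `[0, 1]%classic s by apply: supp; exact: subset_closure.
by rewrite /= in_itv.
Qed.

(** The support condition leaves the endpoints 0 and 1 open; there a nonzero value would persist by
    continuity on a neighbourhood that leaves [0, 1]. *)
Lemma profile_zero (s : R) : s <= 0 \/ 1 <= s -> eta s = 0.
Proof.
move=> hs; apply/eqP; apply: contraT => es.
have e0 : 0 < `|eta s| by rewrite normr_gt0.
have := @profile_continuous s; move/cvgrPdist_lt => /(_ _ e0).
rewrite -nbhs_ballE => -[r /= r0 hr].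
have nz x : ball s r x -> 0 <= x <= 1.
  move=> /hr; rewrite distrC => h; apply: profile_support; apply/eqP => x0.
  by move: h; rewrite x0 sub0r normrN ltxx.
have b (c : R) : `|c| = r / 2 -> ball s r (s + c).
  by move=> cr; rewrite /ball/= opprD addNKr normrN cr; lra.
case: hs => hs.
  have := nz _ (b (- (r / 2)) _); rewrite normrN gtr0_norm ?divr_gt0// => /(_ erefl).
  by lra.
have := nz _ (b (r / 2) _); rewrite gtr0_norm ?divr_gt0// => /(_ erefl).
by lra.
Qed.

Lemma profile_int01 : int01 eta = 1.
Proof.
have [_ _ _ i1] := heta.
have e : (\int[@lebesgue_measure R]_(s in setT) (eta s)%:E =
    \int[@lebesgue_measure R]_(s in `[0%R, 1%R[) (eta s)%:E)%E.
  rewrite [RHS]integral_mkcond; apply: eq_integral => s _.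
  rewrite patchE; case: ifPn => //; rewrite notin_setE/= in_itv/= => h.
  rewrite profile_zero//; have [s0|s0] := leP s 0; [by left|right].
  by rewrite leNgt; apply/negP => s1; apply: h; rewrite (ltW s0).
by rewrite /int01 /Rintegral -e i1.
Qed.

Lemma profile_ge0 s : 0 <= eta s.
Proof. by have [_ + _ _] := heta. Qed.

Lemma velocityE (th : int -> R3 R) (n : nat) (t : R) p : n%:R <= t -> t <= n%:R + 1 ->
  velocity eta th t p = eta (t - n%:R) *: shear (n %% 3) (p + th n%:Z).
Proof.
move=> nt tn; rewrite /velocity -(@fsbig_widen _ _ _ _ [set n%:Z])//.
  by rewrite fsbig_set1 modz_nat.
move=> j [_ jn] /=; rewrite profile_zero ?scale0r//.
have {jn}jn : j != n%:Z by apply/eqP.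
have [jn'|nj] := ltP j n%:Z.
  right; have : (j + 1)%:~R <= n%:R :> R by rewrite -[n%:R]/(n%:Z%:~R) ler_int; lia.
  by rewrite intrD; lra.
left; have : (n%:Z + 1)%:~R <= j%:~R :> R by rewrite ler_int; move: jn nj; lia.
by rewrite intrD; lra.
Qed.

End TimeProfile.

Section Components.
Context {R : realType}.
Implicit Types (p : R3 R) (t : R).

Lemma shear_ax n (q : R3 R) : shear (n %% 3) q =
  sin (2 * pi * (comp3 q (ax n) - comp3 q (ax n.+1))) *: basis3 (ax n.+2).
Proof.
case: q => [[x y] z].
pose Q i j k := shear i (x, y, z) =
  sin (2 * pi * ([:: x; y; z]`_i - [:: x; y; z]`_j)) *: ((k == 0)%N%:R, (k == 1)%N%:R, (k ==
      2)%N%:R).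
have q : Q (ax n) (ax n.+1) (ax n.+2) by exact: ax_modn3.
by rewrite -[(n %% 3)%N]axE; exact: q.
Qed.

Lemma ax_neq n : (ax n != ax n.+2) /\ (ax n.+1 != ax n.+2).
Proof.
pose Q (i j k : nat) := i != k /\ j != k.
exact: (@ax_modn3 Q _ _ _ n).
Qed.

Lemma is_derive_comp3 (V : normedModType R) (F : V -> R3 R) (p v : V) (d : R3 R) i :
  is_derive p v F d -> is_derive p v (fun x => comp3 (F x) i) (comp3 d i).
Proof.
move=> [dF <-].
have H : h^-1 *: (comp3 (F (h *: v + p)) i - comp3 (F p) i) @[h --> (0 : R)^'] --> comp3 ('D_v F
    p) i.
  have E : (fun h : R => h^-1 *: (comp3 (F (h *: v + p)) i - comp3 (F p) i)) =
      (fun h : R => comp3 (h^-1 *: (F (h *: v + p) - F p)) i).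
    apply/funext => h; rewrite [RHS](comp3Z h^-1 (F (h *: v + p) - F p) i).
    rewrite comp3D; congr (_ * (_ + _)).
    by rewrite -[- comp3 _ _]mulN1r -comp3Z scaleN1r.
  rewrite E; apply: (continuous_cvg _ (@comp3_continuous R i ('D_v F p))).
  exact: dF.
split; first by apply/cvg_ex; exists (comp3 ('D_v F p) i).
exact: cvg_lim H.
Qed.

Lemma within_clip (F : R * R3 R -> R) :
  {within [set q : R * R3 R | 0 <= q.1], continuous F} ->
  continuous (fun q : R * R3 R => F (Num.max q.1 0, q.2)).
Proof.
move=> /subspace_continuousP cF q.
have c : continuous (fun q : R * R3 R => (Num.max q.1 0, q.2)).
  apply: continuous_pairing => r; last exact: cvg_snd.
  by apply: (@continuous_comp _ _ _ fst (fun t => Num.max t 0)); [exact: cvg_fst|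
    apply: continuous_max; [exact: cvg_id|exact: cvg_cst]].
have q0 : [set q : R * R3 R | 0 <= q.1] (Num.max q.1 0, q.2) by rewrite /= le_max lexx orbT.
apply: (cvg_comp _ _ _ (cF _ q0)) => A hA.
have H : nbhs q ((fun r : R * R3 R => (Num.max r.1 0, r.2)) @^-1`
    (fun w : R * R3 R => [set q : R * R3 R | 0 <= q.1] w -> A w)) by exact: (c q _ hA).
apply: (@filterS _ (nbhs q) _ _ _ _ H) => r Ar; apply: Ar.
by rewrite /= le_max lexx orbT.
Qed.

Variables (kappa : R) (U : R -> R3 R -> R3 R) (B0 : R3 R -> R3 R) (B : R -> R3 R -> R3 R).
Hypothesis hB : induction_solution kappa U B0 B.

Definition bc (i : 'I_3) t p : R := comp3 (B t p) i.
Definition bt (i : 'I_3) t p : R := comp3 ('D_1 (B ^~ p) t) i.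
Definition bx (i j : 'I_3) t p : R := comp3 ('D_(basis3 j) (B t) p) i.
Definition bxx (i j : 'I_3) t p : R := comp3 ('D_(basis3 j) ('D_(basis3 j) (B t)) p) i.

Lemma induction_c12 i : c12 (bc i) (bt i) (bx i) (bxx i).
Proof.
have [per cB [dt dtc dx dxx] _ _] := hB.
have cc (F : R -> R3 R -> R3 R) t p :
    {for (t, p), continuous (fun q : R * R3 R => F q.1 q.2)} ->
    {for (t, p), continuous (fun q : R * R3 R => comp3 (F q.1 q.2) i)}.
  move=> cF; apply: (@continuous_comp _ _ _ (fun q : R * R3 R => F q.1 q.2) (fun v => comp3 v i))
      => //.
  exact: comp3_continuous.
split.
- by move=> t p k t0; rewrite /bc (per t t0).
- apply: (@within_clip (fun q => comp3 (B q.1 q.2) i)).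
  move=> q; apply: (@continuous_comp _ _ _ _ (fun v => comp3 v i)); first exact: cB.
  exact: comp3_continuous.
- move=> t p t0; apply: (@is_derive_comp3 R^o (B ^~ p)).
  by apply: derivableP; exact: dt.
- by move=> t p t0; apply: (cc (fun t p => 'D_1 (B ^~ p) t)); exact: dtc.
- move=> j t p t0; apply: (@is_derive_comp3 (R3 R) (B t)).
  by apply: derivableP; exact: (dx j).1.
- by move=> j t p t0; apply: (cc (fun t => 'D_(basis3 j) (B t))); exact: (dx j).2.
- move=> j t p t0; apply: (@is_derive_comp3 (R3 R) ('D_(basis3 j) (B t))).
  by apply: derivableP; exact: (dxx j j).1.
- by move=> j t p t0; apply: (cc (fun t => 'D_(basis3 j) ('D_(basis3 j) (B t)))); exact: (dxx j
    j).2.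
Qed.

End Components.

Section ComponentEquation.
Context {R : realType}.
Implicit Types (p q : R3 R) (t : R).

Lemma comp3_sum (F : 'I_3 -> R3 R) i :
  comp3 (\sum_(j < 3) F j) i = \sum_(j < 3) comp3 (F j) i.
Proof. by rewrite !big_ord_recl !big_ord0 !addr0 !comp3D. Qed.

Lemma is_derive_scalel (f : R3 R -> R) (e : R3 R) p v (d : R) :
  is_derive p v f d -> is_derive p v (fun q => f q *: e) (d *: e).
Proof.
move=> [df <-].
have H : h^-1 *: (f (h *: v + p) *: e - f p *: e) @[h --> (0 : R)^'] --> 'D_v f p *: e.
  have E : (fun h : R => h^-1 *: (f (h *: v + p) *: e - f p *: e)) =
      (fun h : R => (h^-1 *: (f (h *: v + p) - f p)) *: e).
    by apply/funext => h; rewrite -scalerBl scalerA.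
  rewrite E; apply: cvgZr_tmp; exact: df.
split; first by apply/cvg_ex; exists ('D_v f p *: e).
exact: cvg_lim H.
Qed.

Lemma comp3_combination (x : R) (u v w z : R3 R) i :
  comp3 (u - x *: v + w - z) i = comp3 u i - x * comp3 v i + comp3 w i - comp3 z i.
Proof.
have cN (v' : R3 R) : comp3 (- v') i = - comp3 v' i by rewrite -scaleN1r comp3Z mulN1r.
by rewrite (comp3D _ (- z)) cN (comp3D _ w) comp3D cN comp3Z.
Qed.

Variables (kappa : R) (eta : R -> R) (th : int -> R3 R) (B : R -> R3 R -> R3 R).
Hypothesis heta : is_time_profile eta.
Hypothesis hB : induction_solution kappa (velocity eta th) initial_field B.

Definition angle (v : R3 R) (n : nat) : R :=
  2 * pi * (comp3 v (ax n) - comp3 v (ax n.+1)).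

Local Notation k0 n := (shear_mode (ax n) (ax n.+1)).

Lemma dot_shear_mode n p : dot (k0 n) p = comp3 p (ax n) - comp3 p (ax n.+1).
Proof.
have E i : \sum_(j < 3) (unit_mode i j)%:~R * comp3 p j = comp3 p i.
  rewrite (bigD1 i)//= /unit_mode eqxx mul1r big1 ?addr0// => j ji.
  by rewrite eq_sym (negbTE ji) mul0r.
rewrite /dot -[in RHS]E -[comp3 p (ax n.+1)]E -sumrB; apply: eq_bigr => j _.
by rewrite /shear_mode intrB mulrBl.
Qed.

Lemma velocity_tf n t q : n%:R <= t -> t <= n%:R + 1 ->
  velocity eta th t q =
    (eta (t - n%:R) * tf (k0 n) (angle (th n%:Z) n - pi / 2) q) *: basis3 (ax n.+2).
Proof.
move=> nt tn; rewrite (@velocityE _ eta heta th n)// shear_ax scalerA; congr ((_ * _) *: _).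
rewrite /tf addrA cosBpihalf dot_shear_mode /angle !comp3D; congr sin; ring.
Qed.

(** The velocity points along [ax n.+2] and varies only along the shear mode, so the stretching term
    has that single component and sees the field only through the difference of its other two
    components. This difference is the quantity followed by [amplitude]. *)
Lemma induction_eq n i t p : n%:R < t -> t <= n%:R + 1 ->
  bt B i t p = kappa * (\sum_(j < 3) bxx B i j t p)
    - (eta (t - n%:R) * tf (k0 n) (angle (th n%:Z) n - pi / 2) p) * bx B i (ax n.+2) t p
    + (if i == ax n.+2 then eta (t - n%:R) * (2 * pi * tf (k0 n) (angle (th n%:Z) n) p) *
         (bc B (ax n) t p - bc B (ax n.+1) t p) else 0).
Proof.
move=> nt tn; have t0 : 0 < t := le_lt_trans (ler0n _ _) nt.
set ph := angle _ n; set ga := ax n.+2.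
have [_ _ _ pde _] := hB.
have UE : velocity eta th t = (fun q => (eta (t - n%:R) * tf (k0 n) (ph - pi / 2) q) *: basis3 ga).
  by apply/funext => q; rewrite (@velocity_tf n)// ltW.
have dU j : 'D_(basis3 j) (fun q => (eta (t - n%:R) * tf (k0 n) (ph - pi / 2) q) *: basis3 ga) p =
    (eta (t - n%:R) * (2 * pi * (k0 n j)%:~R * tf (k0 n) ph p)) *: basis3 ga.
  have d1 := is_derive_tf (k0 n) (ph - pi / 2) j p.
  have d2 := is_deriveZ (eta (t - n%:R)) d1.
  have [_ ->] := is_derive_scalel (basis3 ga) d2.
  by rewrite subrK.
have eL : comp3 (laplacian (B t) p) i = \sum_(j < 3) bxx B i j t p by exact: comp3_sum.
have eA : comp3 (advect (velocity eta th t) (B t) p) i =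
    (eta (t - n%:R) * tf (k0 n) (ph - pi / 2) p) * bx B i ga t p.
  rewrite UE; transitivity (\sum_(j < 3) (eta (t - n%:R) * tf (k0 n) (ph - pi / 2) p *
      (ga == j)%:R) * bx B i j t p).
    rewrite -[RHS]/(\sum_(j < 3) _); apply: etrans (comp3_sum _ _) _; apply: eq_bigr => j _.
    by apply: etrans (comp3Z _ _ _) _; rewrite (comp3Z _ (basis3 ga)) comp3_basis.
  rewrite (bigD1 ga)//= eqxx mulr1 big1 ?addr0// => j jga.
  by rewrite eq_sym (negbTE jga) mulr0 mul0r.
have eS : comp3 (advect (B t) (velocity eta th t) p) i =
    (if i == ga then eta (t - n%:R) * (2 * pi * tf (k0 n) ph p) *
         (bc B (ax n) t p - bc B (ax n.+1) t p) else 0).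
  rewrite UE; transitivity (\sum_(j < 3) bc B j t p *
      (eta (t - n%:R) * (2 * pi * (k0 n j)%:~R * tf (k0 n) ph p) * (ga == i)%:R)).
    apply: etrans (comp3_sum _ _) _; apply: eq_bigr => j _.
    by apply: etrans (comp3Z _ _ _) _; rewrite dU (comp3Z _ (basis3 ga)) comp3_basis.
  rewrite eq_sym; case: eqP => [_|_]; last by rewrite big1// => j _; rewrite !mulr0.
  have <- : dot (k0 n) (B t p) = bc B (ax n) t p - bc B (ax n.+1) t p by exact: dot_shear_mode.
  by rewrite /dot mulr_sumr; apply: eq_bigr => j _; rewrite mulr1 /bc; ring.
have E := congr1 (fun v => comp3 v i) (pde t p t0).
have {E} E := etrans (esym (comp3_combination _ _ _ _ _ i)) E.
have c0 : comp3 (0 : R3 R) i = 0 by move: (i); apply: ord3_ind.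
have {E} E : bt B i t p - kappa * (\sum_(j < 3) bxx B i j t p) +
    (eta (t - n%:R) * tf (k0 n) (ph - pi / 2) p) * bx B i ga t p -
    (if i == ga then eta (t - n%:R) * (2 * pi * tf (k0 n) ph p) *
         (bc B (ax n) t p - bc B (ax n.+1) t p) else 0) = 0.
  by rewrite -eL -eA -eS; exact: etrans E c0.
move: E; set X := kappa * _; set Y := _ * bx _ _ _ _ _; set Z := (if _ then _ else _).
move=> E; apply/eqP; rewrite -subr_eq0 -[X in _ == X]E; apply/eqP; ring.
Qed.

End ComponentEquation.

Section Translation.
Context {R : realType}.
Implicit Types (p q c : R3 R) (t : R).

Lemma is_derive_translate (f : R3 R -> R) p c v (d : R) :
  is_derive (p + c) v f d -> is_derive p v (fun q => f (q + c)) d.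
Proof.
move=> [dv de].
have E : (fun h : R => h^-1 *: (((fun q => f (q + c)) \o shift p) (h *: v) - f (p + c))) =
    (fun h : R => h^-1 *: ((f \o shift (p + c)) (h *: v) - f (p + c))).
  by apply/funext => h /=; rewrite addrA.
split; first by rewrite /derivable E.
by rewrite -de /derive E.
Qed.

Lemma continuous_shift3 {X : topologicalType} (g : X -> R3 R) c :
  continuous g -> continuous (fun z => g z + c).
Proof. by move=> cg z; apply: cvgD; [exact: cg|exact: cvg_cst]. Qed.

Lemma c12_translate (u ut : R -> R3 R -> R) (ux uxx : 'I_3 -> R -> R3 R -> R) c :
  c12 u ut ux uxx ->
  c12 (fun t p => u t (p + c)) (fun t p => ut t (p + c))
    (fun j t p => ux j t (p + c)) (fun j t p => uxx j t (p + c)).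
Proof.
move=> hu.
have cs : continuous (fun q : R * R3 R => (q.1, q.2 + c)).
  apply: continuous_pairing => [q|]; first exact: cvg_fst.
  by apply: continuous_shift3 => q; exact: cvg_snd.
have cc (f : R -> R3 R -> R) t p :
    {for (t, p + c), continuous (fun q : R * R3 R => f q.1 q.2)} ->
    {for (t, p), continuous (fun q : R * R3 R => f q.1 (q.2 + c))}.
  move=> cf; apply: (@continuous_comp _ _ _ (fun q : R * R3 R => (q.1, q.2 + c))
    (fun q : R * R3 R => f q.1 q.2)) => //.
  exact: cs.
split.
- by move=> t p k t0; rewrite addrAC (c12_per hu).
- move=> q; apply: (@continuous_comp _ _ _ (fun q : R * R3 R => (q.1, q.2 + c))
    (fun q : R * R3 R => u (Num.max q.1 0) q.2)); first exact: cs.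
  exact: (c12_cont hu).
- by move=> t p t0; exact: (c12_dt hu).
- by move=> t p t0; apply: cc; exact: (c12_dtc hu).
- by move=> j t p t0; apply: is_derive_translate; exact: (c12_dx hu).
- by move=> j t p t0; apply: (cc (ux j)); exact: (c12_dxc hu).
- by move=> j t p t0; apply: is_derive_translate; exact: (c12_dxx hu).
- by move=> j t p t0; apply: (cc (uxx j)); exact: (c12_dxxc hu).
Qed.

Lemma c12_sub (u ut v vt : R -> R3 R -> R) (ux uxx vx vxx : 'I_3 -> R -> R3 R -> R) :
  c12 u ut ux uxx -> c12 v vt vx vxx ->
  c12 (fun t p => u t p - v t p) (fun t p => ut t p - vt t p)
    (fun j t p => ux j t p - vx j t p) (fun j t p => uxx j t p - vxx j t p).
Proof.
move=> hu hv; split.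
- by move=> t p k t0; rewrite (c12_per hu)// (c12_per hv).
- by move=> q; apply: cvgB; [exact: (c12_cont hu)|exact: (c12_cont hv)].
- by move=> t p t0; apply: is_deriveB; [exact: (c12_dt hu)|exact: (c12_dt hv)].
- by move=> t p t0; apply: cvgB; [exact: (c12_dtc hu)|exact: (c12_dtc hv)].
- by move=> j t p t0; apply: is_deriveB; [exact: (c12_dx hu)|exact: (c12_dx hv)].
- by move=> j t p t0; apply: cvgB; [exact: (c12_dxc hu)|exact: (c12_dxc hv)].
- by move=> j t p t0; apply: is_deriveB; [exact: (c12_dxx hu)|exact: (c12_dxx hv)].
- by move=> j t p t0; apply: cvgB; [exact: (c12_dxxc hu)|exact: (c12_dxxc hv)].
Qed.

Lemma c12_clip (u ut : R -> R3 R -> R) (ux uxx : 'I_3 -> R -> R3 R -> R) (a : R) :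
  0 <= a -> c12 u ut ux uxx -> continuous (fun q : R * R3 R => u (Num.max q.1 a) q.2).
Proof.
move=> a0 hu.
have cu : continuous (fun q : R * R3 R => u (Num.max q.1 0) q.2) by exact: (c12_cont hu).
have := @continuous_clip _ (fun q : R * R3 R => u (Num.max q.1 0) q.2) a (fun t p _ => cu (t, p)).
have -> // : (fun q : R * R3 R => u (Num.max (Num.max q.1 a) 0) q.2) =
  (fun q : R * R3 R => u (Num.max q.1 a) q.2).
by apply/funext => q; rewrite [X in u X]max_l// le_max a0 orbT.
Qed.

(** Uniform continuity along one direction, by compactness of the closed cube and periodicity. *)
Lemma uniform_shift (f : R3 R -> R) (v : R3 R) (e : R) : continuous f ->
  (forall p k, f (p + zvec k) = f p) -> 0 < e ->
  exists2 r : R, 0 < r & forall s p, `|s| < r -> `|f (p + s *: v) - f p| < e.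
Proof.
move=> cf perf e0.
have cg : continuous (fun z : R3 R * R => f (z.1 + z.2 *: v) - f z.1).
  move=> z; apply: cvgB.
    apply: (@continuous_comp _ _ _ (fun z : R3 R * R => z.1 + z.2 *: v) f); last exact: cf.
    by apply: cvgD; [exact: cvg_fst|apply: cvgZr_tmp; exact: cvg_snd].
  by apply: (@continuous_comp _ _ _ fst f); [exact: cvg_fst|exact: cf].
have := @compact_ccube R => /compact_near_coveringP /(_ R (nbhs (0 : R))
   (fun s p => `|f (p + s *: v) - f p| < e) _).
case.
  move=> p _; have := cg (p, 0); rewrite /continuous_at/= scale0r addr0 subrr.
  move=> /cvgrPdist_lt /(_ _ e0) H.
  by apply: filterS H => -[q s] /=; rewrite sub0r normrN.
move=> r /= r0 hr; exists r => // s p sr.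
have [k _ pk] := ccube_representative p.
have := hr s _ _ pk; rewrite addrAC !perf; apply.
by rewrite /ball/= sub0r normrN.
Qed.

End Translation.

(** * Stability under a change of the phases *)

Section Stability.
Context {R : realType}.
Implicit Types (p q : R3 R) (t : R).
Variables (kappa : R) (eta : R -> R).
Hypothesis kappa0 : 0 <= kappa.
Hypothesis heta : is_time_profile eta.

Lemma profile_bounded : exists2 M : R, 0 <= M & forall s, eta s <= M.
Proof.
have [M [Mr hM]] := compact_bounded (continuous_compact (continuous_subspaceT (profile_continuous
    heta))
  (@segment_compact R 0 1)).
exists (`|M| + 1); first by rewrite addr_ge0.
move=> s; have [->|es] := eqVneq (eta s) 0; first by rewrite addr_ge0.
rewrite (le_trans (ler_norm _))//; apply: (hM (`|M| + 1)).
  by rewrite (le_lt_trans (ler_norm M))// ltrDl.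
by exists s => //; rewrite /= in_itv/=; exact: (profile_support heta).
Qed.

Lemma ax_neqS n : ax n.+1 != ax n.
Proof.
pose Q (i j k : nat) := j != i.
exact: (@ax_modn3 Q _ _ _ n).
Qed.

Let source_difference (b : bool) (k s s' v x x' g a a' c c' : R) :
  (k * s - v * x + (if b then g * (a - c) else 0)) -
  (k * s' - v * x' + (if b then g * (a' - c') else 0)) =
  k * (s - s') - v * (x - x') + (if b then g * ((a - a') - (c - c')) else 0).
Proof. by case: b; ring. Qed.

(* Translating the first solution along [ax n] by the difference of the phases makes
   both velocities equal on [n, n + 1]. *)
Lemma step_stability : exists2 C : R, 0 <= C &
  forall (th th' : int -> R3 R) (B B' : R -> R3 R -> R3 R) n,
  induction_solution kappa (velocity eta th) initial_field B ->
  induction_solution kappa (velocity eta th') initial_field B' ->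
  forall e, 0 <= e ->
  let s := (angle (th' n%:Z) n - angle (th n%:Z) n) / (2 * pi) in
  (forall i p, `|bc B i n%:R (p + s *: basis3 (ax n)) - bc B' i n%:R p| <= e) ->
  forall i p, `|bc B i n.+1%:R (p + s *: basis3 (ax n)) - bc B' i n.+1%:R p| <= e * C.
Proof.
have [M M0 hM] := profile_bounded.
(* The bound of [eta], the derivative of the sine, and 2 because the source contains a difference of
   two components. *)
pose K := M * (2 * pi) * 2.
have K0 : 0 <= K by rewrite !mulr_ge0// pi_ge0.
exists (expR (K + 1)); first exact: expR_ge0.
move=> th th' B B' n hB hB' e e0 s.
set c := s *: _; set ph' := angle (th' n%:Z) n.
have tfs (y : R) p : tf (shear_mode (ax n) (ax n.+1)) (angle (th n%:Z) n + y) (p + c) =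
    tf (shear_mode (ax n) (ax n.+1)) (ph' + y) p.
  rewrite /tf dotD dotZ dot_basis /shear_mode /unit_mode eqxx (negbTE (ax_neqS n)) mulr1.
  have p0 : 2 * pi != 0 :> R by rewrite mulf_neq0// gt_eqF// pi_gt0.
  have : 2 * pi * s = ph' - angle (th n%:Z) n by rewrite mulrC divfK.
  by move=> h; congr cos; rewrite mulrDr h; ring.
pose u i := bc B i; pose v i := bc B' i.
have hu i := c12_sub (c12_translate c (induction_c12 hB i)) (induction_c12 hB' i).
move=> H0 i p; have n0 : 0 <= n%:R :> R by [].
have pos t : n%:R < t -> 0 < t by exact: le_lt_trans.
rewrite -natr1; apply: (max_principle (a := n%:R) (kappa := kappa) (M := K)
  (V := fun t p => eta (t - n%:R) * tf (shear_mode (ax n) (ax n.+1)) (ph' - pi / 2) p)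
  (gam := ax n.+2)
  (src := fun i t p => if i == ax n.+2 then eta (t - n%:R) *
     (2 * pi * tf (shear_mode (ax n) (ax n.+1)) ph' p) *
       ((bc B (ax n) t (p + c) - bc B' (ax n) t p) - (bc B (ax n.+1) t (p + c) - bc B' (ax n.+1)
           t p))
     else 0)
  (D := fun i t p => bc B i t (p + c) - bc B' i t p)
  (Dt := fun i t p => bt B i t (p + c) - bt B' i t p)
  (Dx := fun i j t p => bx B i j t (p + c) - bx B' i j t p)
  (Dxx := fun i j t p => bxx B i j t (p + c) - bxx B' i j t p)) => //.
- by move=> j; exact: (c12_clip n0 (hu j)).
- by move=> j t q k nt; apply: (c12_per (hu j)); exact: le_trans nt.
- by move=> j t q nt; apply: (c12_dt (hu j)); exact: pos.
- by move=> j l t q nt; apply: (c12_dx (hu j)); exact: pos.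
- by move=> j l t q nt; apply: (c12_dxx (hu j)); exact: pos.
- move=> j t q nt tn.
  rewrite (induction_eq heta hB (n := n))// (induction_eq heta hB' (n := n))//.
  have := tfs 0 q; rewrite !addr0 => ->; rewrite tfs sumrB -/ph'.
  exact: source_difference.
- move=> j t q m nt tn hm.
  have m0 : 0 <= m := le_trans (normr_ge0 _) (hm (ax n)).
  suff : `|if j == ax n.+2 then eta (t - n%:R) *
     (2 * pi * tf (shear_mode (ax n) (ax n.+1)) ph' q) *
       ((bc B (ax n) t (q + c) - bc B' (ax n) t q) - (bc B (ax n.+1) t (q + c) - bc B' (ax n.+1)
           t q))
     else 0| <= K * m.
    by rewrite ler_norml => /andP[h1 h2]; split => //; rewrite lerNl.
  case: eqP => _; last by rewrite normr0 mulr_ge0.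
  rewrite /K -[X in _ <= X]mulrA normrM; apply: ler_pM => //.
    rewrite normrM; apply: ler_pM => //.
      by rewrite ger0_norm//; exact: (profile_ge0 heta).
    rewrite normrM ger0_norm ?mulr_ge0 ?pi_ge0// ler_piMr ?mulr_ge0 ?pi_ge0//.
    by rewrite ler_norml cos_geN1 cos_le1.
  by rewrite (le_trans (ler_normB _ _))// mulr2n mulrDl mul1r lerD.
- by rewrite lerDl ler01 lexx.
Qed.

End Stability.

Section FieldModulus.
Context {R : realType} d (T : measurableType d) (P : probability T R).
Variables (theta : int -> {RV P >-> R3 R}) (kappa : R) (eta : R -> R).
Variable B : T -> R -> R3 R -> R3 R.
Hypothesis kappa0 : 0 <= kappa.
Hypothesis heta : is_time_profile eta.
Hypothesis hB : forall w,
  induction_solution kappa (velocity eta (fun j => theta j w)) initial_field (B w).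
Implicit Types (w : T) (n : nat) (i : 'I_3) (e : R).

Lemma uniform_shift_field w n (v : R3 R) e : 0 < e ->
  exists2 r : R, 0 < r & forall i (s : R) q, `|s| < r ->
    `|bc (B w) i n%:R (q + s *: v) - bc (B w) i n%:R q| < e.
Proof.
move=> e0; have n0 : 0 <= n%:R :> R by [].
have H i : exists2 r : R, 0 < r & forall (s : R) q, `|s| < r ->
    `|bc (B w) i n%:R (q + s *: v) - bc (B w) i n%:R q| < e.
  apply: uniform_shift => //.
    exact: (c12_slice (induction_c12 (hB w) i)).
  by move=> q k; exact: (c12_per (induction_c12 (hB w) i)).
have [r0 r00 h0] := H (@Ordinal 3 0 isT).
have [r1 r10 h1] := H (@Ordinal 3 1 isT).
have [r2 r20 h2] := H (@Ordinal 3 2 isT).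
exists (Num.min r0 (Num.min r1 r2)); first by rewrite !lt_min r00 r10.
apply: ord3_ind => s q; rewrite !lt_min => /and3P[s0 s1 s2].
- exact: h0.
- exact: h1.
- exact: h2.
Qed.

Lemma angle_phase n w : angle (theta n%:Z w) n = 2 * pi * phase theta n w.
Proof. by []. Qed.

(* The field at time n depends on the sample only through the phases before n, and
   continuously so; this gives measurability with respect to their sigma-algebra. *)
Lemma field_modulus n w e : 0 < e ->
  exists2 r : R, 0 < r & forall w',
    (forall i : 'I_n, `|phase theta i w - phase theta i w'| < r) ->
    forall i q, `|bc (B w) i n%:R q - bc (B w') i n%:R q| <= e.
Proof.
elim: n e => [|n IH] e e0.
  exists 1 => // w' _ i q; have [_ _ _ _ i0] := hB w; have [_ _ _ _ i0'] := hB w'.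
  by rewrite /bc i0 i0' subrr normr0 ltW.
have [C C0 step] := step_stability kappa0 heta.
(* Two errors of size [e1], from the earlier phases and from the translation by [s], are amplified
   by [C] to at most [e / 2]; the other half pays for undoing the translation at time n + 1. *)
pose e1 := e / (4 * (C + 1)).
have C1 : 0 < C + 1 by rewrite ltr_wpDl.
have e10 : 0 < e1 by rewrite divr_gt0// mulr_gt0.
have [r1 r10 h1] := IH _ e10.
have [r2 r20 h2] := uniform_shift_field w n (basis3 (ax n)) e10.
have e20 : 0 < e / 2 by rewrite divr_gt0.
have [r3 r30 h3] := uniform_shift_field w n.+1 (basis3 (ax n)) e20.
exists (Num.min r1 (Num.min r2 r3)); first by rewrite !lt_min r10 r20.
move=> w' hw' i q.
pose s := phase theta n w' - phase theta n w.
have sE : (angle (theta n%:Z w') n - angle (theta n%:Z w) n) / (2 * pi) = s.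
  rewrite !angle_phase -mulrBr mulrC mulKf// mulf_neq0// gt_eqF// pi_gt0//.
have sr : `|s| < Num.min r1 (Num.min r2 r3) by rewrite distrC; exact: (hw' ord_max).
have sr2 : `|s| < r2 by move: sr; rewrite !lt_min => /and3P[].
have sr3 : `|s| < r3 by move: sr; rewrite !lt_min => /and3P[].
have close : forall j z, `|bc (B w) j n%:R z - bc (B w') j n%:R z| <= e1.
  apply: h1 => j; have := hw' (widen_ord (leqnSn n) j).
  by rewrite lt_min => /andP[].
have shifted j z : `|bc (B w) j n%:R (z + s *: basis3 (ax n)) - bc (B w') j n%:R z| <= e1 + e1.
  rewrite -(subrK (bc (B w) j n%:R z) (bc (B w) j n%:R (z + _))) -addrA.
  by apply: (le_trans (ler_normD _ _)); apply: lerD; [exact/ltW/h2|exact: close].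
have := step _ _ _ _ n (hB w) (hB w') (e1 + e1).
rewrite sE => /(_ (addr_ge0 (ltW e10) (ltW e10)) shifted) => /(_ i q) last.
have bnd : (e1 + e1) * C <= e / 2.
  rewrite (_ : _ * C = e / 2 * (C / (C + 1))); last by rewrite /e1; field; rewrite gt_eqF.
  by rewrite ler_piMr ?ltW// ltr_pdivrMr// mul1r ltrDl.
rewrite -(subrKA (bc (B w) i n.+1%:R (q + s *: basis3 (ax n)))).
apply: (le_trans (ler_normD _ _)); rewrite [X in _ <= X](splitr e); apply: lerD.
  by rewrite distrC; exact/ltW/h3.
exact: le_trans last bnd.
Qed.

Lemma fc_sub_le (u v : R -> R3 R -> R) k (x t e : R) :
  continuous (u t) -> continuous (v t) -> (forall q, `|u t q - v t q| <= e) ->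
  `|fc u k x t - fc v k x t| <= e.
Proof.
move=> cu cv uv.
have cf (z : R -> R3 R -> R) : continuous (z t) -> continuous (fun q => z t q * tf k x q).
  by move=> cz q; apply: cvgM; [exact: cz|exact: tf_continuous].
have le (y z : R -> R3 R -> R) : continuous (y t) -> continuous (z t) ->
    (forall q, `|y t q - z t q| <= e) -> fc y k x t <= e + fc z k x t.
  move=> cy cz yz; rewrite -[X in X + _](@tint_cst R e) -tintD; last 2 first.
  - exact: cst_continuous.
  - exact: cf.
  apply: tint_le; [exact: cf|by move=> q; apply: cvgD; [exact: cvg_cst|exact: (cf z)]|].
  move=> q; rewrite -lerBlDr -mulrBl.
  rewrite (le_trans (ler_norm _))// normrM (le_trans _ (yz q))// ler_piMr//.
  by rewrite ler_norml cos_geN1 cos_le1.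
have uv' q : `|v t q - u t q| <= e by rewrite distrC.
by have := le _ _ cu cv uv; have := le _ _ cv cu uv'; rewrite ler_norml; lra.
Qed.

(** Adaptedness to the past, as [expect_step] requires. It includes a form of uniqueness: samples
    with equal phases before n have equal coefficients. *)
Lemma measurable_fc_past n i k (x : R) :
  measurable_fun setT ((fun w => fc (bc (B w) i) k x n%:R) :
    g_sigma_algebraType (past (phase theta) n) -> R).
Proof.
apply: (@measurable_fun_of_modulus R _ (g_sigma_algebraType (past (phase theta) n)) n
  (fun j : 'I_n => phase theta j)).
  by move=> j; exact: measurable_past.
move=> w e e0; have e2 : 0 < e / 2 by rewrite divr_gt0.
have [r r0 hr] := field_modulus n w e2; exists r => // w' hw'.
apply: (@le_lt_trans _ _ (e / 2)); last by rewrite ltr_pdivrMr// ltr_pMr// ltr1n.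
have c w1 : continuous (bc (B w1) i n%:R).
  by apply: (c12_slice (induction_c12 (hB w1) i)).
by apply: fc_sub_le => // q; exact: hr.
Qed.

End FieldModulus.

(** * Recursion for the amplitude *)

Section FourierAmplitudes.
Context {R : realType}.
Implicit Types (p : R3 R) (k : 'I_3 -> int) (x t s : R).

Lemma fc_sub (u v : R -> R3 R -> R) k x t : continuous (u t) -> continuous (v t) ->
  fc (fun t p => u t p - v t p) k x t = fc u k x t - fc v k x t.
Proof.
move=> cu cv.
have cf (z : R -> R3 R -> R) : continuous (z t) -> continuous (fun q => z t q * tf k x q).
  by move=> cz q; apply: cvgM; [exact: cz|exact: tf_continuous].
apply/eqP; rewrite eq_sym subr_eq /fc -tintD; last 2 first.
- by move=> q; apply: cvgM; [apply: cvgB; [exact: cu|exact: cv]|exact: tf_continuous].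
- exact: cf.
by apply/eqP; apply: tint_eq => q; rewrite mulrBl subrK.
Qed.

Lemma fc_phase (u : R -> R3 R -> R) k x t : continuous (u t) ->
  fc u k x t = cos x * fc u k 0 t - sin x * fc u k (- (pi / 2)) t.
Proof.
move=> cu.
have cf y : continuous (fun q => u t q * tf k y q).
  by move=> q; apply: cvgM; [exact: cu|exact: tf_continuous].
have cZ y (c : R) : continuous (fun q => c * (u t q * tf k y q)).
  by move=> q; apply: cvgMl_tmp; exact: cf.
rewrite -mulNr -!tintZ// -tintD//; apply: tint_eq => q.
rewrite [X in u t q * X](_ : _ = cos x * tf k 0 q - sin x * tf k (- (pi / 2)) q); first by ring.
by rewrite /tf addr0 cosBpihalf cosD; ring.
Qed.

Lemma mode_rate_unit (kappa : R) i : mode_rate kappa (unit_mode i) = kappa * (2 * pi) ^+ 2.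
Proof.
rewrite /mode_rate (bigD1 i)//= big1 ?addr0; first by rewrite /unit_mode eqxx mulr1.
by move=> j ji; rewrite /unit_mode eq_sym (negbTE ji) mulr0 expr0n.
Qed.

Lemma tint_tf0 k x (j : 'I_3) : k j != 0 -> tint (tf k x) = 0.
Proof.
move=> kj; have c0 : 2 * pi * (k j)%:~R != 0 :> R.
  by rewrite !mulf_neq0 ?intr_eq0// gt_eqF// pi_gt0.
have : 2 * pi * (k j)%:~R * tint (tf k x) = 0.
  rewrite -tintZ; last exact: tf_continuous.
  apply: (@tint_derive0 _ j (tf k (x - pi / 2))).
  - by move=> q; have := is_derive_tf k (x - pi / 2) j q; rewrite subrK.
  - by move=> q; apply: cvgMl_tmp; exact: tf_continuous.
  - by move=> q; rewrite tf_periodic.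
by move/eqP; rewrite mulf_eq0 (negbTE c0) => /eqP.
Qed.

Section Solution.
Variables (kappa : R) (eta : R -> R) (th : int -> R3 R) (B : R -> R3 R -> R3 R).
Hypothesis kappa0 : 0 <= kappa.
Hypothesis heta : is_time_profile eta.
Hypothesis hB : induction_solution kappa (velocity eta th) initial_field B.

Definition dfc (B : R -> R3 R -> R3 R) i j k x t : R := fc (bc B i) k x t - fc (bc B j) k x t.

(* The integral of [(B_al - B_be) exp(2 pi i p_al)] at time n. *)
Definition amplitude (B : R -> R3 R -> R3 R) n : R[i] :=
  (dfc B (ax n) (ax n.+1) (unit_mode (ax n)) 0 n%:R
   +i* dfc B (ax n) (ax n.+1) (unit_mode (ax n)) (- (pi / 2)) n%:R)%C.

(** Heat decay over unit time of a mode [unit_mode i], the same for the three axes. *)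
Definition unit_decay (kappa : R) : R := expR (- (kappa * (2 * pi) ^+ 2)).

Let bc_slice i t : 0 <= t -> continuous (bc B i t).
Proof. exact: (c12_slice (induction_c12 hB i)). Qed.

Lemma dfcE i j k x t : 0 <= t ->
  fc (fun t p => bc B i t p - bc B j t p) k x t = dfc B i j k x t.
Proof. by move=> t0; rewrite fc_sub//; exact: bc_slice. Qed.

Let difference_eq i n t p : i != ax n.+2 -> n%:R < t -> t <= n%:R + 1 ->
  bt B i t p = kappa * (\sum_(j < 3) bxx B i j t p)
    - (eta (t - n%:R) * tf (shear_mode (ax n) (ax n.+1)) (angle (th n%:Z) n - pi / 2) p) *
      bx B i (ax n.+2) t p.
Proof. by move=> ni nt tn; rewrite (induction_eq heta hB (n := n))// (negbTE ni) addr0. Qed.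

Let equation_sub (k s s' v x x' : R) :
  (k * s - v * x) - (k * s' - v * x') = k * (s - s') - v * (x - x').
Proof. by ring. Qed.

Let equation_sub_source (k s s' v x x' g : R) :
  (k * s - v * x + g) - (k * s' - v * x') = k * (s - s') - v * (x - x') + g.
Proof. by ring. Qed.

Lemma dfc_equation n t p : n%:R < t -> t <= n%:R + 1 ->
  bt B (ax n) t p - bt B (ax n.+1) t p =
    kappa * (\sum_(j < 3) (bxx B (ax n) j t p - bxx B (ax n.+1) j t p))
    - (eta (t - n%:R) * tf (shear_mode (ax n) (ax n.+1)) (angle (th n%:Z) n - pi / 2) p) *
      (bx B (ax n) (ax n.+2) t p - bx B (ax n.+1) (ax n.+2) t p).
Proof.
move=> nt tn; have [a1 a2] := ax_neq n.
by rewrite !(@difference_eq _ n)// sumrB; exact: equation_sub.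
Qed.

Lemma dfc_decay n k x t : k (ax n.+2) = 0 -> n%:R <= t <= n%:R + 1 ->
  dfc B (ax n) (ax n.+1) k x t =
  expR (- mode_rate kappa k * (t - n%:R)) * dfc B (ax n) (ax n.+1) k x n%:R.
Proof.
move=> k0 nt; have [a1 a2] := ax_neq n.
have t0 : 0 <= t by case/andP: nt => nt _; exact: le_trans nt.
rewrite -!dfcE//.
apply: (fc_decay (n := n) a1 a2 x (c12_sub (induction_c12 hB _) (induction_c12 hB _)) _ k0 nt).
by move=> s q ns sn; exact: dfc_equation.
Qed.

(** The frequency [e_al - 2 e_be], the second one coupled by the shear to [e_be]. Its coefficient is
    not followed; it only enters [c], on which the moment bound does not depend. *)
Definition side_mode n : 'I_3 -> int :=
  fun j => shear_mode (ax n) (ax n.+1) j - unit_mode (ax n.+1) j.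

Definition side_weight (kappa : R) (eta : R -> R) n : R :=
  eta_weight eta (mode_rate kappa (unit_mode (ax n.+1)) - mode_rate kappa (side_mode n)).

(** [fc_source] for [B_ga - B_be] at the mode [e_be]: subtracting the unstretched [B_be] leaves the
    source unchanged. The modes [e_al] and [e_be] have equal rates, so the first weight is the
    integral of [eta], that is 1. *)
Lemma dfc_source n x :
  let u y := dfc B (ax n.+2) (ax n.+1) (unit_mode (ax n.+1)) y in
  u x n.+1%:R = unit_decay kappa * (u x n%:R +
    pi * (dfc B (ax n) (ax n.+1) (unit_mode (ax n)) (angle (th n%:Z) n + x) n%:R +
      side_weight kappa eta n *
        dfc B (ax n) (ax n.+1) (side_mode n) (angle (th n%:Z) n - x) n%:R)).
Proof.
move=> u; have [a1 a2] := ax_neq n; have ce := profile_continuous heta.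
have k0 : unit_mode (ax n.+1) (ax n.+2) = 0 by rewrite /unit_mode (negbTE a2).
have := fc_source (n := n) (ph := angle (th n%:Z) n) (kappa := kappa) a1 a2 ce x
  (c12_sub (induction_c12 hB (ax n.+2)) (induction_c12 hB (ax n.+1)))
  (c12_sub (induction_c12 hB (ax n)) (induction_c12 hB (ax n.+1))) (@dfc_equation n) _ k0.
have n1 : 0 <= n%:R + 1 :> R by rewrite addr_ge0.
rewrite /= !dfcE//.
have -> : (fun j => shear_mode (ax n) (ax n.+1) j + unit_mode (ax n.+1) j) = unit_mode (ax n).
  by apply/funext => j; rewrite /shear_mode subrK.
rewrite -/(side_mode n) !mode_rate_unit subrr.
have -> : eta_weight eta 0 = 1.
  rewrite -(profile_int01 heta) /eta_weight; congr int01.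
  by apply/funext => s; rewrite mul0r expR0 mulr1.
rewrite mul1r => H; lapply H => {H} [H|t p nt tn].
  rewrite /u /side_weight mode_rate_unit -natr1.
  apply: etrans (congr1 (fun y => expR (- (kappa * (2 * pi) ^+ 2)) * y) H).
  by rewrite mulrA -expRD addNr expR0 mul1r.
rewrite (@difference_eq (ax n.+1) n)// (induction_eq heta hB (n := n))// eqxx sumrB.
exact: equation_sub_source.
Qed.

Lemma dfc_phase i j k x t : 0 <= t ->
  dfc B i j k x t = cos x * dfc B i j k 0 t - sin x * dfc B i j k (- (pi / 2)) t.
Proof.
move=> t0; rewrite /dfc (fc_phase _ x (@bc_slice i t t0)) (fc_phase _ x (@bc_slice j t t0)).
by ring.
Qed.

Definition step_const (kappa : R) (B : R -> R3 R -> R3 R) n : R[i] :=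
  let u x := unit_decay kappa * dfc B (ax n.+2) (ax n.+1) (unit_mode (ax n.+1)) x n%:R in
  (u 0 +i* u (- (pi / 2)))%C.

Definition step_pos (kappa : R) (B : R -> R3 R -> R3 R) n : R[i] :=
  let u x := unit_decay kappa * pi * dfc B (ax n) (ax n.+1) (unit_mode (ax n)) x n%:R in
  (u 0 +i* u (- (pi / 2)))%C.

(** The imaginary part changes sign because the phase enters as [angle - x]; the coefficient thus
    accompanies [cexpN]. *)
Definition step_neg (kappa : R) (eta : R -> R) (B : R -> R3 R -> R3 R) n : R[i] :=
  let u x := unit_decay kappa * pi * side_weight kappa eta n *
    dfc B (ax n) (ax n.+1) (side_mode n) x n%:R in
  (u 0 -i* u (- (pi / 2)))%C.

Lemma csq_step_pos n :
  csq (step_pos kappa B n) = (unit_decay kappa * pi) ^+ 2 * csq (amplitude B n).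
Proof. by rewrite /csq/= !exprMn; ring. Qed.

(** The sign comes from the turn of the axes: the new difference is [B_be - B_ga], the opposite of
    the one in [dfc_source]. *)
Lemma amplitude_step n : amplitude B n.+1 =
  - tpoly (step_const kappa B n) (step_pos kappa B n) (step_neg kappa eta B n)
      (angle (th n%:Z) n).
Proof.
have flip x : dfc B (ax n.+1) (ax n.+2) (unit_mode (ax n.+1)) x n.+1%:R =
    - dfc B (ax n.+2) (ax n.+1) (unit_mode (ax n.+1)) x n.+1%:R by rewrite /dfc opprB.
have n0 : 0 <= n%:R :> R by [].
apply/eqP; rewrite eq_complex /amplitude /= !flip !dfc_source.
set ph := angle _ n.
rewrite !(@dfc_phase _ _ _ (ph + _) _ n0).
rewrite addr0 subr0 opprK cosBpihalf sinBpihalf cosDpihalf sinDpihalf.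
do ![move: (dfc _ _ _ _ _ _) => ?].
by apply/andP; split; apply/eqP; ring.
Qed.

(** On [n, n + 1] neither component of the difference is stretched, so its mode loses at most one
    unit of heat decay. Bessel's inequality for this mode and [(x - y) ^ 2 <= 2 (x ^ 2 + y ^ 2)] do
    the rest. *)
Lemma amplitude_le_L2norm n t : n%:R <= t <= n%:R + 1 ->
  expR (- (2 * (kappa * (2 * pi) ^+ 2))) * csq (amplitude B n) <= 2 * L2norm (B t) ^+ 2.
Proof.
move=> nt; have t0 : 0 <= t by case/andP: nt => nt _; exact: le_trans nt.
have [a1 a2] := ax_neq n.
set k := unit_mode (ax n); set x1 := - (pi / 2) : R.
have k0 : k (ax n.+2) = 0 by rewrite /k /unit_mode (negbTE a1).
pose V p := bc B (ax n) t p - bc B (ax n.+1) t p.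
pose c := fc (fun t p => bc B (ax n) t p - bc B (ax n.+1) t p) k 0 t.
pose s := fc (fun t p => bc B (ax n) t p - bc B (ax n.+1) t p) k x1 t.
have cV : continuous V by move=> p; apply: cvgB; exact: bc_slice.
have amp : expR (- (2 * (kappa * (2 * pi) ^+ 2))) * csq (amplitude B n) <= c ^+ 2 + s ^+ 2.
  rewrite /c /s !dfcE// !(dfc_decay _ k0 nt) /csq/= -/k -/x1 ![(expR _ * _) ^+ 2]exprMn -mulrDr.
  apply: ler_wpM2r; first by rewrite addr_ge0 ?sqr_ge0.
  rewrite -expRM_natl ler_expR mode_rate_unit.
  have : 0 <= kappa * (2 * pi) ^+ 2 by rewrite mulr_ge0 ?sqr_ge0.
  move: (kappa * _) => K K0; case/andP: nt => nt tn.
  have : K * (t - n%:R) <= K * 1 by rewrite ler_wpM2l//; lra.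
  by rewrite mulr1 mulNr; move: (K * _) => z; lra.
apply: (le_trans amp).
have cB i : continuous (bc B i t) by exact: bc_slice.
have sq i : continuous (fun p => bc B i t p ^+ 2).
  by move=> p; apply: cvgM; exact: cB.
have csn : continuous (fun p => sqnorm3 (B t p)).
  have -> : (fun p => sqnorm3 (B t p)) = (fun p => bc B ord0 t p ^+ 2 +
      (bc B (lift ord0 ord0) t p ^+ 2 + bc B (lift ord0 (lift ord0 ord0)) t p ^+ 2)).
    by apply/funext => p; rewrite /sqnorm3 !big_ord_recl big_ord0 addr0.
  by move=> p; apply: cvgD; [exact: sq|apply: cvgD; exact: sq].
have L2E : L2norm (B t) ^+ 2 = tint (fun p => sqnorm3 (B t p)).
  rewrite sqr_sqrtr// -[X in X <= _](@tint_cst R 0).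
  apply: tint_le => //; first exact: cst_continuous.
  by move=> p; rewrite /sqnorm3 sumr_ge0// => i _; exact: sqr_ge0.
have ctf y : continuous (fun p => V p * tf k y p).
  by move=> p; apply: cvgM; [exact: cV|exact: tf_continuous].
have cg : continuous (fun p => c * (V p * tf k 0 p) + s * (V p * tf k x1 p)).
  by move=> p; apply: cvgD; apply: cvgMl_tmp; exact: ctf.
have E : c ^+ 2 + s ^+ 2 = tint (fun p => c * (V p * tf k 0 p) + s * (V p * tf k x1 p)).
  rewrite tintD; [|by move=> p; apply: cvgMl_tmp; exact: ctf|by move=> p; apply: cvgMl_tmp;
      exact: ctf].
  by rewrite !tintZ// !expr2.
(* Bessel's inequality by completing the square: with f, g the cosine and sine modes and f^2 + g^2 =
   1, V^2 minus this integrand is the sum of the squares of V - (c f + s g) and s f - c g. *)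
have {}E : c ^+ 2 + s ^+ 2 = tint (fun p => 2 * (c * (V p * tf k 0 p) + s * (V p * tf k x1 p))
    - (c ^+ 2 + s ^+ 2)).
  rewrite (tintD (f := fun p => 2 * (c * (V p * tf k 0 p) + s * (V p * tf k x1 p)))
    (g := cst (- (c ^+ 2 + s ^+ 2)))); last 2 first.
  - by move=> p; apply: cvgMl_tmp; exact: cg.
  - exact: cst_continuous.
  by rewrite tintZ// -E tint_cst; ring.
rewrite {}E L2E -tintZ//; apply: tint_le.
- by move=> p; apply: cvgB; [apply: cvgMl_tmp; exact: cg|exact: cvg_cst].
- by move=> p; apply: cvgMl_tmp; exact: csn.
move=> p.
have Vb : V p ^+ 2 <= 2 * sqnorm3 (B t p).
  have : bc B (ax n) t p ^+ 2 + bc B (ax n.+1) t p ^+ 2 <= sqnorm3 (B t p).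
    rewrite /sqnorm3 (bigD1 (ax n))//= (bigD1 (ax n.+1))/= ?ax_neqS// addrA lerDl.
    by apply: sumr_ge0 => i _; exact: sqr_ge0.
  rewrite /V; move: (bc _ _ _ _) (bc _ _ _ _) => a b.
  by have := sqr_ge0 (a + b); rewrite sqrrD sqrrB; lra.
apply: le_trans Vb.
have tt : tf k 0 p ^+ 2 + tf k x1 p ^+ 2 = 1.
  by rewrite /tf addr0 cosBpihalf cos2Dsin2.
move: (V p) (tf k 0 p) (tf k x1 p) tt => v f g tt; rewrite -subr_ge0.
rewrite (_ : _ - _ = (v - (c * f + s * g)) ^+ 2 + (s * f - c * g) ^+ 2
  + (c ^+ 2 + s ^+ 2) * (1 - (f ^+ 2 + g ^+ 2))); last by ring.
by rewrite tt subrr mulr0 addr0 addr_ge0 ?sqr_ge0.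
Qed.

(** The cosine part is [2 * Num.sqrt 2] times the mean 1/2 of a squared cosine; the sine part can
    only add to the modulus. *)
Lemma amplitude0 : 2 <= csq (amplitude B 0).
Proof.
have [_ _ _ _ B0] := hB.
have e0 p : bc B (ax 0) 0 p = 0.
  by rewrite /bc B0 /initial_field comp3Z /comp3 axE/= mulr0.
have e1 p : bc B (ax 1) 0 p = - (2 * Num.sqrt 2) * cos (2 * pi * p.1.1).
  by rewrite /bc B0 /initial_field comp3Z /comp3 axE/= mulr1.
have t1 p : tf (unit_mode (ax 0)) 0 p = cos (2 * pi * p.1.1).
  rewrite /tf addr0 /dot (bigD1 (ax 0))//= big1 ?addr0.
    by rewrite /unit_mode eqxx mul1r /comp3 axE.
  by move=> j j0; rewrite /unit_mode eq_sym (negbTE j0) mul0r.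
have ctf k y : continuous (tf k y : R3 R -> R) by exact: tf_continuous.
suff -> : amplitude B 0 = (Num.sqrt 2 +i* dfc B (ax 0) (ax 1) (unit_mode (ax 0)) (- (pi / 2)) 0)%C.
  by rewrite /csq/= sqr_sqrtr// lerDl sqr_ge0.
rewrite /amplitude; congr (_ +i* _)%C.
rewrite /dfc /fc (_ : tint _ = 0); last first.
  by rewrite -[RHS](@tint_cst R 0); apply: tint_eq => p; rewrite e0 mul0r.
pose k := unit_mode (ax 0); pose kp j := k j + k j; pose km j := k j - k j.
rewrite (_ : tint _ = - (2 * Num.sqrt 2) * (2^-1 * (tint (tf kp 0) + tint (tf km 0)))).
  rewrite (@tint_tf0 kp 0 (ax 0)); last by rewrite /kp /k /unit_mode eqxx.
  rewrite (_ : tint (tf km 0) = 1); first by field.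
  rewrite -[RHS](@tint_cst R 1); apply: tint_eq => p.
  by rewrite /tf addr0 /dot big1 ?mulr0 ?cos0// => j _; rewrite /km subrr mul0r.
have cs : continuous (fun p => tf kp 0 p + tf km 0 p) by move=> p; apply: cvgD; exact: ctf.
have cs2 : continuous (fun p => 2^-1 * (tf kp 0 p + tf km 0 p)).
  by move=> p; apply: cvgMl_tmp; exact: cs.
rewrite -tintD// -(tintZ _ cs) -(tintZ _ cs2).
by apply: tint_eq => p; rewrite e1 -t1 -mulrA tfM addr0 subr0.
Qed.

End Solution.
End FourierAmplitudes.

(** * Growth *)

Section SummableMoments.
Context {R : realType} d (T : measurableType d) (P : probability T R).

(** [s] is the sum of the series. Where the sum is infinite [fine] returns 0, so the pointwise bound
    holds only almost everywhere, namely where the integrable sum is finite. *)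
Lemma summable_moments (f : nat -> T -> \bar R) (r : R) : 0 < r < 1 ->
  (forall n, measurable_fun setT (f n)) -> (forall n w, (0 <= f n w)%E) ->
  (forall n, (\int[P]_w f n w <= (r ^+ n)%:E)%E) ->
  exists s : T -> R, [/\ measurable_fun setT s, forall w, 0 <= s w,
    {ae P, forall w, forall n, (f n w <= (s w)%:E)%E} &
    (\int[P]_w (s w)%:E <= ((1 - r)^-1)%:E)%E].
Proof.
move=> /andP[r0 r1] mf f0 fr.
pose S w : \bar R := (\sum_(0 <= n <oo) f n w)%E.
have S0 w : (0 <= S w)%E by exact: nneseries_ge0.
have mS : measurable_fun setT S.
  by apply: (ge0_emeasurable_sum (P := predT)) => [n w _ _|n _]; [exact: f0|exact: mf].
have IS : (\int[P]_w S w <= ((1 - r)^-1)%:E)%E.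
  rewrite /S integral_nneseries//.
  apply: lime_le; first by apply: is_cvg_nneseries => n _ _; exact: integral_ge0.
  apply: nearW => n; apply: (@le_trans _ _ (\sum_(0 <= i < n) (r ^+ i)%:E)%E).
    by apply: lee_sum => i _; exact: fr.
  rewrite sumEFin lee_fin -[X in _ <= X]mul1r.
  rewrite (_ : \sum_(0 <= i < n) _ = series (geometric 1 r) n).
    by apply: geometric_le_lim => //; rewrite gtr0_norm.
  by rewrite /series/=; apply: eq_bigr => i _; rewrite mul1r.
have iS : P.-integrable setT S.
  apply/integrableP; split => //.
  under eq_integral do rewrite gee0_abs//.
  by rewrite (le_lt_trans IS)// ltry.
exists (fine \o S); split.
- by apply: measurableT_comp => //; exact: fine_measurable.
- by move=> w; exact: fine_ge0.
- have := integrable_ae measurableT iS; apply: filterS => w /(_ Logic.I) fS n.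
  rewrite /= fineK//; apply: (@le_trans _ _ (\sum_(0 <= i < n.+1) f i w)%E).
    by rewrite big_nat_recr//= leeDr// sume_ge0.
  exact: nneseries_lim_ge.
- apply: le_trans IS; apply: ge0_le_integral => //.
  + by move=> w _; rewrite lee_fin fine_ge0.
  + by apply/measurable_EFinP; apply: measurableT_comp => //; exact: fine_measurable.
  + by move=> w _ /=; case: (S w) (S0 w) => [x| |] //= _; rewrite leey.
Qed.

End SummableMoments.

Section GrowthConstant.
Context {R : realType}.
Implicit Types (p s t y : R).

(** Losses in the exponent of the squared norm: 1 for [t - n <= 1], 1 for a factor 2 bounded by e,
    and twice the largest admissible heat exponent. The absolute value gives nonnegativity at
    once. *)
Definition growth_rate : R := 2 + 2 * `|ln (pi / expR 1)|.

(** Shaped so that its power [2 * p] is affine in [s], whose mean is controlled. *)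
Definition growth_constant p s : R :=
  expR ((p * growth_rate + ln (1 + s)) / (2 * p)).

Lemma growth_constant_ge1 p s : 0 < p -> 0 <= s -> 1 <= growth_constant p s.
Proof.
move=> p0 s0; rewrite -expR0 ler_expR; apply: divr_ge0; last by rewrite mulr_ge0// ltW.
apply: addr_ge0; last by rewrite ln_ge0// lerDl.
by rewrite mulr_ge0 ?(ltW p0)// addr_ge0// mulr_ge0.
Qed.

Lemma growth_constant_powR p s : 0 < p -> 0 <= s ->
  growth_constant p s `^ (2 * p) = expR (p * growth_rate) * (1 + s).
Proof.
move=> p0 s0; rewrite -expRM divfK ?mulf_neq0 ?gt_eqF// expRD lnK// posrE.
by rewrite ltr_pwDl.
Qed.

Variables (kappa : R) (eta : R -> R) (th : int -> R3 R) (B : R -> R3 R -> R3 R).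
Hypothesis kappaP : 0 <= kappa <= (4 * pi ^+ 2)^-1 * ln (pi / expR 1).
Hypothesis heta : is_time_profile eta.
Hypothesis hB : induction_solution kappa (velocity eta th) initial_field B.

Lemma decay_exponent_le : kappa * (2 * pi) ^+ 2 <= ln (pi / expR 1).
Proof.
have pi0 : 0 < 4 * pi ^+ 2 :> R by rewrite mulr_gt0// exprn_gt0// pi_gt0.
case/andP: kappaP => _; rewrite mulrC ler_pdivlMr//; apply: le_trans.
by rewrite exprMn (_ : 2 ^+ 2 = 4)// expr2 -natrM.
Qed.

(** The origin of the threshold on [kappa]: stretching gains pi per step, and heat decay must leave
    a factor e of it. *)
Lemma unit_decay_pi_ge : expR 1 <= unit_decay kappa * pi.
Proof.
have p0 : 0 < pi / expR 1 :> R by rewrite divr_gt0 ?pi_gt0 ?expR_gt0.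
have := decay_exponent_le; rewrite -ler_expR lnK// ler_pdivlMr ?expR_gt0// => h.
by rewrite /unit_decay expRN mulrC ler_pdivlMr ?expR_gt0// mulrC.
Qed.

Lemma negpow_step p n : 0 < p ->
  (negpow p (csq (step_pos kappa B n)) <= (expR (- (2 * p)))%:E * negpow p (csq (amplitude B n)))%E.
Proof.
move=> p0; rewrite csq_step_pos [in leRHS]/negpow; case: eqP => [_|/eqP y0].
  by rewrite gt0_muley ?leey// lte_fin expR_gt0.
have yp : 0 < csq (amplitude B n) by rewrite lt_neqAle eq_sym y0 csq_ge0.
have c0 : 0 < unit_decay kappa * pi by rewrite mulr_gt0 ?expR_gt0 ?pi_gt0.
have c2 : 0 < (unit_decay kappa * pi) ^+ 2 by rewrite exprn_gt0.
rewrite /negpow gt_eqF; last exact: mulr_gt0.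
rewrite -EFinM lee_fin -expRD ler_expR.
rewrite lnM ?posrE// lnXn//.
have : 1 <= ln (unit_decay kappa * pi) by rewrite -ler_expR lnK ?posrE// unit_decay_pi_ge.
set u := ln (_ * _); set v := ln _ => u1; rewrite -subr_ge0.
rewrite (_ : _ - _ = 2 * (p * (u - 1))); last by ring.
by rewrite !mulr_ge0 ?subr_ge0// ltW.
Qed.

Lemma growth_lower_bound p s n t : 0 < p -> 0 <= s -> n%:R <= t <= n%:R + 1 ->
  ((expR (p * n%:R))%:E * negpow p (csq (amplitude B n)) <= s%:E)%E ->
  (growth_constant p s)^-1 * expR (t / 2) <= L2norm (B t).
Proof.
(* A vanishing amplitude makes [negpow] infinite, against the finite bound [s]. *)
move=> p0 s0 nt; rewrite /negpow; case: eqP => [_|/eqP y0].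
  by rewrite gt0_muley ?lte_fin ?expR_gt0.
have yp : 0 < csq (amplitude B n) by rewrite lt_neqAle eq_sym y0 csq_ge0.
have kappa0 : 0 <= kappa by case/andP: kappaP.
have := amplitude_le_L2norm kappa0 heta hB nt.
rewrite -[X in _ * X <= _]lnK ?posrE// -expRD -EFinM lee_fin -expRD.
set y := ln _; set l := kappa * _; set N := L2norm _ => hN hs.
have N0 : 0 <= N by exact: sqrtr_ge0.
have hl : l <= ln (pi / expR 1) := decay_exponent_le.
have hs1 : p * n%:R + - p * y <= ln (1 + s).
  by rewrite -ler_expR lnK ?posrE ?ltr_pwDl// (le_trans hs)// lerDr.
rewrite /growth_constant -expRN -expRD; set X := _ / (2 * p).
have hX : growth_rate + n%:R - y <= 2 * X.
  rewrite (_ : 2 * X = growth_rate + ln (1 + s) / p); last by rewrite /X; field; rewrite gt_eqF.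
  rewrite -addrA lerD2l ler_pdivlMr//; move: hs1; rewrite (_ : _ + _ = (n%:R - y) * p)//; ring.
rewrite -(@ler_pXn2r _ 2) ?nnegrE ?expR_ge0// -expRM_natl.
(* Absorbs the factor 2 of [amplitude_le_L2norm]. *)
have e2 : 2 <= expR 1 :> R by exact: (expR_ge1Dx (1 : R)).
have : expR (- (2 * l) + y - 1) <= N ^+ 2.
  rewrite expRD expRN ler_pdivrMr ?expR_gt0//; apply: (le_trans hN).
  by rewrite mulrC ler_wpM2l ?sqr_ge0.
apply: le_trans; rewrite ler_expR.
have := ler_norm (ln (pi / expR 1 : R)); move: hX; rewrite /growth_rate.
case/andP: nt => _ tn; lra.
Qed.

End GrowthConstant.

Section AmplitudeMoments.
Context {R : realType} d (T : measurableType d) (P : probability T R).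
Variables (theta : int -> {RV P >-> R3 R}) (kappa : R) (eta : R -> R).
Variable B : T -> R -> R3 R -> R3 R.
Hypothesis htheta : iid_uniform_on_torus theta.
Hypothesis kappaP : 0 <= kappa <= (4 * pi ^+ 2)^-1 * ln (pi / expR 1).
Hypothesis heta : is_time_profile eta.
Hypothesis hB : forall w,
  induction_solution kappa (velocity eta (fun j => theta j w)) initial_field (B w).

Let kappa0 : 0 <= kappa. Proof. by case/andP: kappaP. Qed.

Lemma measurable_dfc_past n i j k (x : R) :
  measurable_fun setT ((fun w => dfc (B w) i j k x n%:R) :
    g_sigma_algebraType (past (phase theta) n) -> R).
Proof. by apply: measurable_funB; exact: (measurable_fc_past kappa0 heta hB). Qed.

Lemma measurable_amplitude n : measurable_fun setT (fun w => csq (amplitude (B w) n)).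
Proof.
apply: (past_measurable_fun (measurable_phase theta) (n := n)).
by apply: measurable_funD; apply: measurable_funX; exact: measurable_dfc_past.
Qed.

Variable p : R.
Hypothesis p0 : 0 < p.
Hypothesis hp : forall a b c x : R[i], (x = b \/ x = c) ->
   (\int[@lebesgue_measure R]_(s in `[0%R, 1%R[) negpow p (csq (tpoly a b c (2 * pi * s))%R)
    <= (expR (p / 2))%:E * negpow p (csq x))%E.

Lemma amplitude_moment_step n :
  (\int[P]_w negpow p (csq (amplitude (B w) n.+1)) <=
   (expR (- (3 / 2 * p)))%:E * \int[P]_w negpow p (csq (amplitude (B w) n)))%E.
Proof.
have mM (c : R) i j k x : measurable_fun setT ((fun w => c * dfc (B w) i j k x n%:R) :
    g_sigma_algebraType (past (phase theta) n) -> R).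
  by apply: measurable_funM; [exact: measurable_cst|exact: measurable_dfc_past].
have step := @expect_step R d T P (phase theta) (measurable_phase theta) (phase_indep htheta)
  p n (phase_bound htheta n hp)
  (fun w => step_const kappa (B w) n) (fun w => step_pos kappa (B w) n)
  (fun w => step_neg kappa eta (B w) n) (fun w => amplitude (B w) n.+1).
apply: (le_trans (step _ _)).
- move=> z [->|[->|->]] /=; split; try exact: mM.
  by under eq_fun do rewrite -mulNr; exact: mM.
- by move=> w; rewrite (amplitude_step heta (hB w)) csqN angle_phase.
have mneg (f : T -> R) : measurable_fun setT f -> measurable_fun setT (fun w => negpow p (f w)).
  by move=> mf; apply: (measurableT_comp (measurable_negpow p)).
have mamp := mneg _ (measurable_amplitude n).
(* [p / 2] is the loss in [expect_step], [- (2 * p)] the gain in [negpow_step]. *)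
rewrite (_ : - (3 / 2 * p) = p / 2 + - (2 * p)); last by field.
rewrite expRD EFinM -muleA; apply: lee_wpmul2l; first by rewrite lee_fin expR_ge0.
rewrite -ge0_integralZl_EFin ?expR_ge0//; last by move=> w _; exact: negpow_ge0.
apply: ge0_le_integral => //.
- by move=> w _; exact: negpow_ge0.
- under eq_fun do rewrite csq_step_pos; apply: mneg.
  by apply: measurable_funM; [exact: measurable_cst|exact: measurable_amplitude].
- by apply: measurable_funeM.
- by move=> w _; exact: negpow_step.
Qed.

Lemma amplitude_moment n :
  (\int[P]_w negpow p (csq (amplitude (B w) n)) <= (expR (- (3 / 2 * p)) ^+ n)%:E)%E.
Proof.
elim: n => [|n IH].
  rewrite expr0; apply: (@le_trans _ _ (\int[P]_w 1%E)%E); last first.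
    by rewrite integral_cst// mul1e; exact: probability_le1.
  apply: ge0_le_integral => //.
  - by move=> w _; exact: negpow_ge0.
  - by apply: (measurableT_comp (measurable_negpow p)); exact: measurable_amplitude.
  - move=> w _; have a2 := amplitude0 (hB w); rewrite /negpow gt_eqF ?(lt_le_trans _ a2)//.
    rewrite lee_fin -expR0 ler_expR mulNr oppr_le0; apply: mulr_ge0; first exact: ltW.
    by apply: ln_ge0; apply: le_trans a2; rewrite ler1n.
apply: (le_trans (amplitude_moment_step n)); rewrite exprS EFinM.
by apply: lee_wpmul2l; first by rewrite lee_fin expR_ge0.
Qed.

End AmplitudeMoments.

Theorem theorem1p1 (R : realType) (d : measure_display) (T : measurableType d)
  (P : probability T R)
  (eta : R -> R) (heta : is_time_profile eta)
  (theta : int -> {RV P >-> R3 R}) (htheta : iid_uniform_on_torus theta)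
  (B : R -> T -> R -> R3 R -> R3 R)
  (hB : forall (kappa : R) (w : T), 0 <= kappa ->
    induction_solution kappa (velocity eta (fun j => theta j w))
      initial_field (B kappa w)) :
  exists p C : R, [/\ 0 < p, 0 < C &
    forall kappa : R,
      0 <= kappa <= (4 * pi ^+ 2)^-1 * ln (pi / expR 1) ->
      exists L : {RV P >-> R},
        [/\ forall w, 1 <= L w,
            {ae P, forall w, forall t : R, 0 <= t ->
               (L w)^-1 * expR (t / 2) <= L2norm (B kappa w t)} &
            ('E_P[fun w => (L w `^ p)%R] <= C%:E)%E]].
Proof.
have [p /andP[p0 _] hp] := @neg_moment R.
(* The weight [expR p] per step against the decay [expR (- (3 / 2 * p))] of the moments. *)
pose r : R := expR (- (p / 2)).
have r01 : 0 < r < 1 by rewrite expR_gt0 -expR0 ltr_expR oppr_lt0 divr_gt0.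
have K0 : 0 < (1 - r)^-1 by rewrite invr_gt0 subr_gt0; case/andP: r01.
(* Both witnesses are fixed before [kappa]: [p] comes from [neg_moment], and the mean of [s] is at
   most [(1 - r)^-1]. *)
exists (2 * p), (expR (p * growth_rate) * (1 + (1 - r)^-1)); split.
- by rewrite mulr_gt0.
- by rewrite mulr_gt0 ?expR_gt0// addr_gt0.
move=> kappa kappaP; have kappa0 : 0 <= kappa by case/andP: kappaP.
have hBk w := hB kappa w kappa0.
pose f n w : \bar R := ((expR (p * n%:R))%:E * negpow p (csq (amplitude (B kappa w) n)))%E.
have mneg n : measurable_fun setT (fun w => negpow p (csq (amplitude (B kappa w) n))).
  by apply: (measurableT_comp (measurable_negpow p)); exact: (measurable_amplitude kappaP heta hBk).
have f0 n w : (0 <= f n w)%E by rewrite mule_ge0 ?negpow_ge0// lee_fin expR_ge0.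
have fr n : (\int[P]_w f n w <= (r ^+ n)%:E)%E.
  rewrite ge0_integralZl_EFin ?expR_ge0//; last by move=> w _; exact: negpow_ge0.
  rewrite (_ : r ^+ n = expR (p * n%:R) * expR (- (3 / 2 * p)) ^+ n); last first.
    by rewrite -!expRM_natl -expRD; congr expR; field.
  rewrite EFinM; apply: lee_wpmul2l; first by rewrite lee_fin expR_ge0.
  exact: (amplitude_moment htheta kappaP heta hBk p0 hp).
have mf n : measurable_fun setT (f n) by apply: measurable_funeM.
have [s [ms s0 fs Is]] := summable_moments r01 mf f0 fr.
have mL : measurable_fun setT (fun w => growth_constant p (s w)).
  apply: (measurableT_comp (@measurable_expR R)); apply: measurable_funM; last exact:
      measurable_cst.
  apply: measurable_funD; first exact: measurable_cst.
  apply: (measurableT_comp (@measurable_ln R)).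
  by apply: measurable_funD; [exact: measurable_cst|].
pose L : {RV P >-> R} := mfun_Sub (mem_set mL).
exists L; split.
- by move=> w; exact: growth_constant_ge1.
- apply: filterS fs => w fs t t0.
  have nt : (Num.truncn t)%:R <= t <= (Num.truncn t)%:R + 1.
    by have := truncn_itv t0; rewrite -natr1 => /andP[-> /ltW].
  exact: (growth_lower_bound kappaP heta (hBk w) p0 (s0 w) nt (fs _)).
- rewrite unlock (_ : (\int[P]_w _)%E =
      (\int[P]_w ((expR (p * growth_rate))%:E * (1 + (s w)%:E)))%E); last first.
    by apply: eq_integral => w _; rewrite /= growth_constant_powR// EFinM EFinD.
  have ms1 : measurable_fun setT (fun w => (s w)%:E) by exact/measurable_EFinP.
  rewrite ge0_integralZl_EFin ?expR_ge0//; last 2 first.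
  + by move=> w _; rewrite -EFinD lee_fin addr_ge0.
  + by apply: emeasurable_funD => //; exact: measurable_cst.
  rewrite EFinM; apply: lee_wpmul2l; first by rewrite lee_fin expR_ge0.
  rewrite ge0_integralD//; last 1 first.
  + by move=> w _; rewrite lee_fin.
  rewrite integral_cst// mul1e EFinD; apply: leeD => //.
  exact: probability_le1.
Qed.
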